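(* (i) Let $\gamma\colon(0,\infty)\to\mathcal P_2(\mathbb R)$ be a locally absolutely continuous curve and let $\mathrm F\colon L_2((0,1))\to(-\infty,\infty]$ be a functional such that the pointwise derivative $\partial_t Q_{\gamma(t)}$ exists and fulfills the $L_2$ subgradient equation $$\partial_t Q_{\gamma(t)}\in-\partial \mathrm F(Q_{\gamma(t)})\quad\text{for almost every } t\in(0,+\infty).$$ Then $\gamma$ is a Wasserstein gradient flow with respect to the functional $\mathcal F\colon\mathcal P_2(\mathbb R)\to(-\infty,+\infty]$ defined by $\mathcal F(\mu):=\mathrm F(Q_\mu)$. (ii) If $\mathrm F\colon\mathcal C((0,1))\to(-\infty,\infty]$ is convex, then the functional $\mathcal F\colon\mathcal P_2(\mathbb R)\to(-\infty,+\infty]$, $\mathcal F(\mu):=\mathrm F(Q_\mu)$, is convex along geodesics.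
   Context: $\mathcal P_2(\mathbb R)$ is the set of Borel probability measures on $\mathbb R$ with finite second moment, with the Wasserstein distance $W_2^2(\mu,\nu)=\min_{\pi\in\Gamma(\mu,\nu)}\int_{\mathbb R\times\mathbb R}|x-y|^2\,\mathrm d\pi(x,y)$, where $\Gamma(\mu,\nu)$ is the set of couplings of $\mu,\nu$; $\Gamma^{\mathrm{opt}}(\mu,\nu)$ denotes the set of minimizers. Push-forward: $T_\#\mu=\mu\circ T^{-1}$. Quantile function: for $\mu\in\mathcal P_2(\mathbb R)$, $Q_\mu(p):=\min\{x\in\mathbb R: \mu((-\infty,x])\ge p\}$, $p\in(0,1)$. $\mathcal C((0,1)):=\{Q\in L_2((0,1)): Q \text{ nondecreasing}\}$, a convex cone in $L_2((0,1))$. Regular subdifferential in $L_2((0,1))$: for $G\colon L_2((0,1))\to(-\infty,\infty]$ and $f$ with $G(f)<\infty$, $\partial G(f):=\{h\in L_2((0,1)): G(g)\ge G(f)+\langle h,g-f\rangle+o(\|g-f\|_{L_2})\ \forall g\in L_2((0,1))\}$; $\partial G(f):=\emptyset$ if $G(f)=\infty$. $L_{2,\mu}$ is the space of ($\mu$-a.e. classes of) functions $\xi\colon\mathbb R\to\mathbb R$ with $\|\xi\|_{L_{2,\mu}}^2=\int|\xi|^2\,\mathrm d\mu<\infty$. The regular tangent space at $\mu$ is $\mathrm T_\mu\mathcal P_2(\mathbb R):=\overline{\{\lambda(T-\mathrm{Id}): (\mathrm{Id},T)_\#\mu\in\Gamma^{\mathrm{opt}}(\mu,T_\#\mu),\ \lambda>0\}}^{L_{2,\mu}}$.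 Reduced Fréchet subdifferential: for $\mathcal F\colon\mathcal P_2(\mathbb R)\to(-\infty,\infty]$ and $\mu$ with $\mathcal F(\mu)<\infty$, $\partial\mathcal F(\mu)$ is the set of $\xi\in L_{2,\mu}$ with $$\mathcal F(\nu)-\mathcal F(\mu)\ge\inf_{\pi\in\Gamma^{\mathrm{opt}}(\mu,\nu)}\int_{\mathbb R^2}\xi(x)(y-x)\,\mathrm d\pi(x,y)+o(W_2(\mu,\nu))\quad\forall\nu\in\mathcal P_2(\mathbb R);$$ $\partial\mathcal F(\mu):=\emptyset$ if $\mathcal F(\mu)=\infty$. Absolutely continuous curves: a (narrowly continuous) curve $\gamma\colon I\to\mathcal P_2(\mathbb R)$ on an interval $I$ is absolutely continuous if there is a Borel velocity field $v_t\colon\mathbb R\to\mathbb R$ with $\int_I\|v_t\|_{L_{2,\gamma(t)}}\,\mathrm dt<\infty$ such that the continuity equation $\partial_t\gamma(t)+\partial_x(v_t\gamma(t))=0$ holds on $I\times\mathbb R$ in the distributional sense, i.e. $\int_I\int_{\mathbb R}\partial_t\varphi(t,x)+v_t(x)\,\partial_x\varphi(t,x)\,\mathrm d\gamma(t)(x)\,\mathrm dt=0$ for all $\varphi\in C_c^\infty(I\times\mathbb R)$. Locally absolutely continuous means this with the integrability condition on compact subintervals. Wasserstein gradient flow with respect to $\mathcal F\colon\mathcal P_2(\mathbb R)\to(-\infty,+\infty]$: a locally absolutely continuous curve $\gamma\colon(0,+\infty)\to\mathcal P_2(\mathbb R)$ with velocity field $v_t\in\mathrm T_{\gamma(t)}\mathcal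 P_2(\mathbb R)$ satisfying $v_t\in-\partial\mathcal F(\gamma(t))$ for a.e. $t>0$. Geodesic: a curve $\gamma\colon I\to\mathcal P_2(\mathbb R)$ for which there is $C\ge0$ with $W_2(\gamma(t_1),\gamma(t_2))=C|t_2-t_1|$ for all $t_1,t_2\in I$. $\mathcal F$ is convex along geodesics if for all $\mu,\nu$ with $\mathcal F(\mu),\mathcal F(\nu)<\infty$ there is at least one geodesic $\gamma\colon[0,1]\to\mathcal P_2(\mathbb R)$ from $\mu$ to $\nu$ with $\mathcal F(\gamma(t))\le(1-t)\mathcal F(\mu)+t\mathcal F(\nu)$ for $t\in[0,1]$. *)

(* Defs.v *)
From HB Require Import structures.
From mathcomp Require Import all_boot all_order all_algebra.
From mathcomp Require Import all_classical all_reals all_analysis.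

Set Implicit Arguments.
Unset Strict Implicit.
Unset Printing Implicit Defensive.

Import Order.TTheory GRing.Theory Num.Theory.
Import numFieldNormedType.Exports.

Local Open Scope classical_set_scope.
Local Open Scope ring_scope.

Section Wasserstein.
Context {R : realType}.

Record P2 := MkP2 {
  P2_prob :> probability R R ;
  P2_moment2 : (\int[P2_prob]_x (x ^+ 2)%:E < +oo)%E
}.

(** Library measures are functions on all subsets; as Borel measures they are
    equal when they agree on the measurable ones. *)
Definition eqP2 (mu nu : P2) : Prop :=
  forall A : set R, measurable A -> mu A = nu A.

Definition coupling (mu nu : P2) : set (probability (R * R)%type R) :=
  [set pi | forall A : set R, measurable A ->
     pi (A `*` setT) = mu A /\ pi (setT `*` A) = nu A].

Definition cost (pi : probability (R * R)%type R) : \bar R :=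
  (\int[pi]_z ((z.1 - z.2) ^+ 2)%:E)%E.

Definition opt_coupling (mu nu : P2) : set (probability (R * R)%type R) :=
  [set pi | coupling mu nu pi /\
     forall rho, coupling mu nu rho -> (cost pi <= cost rho)%E].

(** The infimum is finite (second moments) and attained. *)
Definition W2 (mu nu : P2) : R :=
  Num.sqrt (fine (ereal_inf (cost @` coupling mu nu))).

(** For [0 < p < 1] the infimum is a minimum, by right-continuity of the
    distribution function; the values at other [p] are irrelevant. *)
Definition quantile (mu : P2) (p : R) : R :=
  inf [set x : R | (p%:E <= mu `]-oo, x]%classic)%E].

(** [L_2((0,1))] is represented by measurable functions on [R] that are
    square-integrable for [leb01], modulo equality [leb01]-a.e. *)
Definition leb01 : {measure set (measurableTypeR R) -> \bar R} :=
  mrestr lebesgue_measure (measurable_itv `]0%R, 1%R[).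

Definition L2_01 : set (R -> R) := [set f | f \in Lfun leb01 2%:E].

Definition L2_01_norm (f : R -> R) : R := fine ('N[leb01]_2[EFin \o f])%E.

Definition L2_01_inner (f g : R -> R) : R := \int[leb01]_p (f p * g p).

(** A class belongs to the cone iff it has a representative in this set. *)
Definition cone01 : set (R -> R) :=
  [set f | L2_01 f /\
     forall p q, 0 < p -> p <= q -> q < 1 -> f p <= f q].

(** [F] induces a map from the a.e.-classes of elements of [D] to
    [(-oo, +oo]]; its values outside [D] are irrelevant. *)
Definition functional_on (D : set (R -> R)) (F : (R -> R) -> \bar R) : Prop :=
  (forall f, D f -> F f != -oo%E) /\
  (forall f g, D f -> D g -> {ae leb01, forall p, f p = g p} -> F f = F g).

Definition L2_subdiff (G : (R -> R) -> \bar R) (f : R -> R) : set (R -> R) :=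
  [set h | [/\ L2_01 h, (G f < +oo)%E &
     forall e : R, 0 < e -> exists2 d : R, 0 < d &
       forall g, L2_01 g -> L2_01_norm (g \- f) < d ->
         (G f + (L2_01_inner h (g \- f)%R - e * L2_01_norm (g \- f)%R)%:E
            <= G g)%E]].

Definition tangent_dir (mu : P2) : set (R -> R) :=
  [set xi | exists (T : R -> R) (lambda : R) (nu : P2)
                   (pi : probability (R * R)%type R),
     [/\ measurable_fun setT T, 0 < lambda,
         (forall A : set R, measurable A -> nu A = pushforward mu T A),
         (forall B : set (R * R), measurable B ->
            pi B = pushforward mu (fun x => (x, T x)) B) /\
         opt_coupling mu nu pi &
         xi = (fun x => lambda * (T x - x))]].

Definition tangent (mu : P2) : set (R -> R) :=
  [set xi | xi \in Lfun mu 2%:E /\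
     forall e : R, 0 < e -> exists2 eta, tangent_dir mu eta &
       ('N[mu]_2[EFin \o (xi \- eta)%R] < e%:E)%E].

Definition frechet_subdiff (F : P2 -> \bar R) (mu : P2) : set (R -> R) :=
  [set xi | [/\ xi \in Lfun mu 2%:E, (F mu < +oo)%E &
     forall e : R, 0 < e -> exists2 d : R, 0 < d &
       forall nu : P2, W2 mu nu < d ->
         (ereal_inf [set \int[pi]_z (xi z.1 * (z.2 - z.1))%:E
                    | pi in opt_coupling mu nu]
            - (e * W2 mu nu)%:E <= F nu - F mu)%E]].

(** [k]-times continuously differentiable functions on the plane, through
    iterated partial derivatives taken in any order. *)
Fixpoint Ck (k : nat) (phi : R^o * R^o -> R^o) : Prop :=
  continuous phi /\
  if k is k'.+1 then
    [/\ forall z, derivable phi z (1, 0), forall z, derivable phi z (0, 1),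
        Ck k' ('D_((1, 0) : R^o * R^o) phi) &
        Ck k' ('D_((0, 1) : R^o * R^o) phi)]
  else True.

(** [C_c^oo (I x R)] for an open interval [I]; test functions are extended by
    zero to the plane. *)
Definition test_function (I : set R) (phi : R^o * R^o -> R^o) : Prop :=
  [/\ forall k, Ck k phi,
      compact (closure [set z | phi z != 0]) &
      closure [set z | phi z != 0] `<=` I `*` setT].

Definition narrowly_continuous (I : set R) (gamma : R -> P2) : Prop :=
  forall f : R -> R, continuous f -> (exists M : R, forall x, `|f x| <= M) ->
    {within I, continuous (fun t => \int[gamma t]_x f x : R)}.

Definition continuity_equation (I : set R) (gamma : R -> P2)
    (v : R -> R -> R) : Prop :=
  forall phi, test_function I phi ->
    (\int[lebesgue_measure]_(t in I) \int[gamma t]_x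
       ('D_((1, 0) : R^o * R^o) phi (t, x) +
        v t x * 'D_((0, 1) : R^o * R^o) phi (t, x))%:E = 0)%E.

(** Curves on [I] are functions on [R] whose values outside [I] are
    irrelevant. *)
Definition loc_velocity_field (I : set R) (gamma : R -> P2)
    (v : R -> R -> R) : Prop :=
  [/\ measurable_fun (I `*` setT) (fun z : R * R => v z.1 z.2),
      forall a b : R, `[a, b] `<=` I ->
        (\int[lebesgue_measure]_(t in `[a, b]) 'N[gamma t]_2[EFin \o v t]
           < +oo)%E &
      continuity_equation I gamma v].

Definition loc_abs_continuous (I : set R) (gamma : R -> P2) : Prop :=
  narrowly_continuous I gamma /\ exists v, loc_velocity_field I gamma v.

Definition wasserstein_gradient_flow (F : P2 -> \bar R)
    (gamma : R -> P2) : Prop :=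
  narrowly_continuous `]0, +oo[ gamma /\
  exists2 v, loc_velocity_field `]0, +oo[ gamma v &
    {ae lebesgue_measure, forall t : R, 0 < t ->
       tangent (gamma t) (v t) /\
       frechet_subdiff F (gamma t) (fun x => - v t x)}.

Definition geodesic01 (gamma : R -> P2) : Prop :=
  exists2 C : R, 0 <= C &
    forall s t, 0 <= s <= 1 -> 0 <= t <= 1 ->
      W2 (gamma s) (gamma t) = C * `|t - s|.

Definition convex_along_geodesics (F : P2 -> \bar R) : Prop :=
  forall mu nu : P2, (F mu < +oo)%E -> (F nu < +oo)%E ->
    exists gamma : R -> P2,
      [/\ geodesic01 gamma, eqP2 (gamma 0) mu, eqP2 (gamma 1) nu &
          forall t, 0 <= t <= 1 ->
            (F (gamma t) <= (1 - t)%:E * F mu + t%:E * F nu)%E].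

Definition convex_on (D : set (R -> R)) (F : (R -> R) -> \bar R) : Prop :=
  forall f g, D f -> D g -> forall t : R, 0 <= t <= 1 ->
    (F (fun p => (1 - t) * f p + t * g p)%R
       <= (1 - t)%:E * F f + t%:E * F g)%E.

(** At time [t] the difference quotients of [s |-> quantile (gamma s) p]
    converge for a.e. [p] in [(0,1)], with limit the class of [h]. *)
Definition quantile_derivative (gamma : R -> P2) (t : R)
    (h : R -> R) : Prop :=
  L2_01 h /\
  {ae leb01, forall p,
     is_derive (t : R^o) (1 : R^o) (fun s : R^o => quantile (gamma s) p : R^o)
       (h p)}.

End Wasserstein.

Arguments P2 R : clear implicits.

(* Main.v *)
(** In quantile coordinates [W2] is the distance of [L_2((0,1))], and
    [p |-> (Q_mu p, Q_nu p)] pushes [leb01] to an optimal coupling. Interpolating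
    quantiles linearly therefore gives geodesics, whence (ii).

    For (i), every element of [L_{2,mu}] is tangent: bounded Lipschitz [eta] are
    dense and [id + eta / l] is nondecreasing, hence optimal, for large [l]. So a
    velocity field [v] of the curve can be kept as it is, and an [L_2] subgradient
    is transported along monotone couplings as soon as [h = v_t o Q_t] almost
    everywhere, where [h] is the time derivative of [Q_t].
    Testing the continuity equation against [Psi (x + c t)] controls the
    increments of [t |-> \int Psi (Q_t + c t)]. If [W] is a primitive of a weight
    [w >= 0], monotonicity of [Q_s] and [Q_t] makes the positive part of
    [W (Q_t + c t) - W (Q_s + c s)] the increment of a primitive of [w 1_G] for a
    set [G] independent of [p], so that
      [\int (W (Q_t + c t) - W (Q_s + c s))^+ <=
         \int_s^t \int (v_r (Q_r) + c)^+ w (Q_r + c r) dp dr].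
    Dividing by [t - s], Lebesgue differentiation on the right and Fatou's lemma
    on the left give
      [\int w (Q_t + c t) (h + c)^+ <= \int w (Q_t + c t) (v_t (Q_t) + c)^+]
    for a.e. [t]. Since [v_t (Q_t)] is a function of [Q_t], [w (Q_t + c t)] may
    approximate the indicator of [v_t (Q_t) <= - c], where consequently
    [h <= - c]; the negative parts give the reverse inequality. *)

Require Import Defs.
From HB Require Import structures.
From mathcomp Require Import all_boot all_order all_algebra.
From mathcomp Require Import all_classical all_reals all_analysis.
From mathcomp Require Import measurable_realfun ring lra.

Set Implicit Arguments.
Unset Strict Implicit.
Unset Printing Implicit Defensive.

Import Order.TTheory GRing.Theory Num.Theory.
Import numFieldNormedType.Exports.

Local Open Scope classical_set_scope.
Local Open Scope ring_scope.

(** * Smooth functions on the line *)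

(** The obstacle in (i) is that [h] is a pointwise derivative only: nothing dominates the difference
    quotients of the quantiles, so one cannot differentiate under the integral, and Fatou's lemma
    yields inequalities only. Hence positive and negative parts are compared separately, and at
    every level [- c], since one inequality between integrals would not identify [h]. That [G] does
    not depend on [p] is what brings in the continuity equation: the integral over [p] of the
    increment becomes a difference of integrals of one sheared function against [gamma t] and
    [gamma s]. The indicator of [G] is not smooth, so a smooth approximation replaces it up to an
    arbitrarily small error; bounding the velocity by its positive part then removes this
    approximation, which depends on [s] and [t], from the estimate. Lebesgue differentiation costs a
    null set of times for each weight and each level. Weights and levels therefore range over
    countable families, and the weights must still approximate every Borel indicator. *)

Section Smooth.
Context {R : realType}.
Implicit Types (f g : R -> R) (n : nat).

Fixpoint Cn n f : Prop :=
  if n is n'.+1 then (forall x, derivable f x 1) /\ Cn n' (derive1 f)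
  else continuous f.

Definition smooth f := forall n, Cn n f.

Lemma is_derive_derive1 f x df : is_derive x (1 : R) f df -> derive1 f x = df.
Proof. by move=> H; rewrite derive1E derive_val. Qed.

Lemma derivable_is_derive f x : derivable f x 1 -> is_derive x (1 : R) f (derive1 f x).
Proof. by move=> H; rewrite derive1E; exact: derivableP. Qed.

Lemma CnS_is_derive n f f' :
  (forall x : R, is_derive x (1 : R) f (f' x)) -> Cn n f' -> Cn n.+1 f.
Proof.
move=> H C; split=> [x|]; first by have [] := H x.
by have -> : derive1 f = f' by apply/funext => x; exact: is_derive_derive1.
Qed.

Lemma CnW n f : Cn n.+1 f -> Cn n f.
Proof.
elim: n f => [|n IH] f [df Cf] /=; last by split=> //; exact: IH.
by move=> x; apply: differentiable_continuous; exact/derivable1_diffP.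
Qed.

Lemma Cn_cst n (c : R) : Cn n (cst c).
Proof.
elim: n c => [|n IH] c; first by move=> x; exact: cst_continuous.
by apply: (CnS_is_derive (f' := cst 0)).
Qed.

Lemma CnD n f g : Cn n f -> Cn n g -> Cn n (fun x => f x + g x).
Proof.
elim: n f g => [|n IH] f g.
  by move=> cf cg x; apply: cvgD; [exact: cf|exact: cg].
move=> [df Cf] [dg Cg]; apply: CnS_is_derive (IH _ _ Cf Cg) => x.
by apply: is_deriveD; apply: derivable_is_derive.
Qed.

Lemma CnM n f g : Cn n f -> Cn n g -> Cn n (fun x => f x * g x).
Proof.
elim: n f g => [|n IH] f g.
  by move=> cf cg x; apply: cvgM; [exact: cf|exact: cg].
move=> Cf Cg; have [df Cf'] := Cf; have [dg Cg'] := Cg.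
apply: (CnS_is_derive (f' := fun x => f x * derive1 g x + g x * derive1 f x)).
  by move=> x; apply: is_deriveM; apply: derivable_is_derive.
by apply: CnD; apply: IH => //; exact: CnW.
Qed.

Lemma CnV n f : (forall x, f x != 0) -> Cn n f -> Cn n (fun x => (f x)^-1).
Proof.
move=> f0; elim: n => [|n IH].
  by move=> cf x; apply: cvgV => //; exact: cf.
move=> Cf; have [df Cf'] := Cf.
have IHf := IH (CnW Cf).
apply: (CnS_is_derive
  (f' := fun x => - 1 * ((f x)^-1 * (f x)^-1) * derive1 f x)).
  move=> x; have := is_deriveV (f0 x) (derivable_is_derive (df x)).
  by rewrite -exprVn expr2 mulN1r.
by apply: CnM => //; apply: CnM; [exact: Cn_cst|exact: CnM].
Qed.

Lemma is_derive_affine (a b x : R) : is_derive x (1 : R) (fun y : R => a * y + b) a.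
Proof.
have -> : (fun y : R => a * y + b) = (a \*: (@id R)) + cst b by [].
apply: is_derive_eq.
by rewrite addr0 -[_ *: _]/(_ * _) mulr1.
Qed.

Lemma Cn_affine n f (a b : R) : Cn n f -> Cn n (fun x => f (a * x + b)).
Proof.
elim: n f => [|n IH] f.
  move=> cf x; apply: (@continuous_comp _ _ _ (fun y : R => a * y + b) f); last exact: cf.
  apply: cvgD; last exact: cvg_cst.
  by apply: cvgM; [exact: cvg_cst|exact: cvg_id].
move=> [df Cf]; apply: (CnS_is_derive (f' := fun x => derive1 f (a * x + b) * a)).
  move=> x; apply: (@is_derive1_comp _ f (fun y : R => a * y + b)).
    exact: derivable_is_derive.
  exact: is_derive_affine.
by apply: CnM; [exact: IH|exact: Cn_cst].
Qed.

Lemma smooth_derivable f x : smooth f -> derivable f x 1.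
Proof. by move=> /(_ 1%N)[]. Qed.
Lemma smooth_is_derive f (x : R) : smooth f -> is_derive x (1 : R) f (derive1 f x).
Proof. by move=> sf; apply/derivable_is_derive/smooth_derivable. Qed.
Lemma smooth_derive1 f : smooth f -> smooth (derive1 f).
Proof. by move=> sf n; have [] := sf n.+1. Qed.
Lemma smooth_continuous f : smooth f -> continuous f.
Proof. by move=> /(_ 0%N). Qed.

(** [flat k x = x^-k exp(-1/x)] for [x > 0]; the derivative of [flat k] is a
    combination of [flat k.+1] and [flat k.+2], whence smoothness at 0. *)
Definition flat k (x : R) : R := if 0 < x then x^-1 ^+ k * expR (- x^-1) else 0.

Lemma flat_ge0 k x : 0 <= flat k x.
Proof.
rewrite /flat; case: ifPn => // x0.
by rewrite mulr_ge0 ?expR_ge0// exprn_ge0// invr_ge0 ltW.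
Qed.

(** With [y = x^-1], this is [y^(k+1) <= (k+1)! exp y]. It makes every [flat k] continuous at 0,
    which the differentiation at 0 relies on. *)
Lemma flat_le k x : flat k x <= k.+1`!%:R * `|x|.
Proof.
rewrite /flat; case: ifPn => [x0|_]; last by rewrite mulr_ge0.
have y0 : 0 < x^-1 by rewrite invr_gt0.
rewrite (gtr0_norm x0) expRN ler_pdivrMr ?expR_gt0//.
have := expR_ge1Dxn k (ltW y0).
move=> /(le_trans (ler_wpDl ler01 (lexx _))).
rewrite ler_pdivrMr ?ltr0n ?fact_gt0// exprSr => H.
have := ler_wpM2l (ltW x0) H.
rewrite mulrCA divff ?gt_eqF// mulr1 => /le_trans; apply.
by rewrite le_eqVlt; apply/orP; left; apply/eqP; ring.
Qed.

Lemma is_derive_flat k x :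
  is_derive x (1 : R) (flat k) (- k%:R * flat k.+1 x + flat k.+2 x).
Proof.
have [x0|x0|->] := ltgtP x 0.
- rewrite /flat !ltNge (ltW x0)/= mulr0 addr0.
  apply: (@near_eq_is_derive _ _ _ (cst 0)).
  near=> y; rewrite /flat ltNge ifN// negbK ltW//; near: y.
  exact: lt_nbhsl.
- have xn0 : x != 0 by rewrite gt_eqF.
  have dV : is_derive x (1 : R) (fun y : R => y^-1) (- x ^- 2).
    have := @is_deriveV _ id x 1 1 xn0 (is_derive_id x (1 : R)).
    by rewrite -[_ *: _]/(_ * _) mulr1.
  have dX : is_derive x (1 : R) (fun y : R => y^-1 ^+ k) (k%:R * x^-1 ^+ k.-1 * - x ^- 2).
    have -> : (fun y : R => y^-1 ^+ k) = (fun y : R => y^-1) ^+ k.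
      by apply/funext => y; rewrite exprfctE.
    exact: (is_deriveX k dV).
  have dE : is_derive x (1 : R) (fun y : R => expR (- y^-1)) (expR (- x^-1) * x ^- 2).
    apply: (@is_derive1_comp _ expR (fun y : R => - y^-1)).
    by rewrite -[x ^- 2]opprK; exact: is_deriveN.
  have dF := is_deriveM dX dE.
  apply: is_derive_eq.
    apply: near_eq_is_derive dF.
    near=> y; rewrite /flat ifT//; near: y.
    exact: lt_nbhsr.
  rewrite /flat x0 -![_ *: _]/(_ * _) -exprVn.
  by case: k {dX dF} => [|k] /=; rewrite ?exprS; ring.
- rewrite {2 3}/flat ltxx mulr0 addr0.
  (* Since [flat k x = x * flat k.+1 x], the slope function at 0 is [flat k.+1] itself, and its
     continuity at 0 is all that is left. *)
  apply/is_derive1_caratheodory; exists (flat k.+1); split.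
  + move=> z; rewrite /flat ltxx !subr0; case: ifPn => z0; last by rewrite mul0r.
    by rewrite exprS; field; rewrite gt_eqF.
  + have f0 : flat k.+1 0 = 0 by rewrite /flat ltxx.
    apply/cvgrPdist_le => e e0; near=> y.
    rewrite f0 sub0r normrN ger0_norm ?flat_ge0// (le_trans (flat_le _ _))//.
    rewrite -ler_pdivlMl ?ltr0n ?fact_gt0//; near: y.
    apply: (@nbhs0_le _ R); by rewrite mulr_gt0 ?invr_gt0 ?ltr0n ?fact_gt0.
  + by rewrite /flat ltxx.
Unshelve. all: by end_near. Qed.

Lemma smooth_flat k : smooth (flat k).
Proof.
move=> n; elim: n k => [|n IH] k.
  move=> x; apply: differentiable_continuous; apply/derivable1_diffP.
  by have [] := is_derive_flat k x.
apply: (CnS_is_derive (is_derive_flat k)).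
by apply: CnD; [apply: CnM; [exact: Cn_cst|exact: IH]|exact: IH].
Qed.

(** The classical smooth transition from 0 (for [x <= 0]) to 1 (for [x >= 1]); all cut-offs and
    weights are built from it. *)
Definition sstep (x : R) : R := flat 0 x / (flat 0 x + flat 0 (1 - x)).

Lemma sstep_den_gt0 x : 0 < flat 0 x + flat 0 (1 - x).
Proof.
have [x0|x0] := ltP 0 x.
  apply: ltr_wpDr; first exact: flat_ge0.
  by rewrite /flat x0 expr0 mul1r expR_gt0.
apply: ltr_wpDl; first exact: flat_ge0.
by rewrite /flat ifT ?expr0 ?mul1r ?expR_gt0// subr_gt0; lra.
Qed.

Lemma smooth_sstep : smooth sstep.
Proof.
move=> n; apply: CnM; first exact: smooth_flat.
apply: CnV => [x|]; first by rewrite gt_eqF ?sstep_den_gt0.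
apply: CnD; first exact: smooth_flat.
have -> : (fun x : R => flat 0 (1 - x)) = (fun x => flat 0 (-1 * x + 1)).
  by apply/funext => x; congr flat; ring.
apply: Cn_affine; exact: smooth_flat.
Qed.

Lemma sstep_ge0 x : 0 <= sstep x.
Proof. by rewrite divr_ge0 ?flat_ge0// ltW ?sstep_den_gt0. Qed.

Lemma sstep_le1 x : sstep x <= 1.
Proof. by rewrite ler_pdivrMr ?sstep_den_gt0// mul1r lerDl flat_ge0. Qed.

Lemma sstep_eq0 x : x <= 0 -> sstep x = 0.
Proof. by move=> x0; rewrite /sstep {1}/flat ltNge x0/= mul0r. Qed.

Lemma sstep_eq1 x : 1 <= x -> sstep x = 1.
Proof.
move=> x1; have := sstep_den_gt0 x.
have f1 : flat 0 (1 - x) = 0 by rewrite /flat ltNge subr_le0 x1.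
by rewrite /sstep f1 addr0 => ?; rewrite divff// gt_eqF.
Qed.

Lemma bounded_supp f (a b : R) : a <= b -> continuous f ->
  (forall x, (x < a) || (b < x) -> f x = 0) -> exists M, forall x, `|f x| <= M.
Proof.
move=> ab cf f0.
have [c _ H] : exists2 c, c \in `[a, b] & forall t, t \in `[a, b] -> `|f t| <= `|f c|.
  apply: (@EVT_max _ (fun x => `|f x|)) => //.
  apply: continuous_subspaceT => x.
  exact: (continuous_comp (cf x) (@norm_continuous _ _ _)).
exists `|f c| => x; have [xab|] := boolP (x \in `[a, b]); first exact: H.
rewrite in_itv/= negb_and -!ltNge => /f0 ->; by rewrite normr0.
Qed.

Lemma derive1_near0 f (x c : R) : (\forall y \near x, f y = c) -> derive1 f x = 0.
Proof.
move=> H; apply: is_derive_derive1.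
apply: (@near_eq_is_derive _ _ _ (cst c)).
by apply: filterS H => y ->.
Qed.

Lemma derive1_sstep_bounded : exists M, forall x, `|derive1 sstep x| <= M.
Proof.
apply: (@bounded_supp _ 0 1) => //.
  exact/smooth_continuous/smooth_derive1/smooth_sstep.
move=> x /orP[x0|x1].
  apply: (@derive1_near0 _ _ 0); near=> y; apply: sstep_eq0; apply: ltW; near: y.
  exact: lt_nbhsl.
apply: (@derive1_near0 _ _ 1); near=> y; apply: sstep_eq1; apply: ltW; near: y.
exact: lt_nbhsr.
Unshelve. all: by end_near. Qed.

End Smooth.

(** * Sheared test functions *)

Section TestFunctions.
Context {R : realType}.
Implicit Types (phi psi : R^o * R^o -> R^o) (n : nat).

Lemma CkS_is_derive n phi (p1 p2 : R^o * R^o -> R^o) : continuous phi ->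
  (forall z, is_derive z ((1, 0) : R^o * R^o) phi (p1 z)) ->
  (forall z, is_derive z ((0, 1) : R^o * R^o) phi (p2 z)) ->
  Ck n p1 -> Ck n p2 -> Ck n.+1 phi.
Proof.
move=> cphi d1 d2 C1 C2; split => //; split.
- by move=> z; have [] := d1 z.
- by move=> z; have [] := d2 z.
- have -> // : 'D_((1, 0) : R^o * R^o) phi = p1.
  by apply/funext => z; have := d1 z => H; rewrite derive_val.
- have -> // : 'D_((0, 1) : R^o * R^o) phi = p2.
  by apply/funext => z; have := d2 z => H; rewrite derive_val.
Qed.

Lemma CkW n phi : Ck n.+1 phi -> Ck n phi.
Proof.
elim: n phi => [|n IH] phi [cphi [d1 d2 C1 C2]]; first by split.
split; first exact: cphi.
by split; [exact d1|exact d2|exact (IH _ C1)|exact (IH _ C2)].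
Qed.

Lemma Ck_cst n (c : R^o) : Ck n (fun=> c).
Proof.
elim: n c => [|n IH] c; first by split=> // z; exact: cst_continuous.
apply: (@CkS_is_derive _ _ (fun=> 0) (fun=> 0)) => // z; first exact: cst_continuous.
Qed.

Lemma CkD n phi psi : Ck n phi -> Ck n psi -> Ck n (fun z => phi z + psi z).
Proof.
elim: n phi psi => [|n IH] phi psi.
  by move=> [c1 _] [c2 _]; split=> // z; apply: cvgD; [exact: c1|exact: c2].
move=> [c1 [d1 e1 C1 D1]] [c2 [d2 e2 C2 D2]].
apply: (CkS_is_derive _ _ _ (IH _ _ C1 C2) (IH _ _ D1 D2)) => z.
- by apply: cvgD; [exact: c1|exact: c2].
- by apply: is_deriveD; apply: derivableP.
- by apply: is_deriveD; apply: derivableP.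
Qed.

Lemma CkM n phi psi : Ck n phi -> Ck n psi -> Ck n (fun z => phi z * psi z).
Proof.
elim: n phi psi => [|n IH] phi psi.
  by move=> [c1 _] [c2 _]; split=> // z; apply: cvgM; [exact: c1|exact: c2].
move=> C C'; have [c1 [d1 e1 C1 D1]] := C; have [c2 [d2 e2 C2 D2]] := C'.
have {}C := CkW C; have {}C' := CkW C'.
apply: (@CkS_is_derive _ _ (fun z => phi z * 'D_((1, 0) : R^o * R^o) psi z + psi z * 'D_((1, 0) : R^o * R^o) phi z)
 (fun z => phi z * 'D_((0, 1) : R^o * R^o) psi z + psi z * 'D_((0, 1) : R^o * R^o) phi z)).
- by move=> z; apply: cvgM; [exact: c1|exact: c2].
- by move=> z; apply: is_deriveM; apply: derivableP.
- by move=> z; apply: is_deriveM; apply: derivableP.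
- by apply: CkD; apply: IH.
- by apply: CkD; apply: IH.
Qed.

(** On the line through [z] in direction [v] the linear form is affine, so the difference quotient
    in the plane is literally that of a function of one variable. *)
Lemma is_derive_linear_comp (f : R -> R) (a b : R) (z v : R^o * R^o) (d : R) :
  is_derive (a * z.1 + b * z.2) (1 : R) f d ->
  is_derive z v (fun z => f (a * z.1 + b * z.2) : R^o) (d * (a * v.1 + b * v.2)).
Proof.
move=> df; set s := a * v.1 + b * v.2; set w := a * z.1 + b * z.2.
have H : is_derive (0 : R) (1 : R) (fun h : R => f (s * h + w)) (d * s).
  apply: (@is_derive1_comp _ f (fun y : R => s * y + w)).
    by rewrite mulr0 add0r.
  exact: is_derive_affine.
have E : (fun h : R => h^-1 *: (((fun z : R^o * R^o => f (a * z.1 + b * z.2) : R^o) \o shift z) (h *: v) - f w))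
  = (fun h : R => h^-1 *: (((fun h : R => f (s * h + w)) \o shift 0) (h *: 1) - f (s * 0 + w))).
  apply/funext => h /=; congr (_ *: (f _ - f _)).
    rewrite /s /w /= -![_ *: _]/(_ * _); ring.
  by rewrite mulr0 add0r.
split; first by rewrite /derivable -/w E; have [] := H.
by rewrite /derive -/w E; have [_] := H.
Qed.

Lemma continuous_linear_comp (f : R -> R) (a b : R) : continuous f ->
  continuous (fun z : R^o * R^o => f (a * z.1 + b * z.2) : R^o).
Proof.
move=> cf z; apply: (@continuous_comp _ _ _ (fun z : R^o * R^o => a * z.1 + b * z.2 : R) f).
  by apply: cvgD; apply: cvgM; do ?exact: cvg_cst; [exact: cvg_fst|exact: cvg_snd].
exact: cf.
Qed.

Lemma Ck_linear_comp (f : R -> R) (a b : R) n : smooth f ->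
  Ck n (fun z => f (a * z.1 + b * z.2) : R^o).
Proof.
elim: n f => [|n IH] f sf.
  by split=> //; exact/continuous_linear_comp/smooth_continuous.
apply: (@CkS_is_derive _ _ (fun z => derive1 f (a * z.1 + b * z.2) * a)
   (fun z => derive1 f (a * z.1 + b * z.2) * b)).
- exact/continuous_linear_comp/smooth_continuous.
- move=> z; apply: is_derive_eq.
    exact/is_derive_linear_comp/smooth_is_derive.
  by rewrite /= mulr1 mulr0 addr0.
- move=> z; apply: is_derive_eq.
    exact/is_derive_linear_comp/smooth_is_derive.
  by rewrite /= mulr1 mulr0 add0r.
- by apply: CkM; [apply/IH/smooth_derive1|exact: Ck_cst].
- by apply: CkM; [apply/IH/smooth_derive1|exact: Ck_cst].
Qed.

(** Shearing by [c] amounts to adding the constant [c] to the velocity. *)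
Definition shear_test (a P k : R -> R) (c : R) : R^o * R^o -> R^o :=
  fun z => a z.1 * (P (z.2 + c * z.1) * k z.2).

(** Brings the three factors into the shape treated by [Ck_linear_comp] and
    [is_derive_linear_comp]. *)
Lemma shear_testE (a P k : R -> R) (c : R) : shear_test a P k c =
  fun z => a (1 * z.1 + 0 * z.2) * (P (c * z.1 + 1 * z.2) * k (0 * z.1 + 1 * z.2)).
Proof.
by apply/funext => z; rewrite /shear_test !mul1r !mul0r add0r addr0 addrC.
Qed.

Lemma shear_test_Ck a P k c n : smooth a -> smooth P -> smooth k ->
  Ck n (shear_test a P k c).
Proof.
move=> sa sP sk; rewrite shear_testE.
by apply: CkM; [|apply: CkM]; exact: Ck_linear_comp.
Qed.

Lemma shear_test_D1 a P k c z : smooth a -> smooth P -> smooth k ->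
  'D_((1, 0) : R^o * R^o) (shear_test a P k c) z =
  derive1 a z.1 * (P (z.2 + c * z.1) * k z.2)
   + a z.1 * (c * derive1 P (z.2 + c * z.1) * k z.2).
Proof.
move=> sa sP sk; rewrite shear_testE.
have da := @is_derive_linear_comp a 1 0 z (1, 0) _ (smooth_is_derive _ sa).
have dP := @is_derive_linear_comp P c 1 z (1, 0) _ (smooth_is_derive _ sP).
have dk := @is_derive_linear_comp k 0 1 z (1, 0) _ (smooth_is_derive _ sk).
have := is_deriveM da (is_deriveM dP dk) => H; rewrite derive_val mulrfctE.
have -> : 1 * z.1 + 0 * z.2 = z.1 by ring.
have -> : 0 * z.1 + 1 * z.2 = z.2 by ring.
have -> : c * z.1 + 1 * z.2 = z.2 + c * z.1 by ring.
rewrite -![_ *: _]/(_ * _) /=. ring.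
Qed.

Lemma shear_test_D2 a P k c z : smooth a -> smooth P -> smooth k ->
  'D_((0, 1) : R^o * R^o) (shear_test a P k c) z =
  a z.1 * (derive1 P (z.2 + c * z.1) * k z.2 + P (z.2 + c * z.1) * derive1 k z.2).
Proof.
move=> sa sP sk; rewrite shear_testE.
have da := @is_derive_linear_comp a 1 0 z (0, 1) _ (smooth_is_derive _ sa).
have dP := @is_derive_linear_comp P c 1 z (0, 1) _ (smooth_is_derive _ sP).
have dk := @is_derive_linear_comp k 0 1 z (0, 1) _ (smooth_is_derive _ sk).
have := is_deriveM da (is_deriveM dP dk) => H; rewrite derive_val mulrfctE.
have -> : 1 * z.1 + 0 * z.2 = z.1 by ring.
have -> : 0 * z.1 + 1 * z.2 = z.2 by ring.
have -> : c * z.1 + 1 * z.2 = z.2 + c * z.1 by ring.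
rewrite -![_ *: _]/(_ * _) /=; ring.
Qed.

(** [a] bounds the support in time and keeps it at distance [u] from 0, [k] bounds it in space; [P]
    need not have compact support, so primitives of weights are admissible. *)
Lemma shear_test_function a P k c (u v N : R) :
  smooth a -> smooth P -> smooth k -> 0 < u ->
  (forall t, ~ (u <= t <= v) -> a t = 0) ->
  (forall x, ~ (- N <= x <= N) -> k x = 0) ->
  test_function `]0, +oo[ (shear_test a P k c).
Proof.
move=> sa sP sk u0 a0 k0.
have cpt : compact (`[u, v] `*` `[- N, N] : set (R^o * R^o)).
  by apply: compact_setX; exact: segment_compact.
have cl := compact_closed (@norm_hausdorff _ (R^o * R^o)%type) cpt.
have sub : closure [set z | shear_test a P k c z != 0] `<=` `[u, v] `*` `[- N, N].
  move=> z cz; apply: cl; move: z cz; apply: closure_subset.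
  move=> z /=; rewrite /shear_test => /eqP p.
  split => /=; rewrite in_itv/=; apply: contrapT => H; apply: p.
  - by rewrite a0 ?mul0r.
  - by rewrite k0 ?mulr0.
split.
- by move=> n; exact: shear_test_Ck.
- by apply: (subclosed_compact _ cpt sub); exact: closed_closure.
- move=> z /sub[/=]; rewrite in_itv/= => /andP[uz _] _; split => //=.
  by rewrite in_itv/= andbT (lt_le_trans u0).
Qed.

End TestFunctions.

(** * A countable family of smooth approximations of indicators *)

(** Codes for the weights [beval]. The family has to be countable because each
    weight comes with its own null set of exceptional times. *)
Inductive bexp := BOne | BStep of rat & nat | BNand of bexp & bexp.

Fixpoint benc e : GenTree.tree (rat * nat) :=
  match e with
  | BOne => GenTree.Node 0 [::]
  | BStep q n => GenTree.Leaf (q, n)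
  | BNand a b => GenTree.Node 0 [:: benc a; benc b]
  end.

Fixpoint bdec t : option bexp :=
  match t with
  | GenTree.Leaf (q, n) => Some (BStep q n)
  | GenTree.Node _ [:: a; b] =>
      if (bdec a, bdec b) is (Some a', Some b') then Some (BNand a' b') else None
  | GenTree.Node _ _ => Some BOne
  end.

Lemma bencK : pcancel benc bdec.
Proof. by elim=> //= a -> b ->. Qed.

HB.instance Definition _ := Countable.copy bexp (pcan_type bencK).

Lemma ae_forall_countable d (T : measurableType d) (R : realType)
  (mu : {measure set T -> \bar R}) (E : countType) (P : E -> T -> Prop) :
  (forall e, {ae mu, forall x, P e x}) -> {ae mu, forall x e, P e x}.
Proof.
move=> H; have : {ae mu, forall x n, if unpickle n is Some e then P e x else True}.
  by apply: ae_foralln => n; case: unpickle => [e|]; [exact: H|exact: aeW].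
apply: filterS => x Hx e; have := Hx (pickle e).
by rewrite pickleK.
Qed.

Section Beval.
Context {R : realType}.

(** A Boolean algebra with values in [[0, 1]]: [BNand] extends the connective from indicators to
    functions, and with [BOne] it expresses complements and unions. The steps converge to indicators
    of rational rays as their slope grows. *)
Fixpoint beval (e : bexp) (x : R) : R :=
  match e with
  | BOne => 1
  | BStep q n => sstep (n.+1%:R * (x - ratr q))
  | BNand a b => 1 - beval a x * beval b x
  end.

Lemma beval01 e x : 0 <= beval e x <= 1.
Proof.
elim: e => [|q n|a /andP[a0 a1] b /andP[b0 b1]] /=; first by rewrite ler01 lexx.
  by rewrite sstep_ge0 sstep_le1.
by rewrite subr_ge0 mulr_ile1//= lerBlDl lerDr mulr_ge0.
Qed.

Lemma beval_ge0 e x : 0 <= beval e x. Proof. by have /andP[] := beval01 e x. Qed.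
Lemma beval_le1 e x : beval e x <= 1. Proof. by have /andP[] := beval01 e x. Qed.

Lemma bstepE q n : beval (BStep q n) = fun x => sstep (n.+1%:R * x + - (n.+1%:R * ratr q)).
Proof. by apply/funext => x /=; rewrite mulrBr. Qed.

Lemma smooth_beval e : smooth (beval e).
Proof.
elim: e => [|q n|a Ha b Hb] k; first exact: Cn_cst.
  by rewrite bstepE; exact/Cn_affine/smooth_sstep.
rewrite /=; apply: CnD; first exact: Cn_cst.
have -> : (fun x => - (beval a x * beval b x)) = (fun x => -1 * (beval a x * beval b x)).
  by apply/funext => x; rewrite mulN1r.
by apply: CnM; [exact: Cn_cst|apply: CnM].
Qed.

Lemma is_derive_beval e (x : R) :
  is_derive x (1 : R) (beval e) (derive1 (beval e) x).
Proof. exact/smooth_is_derive/smooth_beval. Qed.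

Lemma derive1_beval_bounded e : exists M, forall x, `|derive1 (beval e) x| <= M.
Proof.
elim: e => [|q n|a [Ma Ha] b [Mb Hb]].
- by exists 0 => x; rewrite (_ : beval BOne = cst 1)// derive1_cst normr0.
- have [M HM] := @derive1_sstep_bounded R.
  exists (M * n.+1%:R) => x; rewrite bstepE.
  have D : is_derive x (1 : R) (fun y : R => sstep (n.+1%:R * y + - (n.+1%:R * ratr q)))
      (derive1 sstep (n.+1%:R * x + - (n.+1%:R * ratr q)) * n.+1%:R).
    apply: (@is_derive1_comp _ sstep (fun y : R => n.+1%:R * y + - (n.+1%:R * ratr q))).
      exact/smooth_is_derive/smooth_sstep.
    exact: is_derive_affine.
  by rewrite (is_derive_derive1 D) normrM ler_pM// ger0_norm.
- exists (Mb + Ma) => x.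
  have D : is_derive x (1 : R) (beval (BNand a b))
    (0 - (beval a x * derive1 (beval b) x + beval b x * derive1 (beval a) x)).
    exact: (is_deriveB (is_derive_cst (1 : R) x 1)
      (is_deriveM (is_derive_beval a x) (is_derive_beval b x))).
  rewrite (is_derive_derive1 D) sub0r normrN (le_trans (ler_normD _ _))// lerD// normrM.
    rewrite -[leRHS]mul1r ler_pM//.
    by rewrite ger0_norm ?beval_ge0 ?beval_le1.
  rewrite -[leRHS]mul1r ler_pM//.
  by rewrite ger0_norm ?beval_ge0 ?beval_le1.
Qed.

Lemma measurable_beval e : measurable_fun setT (beval e).
Proof.
apply: continuous_measurable_fun; apply: smooth_continuous; exact: smooth_beval.
Qed.

Section Approx.
Context d (S : measurableType d) (mu : {measure set S -> \bar R}).
Variables (g w : S -> R).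
Hypotheses (mg : measurable_fun setT g) (w0 : forall x, 0 <= w x).
Hypothesis wi : mu.-integrable setT (EFin \o w).

(** The distance of [beval e] and the indicator of [E] in L1 of the image under [g] of the measure
    with density [w]. Both [g] a shifted quantile function and [g] the identity on the line
    occur. *)
Let err (e : bexp) (E : set R) : \bar R := (\int[mu]_x (w x * `|beval e (g x) - \1_E (g x)|)%:E)%E.

Let approx : set (set R) := [set E | measurable E /\
  forall eps : R, 0 < eps -> exists e, (err e E < eps%:E)%E].

Let mw : measurable_fun setT w.
Proof. by have /integrableP[/measurable_EFinP] := wi. Qed.

Let mI (E : set R) : measurable E -> measurable_fun setT (fun x => \1_E (g x) : R).
Proof. by move=> mE; apply: measurableT_comp mg; exact: measurable_indic. Qed.

Let mf e (E : set R) : measurable E ->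
  measurable_fun setT (fun x => (w x * `|beval e (g x) - \1_E (g x)|)%:E).
Proof.
move=> mE; apply/measurable_EFinP; apply: measurable_funM mw _.
apply: measurableT_comp => //; apply: measurable_funB; last exact: mI.
by apply: measurableT_comp mg; exact: measurable_beval.
Qed.

Let f0 e (E : set R) x : (0 <= (w x * `|beval e (g x) - \1_E (g x)|)%:E)%E.
Proof. by rewrite lee_fin mulr_ge0. Qed.

(** Dominated convergence with [w] as the dominating function. *)
Let small (f : nat -> S -> R) (eps : R) : 0 < eps -> (forall n, measurable_fun setT (f n)) ->
  (forall n x, 0 <= f n x <= 1) -> (forall x, \forall n \near \oo, f n x = 0) ->
  exists n, (\int[mu]_x (w x * f n x)%:E < eps%:E)%E.
Proof.
move=> e0 mfn f01 fz.
have [] := @dominated_convergence _ _ _ mu setT measurableT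
  (fun n x => (w x * f n x)%:E) (cst 0%E) (EFin \o w).
- by move=> n; apply/measurable_EFinP; exact: measurable_funM.
- exact: measurable_cst.
- apply: aeW => x _; apply: cvg_near_cst; have := fz x.
  by apply: filterS => n ->; rewrite mulr0.
- exact: wi.
- apply: aeW => x n _; have /andP[f0n f1n] := f01 n x.
  by rewrite /= lee_fin ger0_norm ?mulr_ge0// ler_piMr.
move=> _ _; rewrite integral0 => /fine_cvgP[ff /cvgrPdist_lt /(_ _ e0) H].
near \oo => n; exists n.
have fn : (\int[mu]_x (w x * f n x)%:E)%E \is a fin_num by near: n.
rewrite -(fineK fn) lte_fin.
apply: le_lt_trans (ler_norm _) _; rewrite -normrN -sub0r; near: n; exact: H.
Unshelve. all: by end_near. Qed.

Let approxC E : approx E -> approx (~` E).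
Proof.
move=> [mE H]; split; first exact: measurableC.
move=> eps /H[e He]; exists (BNand e BOne); apply: le_lt_trans He.
rewrite le_eqVlt; apply/orP; left; apply/eqP; apply: eq_integral => x _ /=.
congr (_%:E); congr (_ * _); rewrite mulr1 -normrN opprB; congr (`|_|).
rewrite !indicE in_setC; case: (g x \in E) => /=; ring.
Qed.

Let approxU A B : approx A -> approx B -> approx (A `|` B).
Proof.
move=> [mA HA] [mB HB]; split; first exact: measurableU.
move=> eps e0; have e20 : 0 < eps / 2 by rewrite divr_gt0.
have [a Ha] := HA _ e20; have [b Hb] := HB _ e20.
(* This evaluates to [1 - (1 - a) (1 - b)], the union for indicators; pointwise its error is at most
   the sum of the two errors. *)
exists (BNand (BNand a BOne) (BNand b BOne)).
apply: (@le_lt_trans _ _ (err a A + err b B)%E); last first.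
  by rewrite (splitr eps) EFinD; exact: lteD.
rewrite /err -ge0_integralD//; [|exact: mf..].
apply: ge0_le_integral => //; first by apply: mf; exact: measurableU.
  by apply: emeasurable_funD; exact: mf.
move=> x _; rewrite -EFinD lee_fin -mulrDr; apply: ler_wpM2l => //=; move: (g x) => {}x.
rewrite !mulr1.
have /andP[a0 a1] := beval01 a x; have /andP[b0 b1] := beval01 b x.
rewrite !indicE in_setU; case: (x \in A); case: (x \in B) => /=; rewrite ?subr0.
- rewrite (_ : _ - 1 = - ((1 - beval a x) * (1 - beval b x))); last by ring.
  rewrite normrN ger0_norm ?mulr_ge0 ?subr_ge0//.
  by rewrite distrC ger0_norm ?subr_ge0// ler_wpDr// ler_piMr ?subr_ge0// lerBlDr lerDl.
- rewrite (_ : _ - 1 = - ((1 - beval a x) * (1 - beval b x))); last by ring.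
  rewrite normrN ger0_norm ?mulr_ge0 ?subr_ge0//.
  by rewrite distrC ger0_norm ?subr_ge0// ler_wpDr// ler_piMr ?subr_ge0// lerBlDr lerDl.
- rewrite (_ : _ - 1 = - ((1 - beval a x) * (1 - beval b x))); last by ring.
  rewrite normrN ger0_norm ?mulr_ge0 ?subr_ge0//.
  rewrite (distrC (beval b x)) (ger0_norm (_ : 0 <= 1 - beval b x)) ?subr_ge0//.
  by rewrite ler_wpDl// ler_piMl ?subr_ge0// lerBlDr lerDl.
- rewrite (ger0_norm a0) (ger0_norm b0) ger0_norm.
    have -> : 1 - (1 - beval a x) * (1 - beval b x) = beval a x + beval b x - beval a x * beval b x.
      ring.
    by rewrite lerBlDr lerDl mulr_ge0.
  rewrite subr_ge0 mulr_ile1 ?subr_ge0//; first by rewrite lerBlDr lerDl.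
  by rewrite lerBlDr lerDl.
Qed.

(** A finite union carries all but [eps / 2] of the mass of the countable one, and finite unions are
    covered by [approxU]. *)
Let approx_bigcup (F : (set R)^nat) : (forall n, approx (F n)) -> approx (\bigcup_n F n).
Proof.
move=> HF; have mF n : measurable (F n) by have [] := HF n.
split; first exact: bigcupT_measurable.
move=> eps e0; have e20 : 0 < eps / 2 by rewrite divr_gt0.
set U := fun n => \big[setU/set0]_(i < n.+1) F i.
have mU n : measurable (U n) by apply: bigsetU_measurable => i _; exact: mF.
have aU n : approx (U n).
  rewrite /U; elim: n => [|n IH]; first by rewrite big_ord_recr big_ord0 /= set0U.
  by rewrite big_ord_recr /=; exact: approxU.
have mB : measurable (\bigcup_n F n) by exact: bigcupT_measurable.
have mBU n : measurable (\bigcup_n F n `\` U n).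
  by apply: measurableD; [exact: mB|exact: mU].
pose D n x : R := \1_(\bigcup_n F n `\` U n) (g x).
have mD n : measurable_fun setT (D n) by apply: mI; exact: mBU.
have D01 n x : 0 <= D n x <= 1 by rewrite /D indicE; case: (_ \in _); rewrite /= ?ler01 lexx.
have [n Hn] : exists n, (\int[mu]_x (w x * D n x)%:E < (eps / 2)%:E)%E.
  apply: small => // x; rewrite /D; have [[k _ Fk]|nF] := pselect ((\bigcup_n F n) (g x)); last first.
    by apply: nearW => n; rewrite indicE memNset// => -[].
  near=> n; rewrite indicE memNset// => -[_]; apply.
  rewrite /U -bigcup_mkord; exists k => //=; rewrite ltnS; near: n; exact: nbhs_infty_ge.
have [_ HU] := aU n; have [e He] := HU _ e20; exists e.
apply: (@le_lt_trans _ _ (err e (U n) + \int[mu]_x (w x * D n x)%:E)%E); last first.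
  by rewrite (splitr eps) EFinD; exact: lteD.
have mDE : measurable_fun setT (fun x => (w x * D n x)%:E).
  by apply/measurable_EFinP; exact: measurable_funM.
have D0 x : (0 <= (w x * D n x)%:E)%E by have /andP[? _] := D01 n x; rewrite lee_fin mulr_ge0.
rewrite /err -ge0_integralD//; last exact: mf.
apply: ge0_le_integral => //; first exact: mf.
  by apply: emeasurable_funD => //; exact: mf.
move=> x _; rewrite -EFinD lee_fin -mulrDr; apply: ler_wpM2l => //; rewrite /D; move: (g x) => {}x.
have -> : \1_(\bigcup_n F n) x = \1_(U n) x + \1_(\bigcup_n F n `\` U n) x :> R.
  have UB : U n `<=` \bigcup_n F n.
    by rewrite /U -bigcup_mkord => y [i _ Fi]; exists i.
  rewrite !indicE in_setD; case: (boolP (x \in U n)) => xU /=; last by rewrite andbT add0r.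
  by rewrite mem_set ?addr0//; apply: UB; exact: set_mem.
rewrite opprD addrA (le_trans (ler_normB _ _))// lerD2l ger0_norm//.
Unshelve. all: by end_near. Qed.

(** The steps vanish up to [q] included and are eventually 1 at each point beyond, so they converge
    to the indicator of the open ray. *)
Let approx_oray_rat (q : rat) : approx `]ratr q, +oo[%classic.
Proof.
split; first exact: measurable_itv.
move=> eps e0; have mQ : measurable (`]ratr q, +oo[%classic : set R) by exact: measurable_itv.
have [n Hn] : exists n,
    (\int[mu]_x (w x * `|beval (BStep q n) (g x) - \1_(`]ratr q, +oo[%classic) (g x)|)%:E < eps%:E)%E.
  apply: (@small (fun n x => `|beval (BStep q n) (g x) - \1_(`]ratr q, +oo[%classic) (g x)|)) => //.
  - move=> n; apply: measurableT_comp => //; apply: measurable_funB; last exact: mI.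
    by apply: measurableT_comp mg; exact: measurable_beval.
  - move=> n x; rewrite normr_ge0 indicE/=.
    have /andP[b0 b1] := beval01 (BStep q n) (g x); rewrite /= in b0 b1.
    by rewrite ler_norml; case: (_ \in _) => /=; apply/andP; split; lra.
  - move=> x; rewrite indicE; have [xq|qx] := leP (g x) (ratr q).
      rewrite memNset/= ?in_itv/= ?andbT ?ltNge ?xq//.
      by near=> n; rewrite sstep_eq0 ?subrr ?normr0// mulr_ge0_le0// subr_le0.
    rewrite mem_set/= ?in_itv/= ?andbT//.
    near=> n; rewrite sstep_eq1 ?subrr ?normr0//.
    rewrite -ler_pdivrMr ?subr_gt0//.
    rewrite (@le_trans _ _ n%:R)//; last by rewrite ler_nat.
    by near: n; exact: nbhs_infty_ger.
by exists (BStep q n).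
Unshelve. all: by end_near. Qed.

(** The sets in [approx] form a sigma-algebra that contains the open rays, hence every Borel set. *)
Lemma beval_approx (E : set R) (eps : R) : measurable E -> 0 < eps ->
  exists e, (\int[mu]_x (w x * `|beval e (g x) - \1_E (g x)|)%:E < eps%:E)%E.
Proof.
move=> mE e0; suff [_ /(_ _ e0)] : approx E by [].
have : @measurable _ (measurableTypeR R) E by [].
rewrite RGenOInfty.measurableE.
move: E {mE}; apply: smallest_sub.
  split.
  - split; first exact: measurable0.
    move=> ? ?; exists (BNand BOne BOne); rewrite /err integral0_eq// => x _.
    by rewrite /= mulr1 subrr indicE in_set0 subrr normr0 mulr0.
  - by move=> A HA; rewrite setTD; exact: approxC.
  - by move=> F HF; exact: approx_bigcup.
move=> _ [x ->].
(* Codes exist for rational rays only; a real ray is the union of the rational rays inside it. *)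
pose Fq (o : option rat) : set R :=
   if o is Some q then if x < ratr q then `]ratr q, +oo[%classic else set0 else set0.
have -> : `]x, +oo[%classic = \bigcup_n Fq (unpickle n).
  apply/seteqP; split => y.
    rewrite /= in_itv/= andbT => xy; have [q] := rat_in_itvoo xy.
    rewrite in_itv/= => /andP[xq qy]; exists (pickle q); first exact: I.
    by rewrite pickleK /Fq xq /= in_itv/= qy.
  move=> [n _]; rewrite /Fq; case: unpickle => // q; case: ifPn => // xq.
  by rewrite /= !in_itv/= !andbT; exact: lt_trans.
apply: approx_bigcup => n; rewrite /Fq.
have a0 : approx set0.
  split; first exact: measurable0.
  move=> ? ?; exists (BNand BOne BOne); rewrite /err integral0_eq// => y _.
  by rewrite /= mulr1 subrr indicE in_set0 subrr normr0 mulr0.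
case: unpickle => // q; case: ifPn => // _; exact: approx_oray_rat.
Qed.

End Approx.
End Beval.

(** * Quantile functions *)

Section Law.
Context d (T : measurableType d) (R : realType) d' (T' : measurableType d').
Variables (P : probability T R) (f : T -> T') (mf : measurable_fun setT f).

Definition law : probability T' R := distribution P (mfun_Sub (mem_set mf)).

Lemma lawE A : law A = P (f @^-1` A). Proof. by []. Qed.

End Law.

Lemma integral_image d (T : measurableType d) (R : realType) d'
  (T' : measurableType d') (m : {measure set T -> \bar R}) (nu : {measure set T' -> \bar R})
  (f : T -> T') (g : T' -> \bar R) :
  measurable_fun setT f -> (forall A, measurable A -> nu A = m (f @^-1` A)) ->
  measurable_fun setT g ->
  (\int[nu]_y g y = \int[m]_x g (f x))%E.
Proof.
move=> mf Hnu mg.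
have key (h : T' -> \bar R) : measurable_fun setT h -> (forall y, 0 <= h y)%E ->
    (\int[nu]_y h y = \int[m]_x h (f x))%E.
  move=> mh h0.
  rewrite (eq_measure_integral (pushforward m f)); last by move=> A mA _; exact: Hnu.
  by rewrite ge0_integral_pushforward.
rewrite [LHS]integralE [RHS]integralE; congr (_ - _)%E.
  by rewrite (key _ (measurable_funepos mg) (fun y => funepos_ge0 g y)); apply: eq_integral => x _; rewrite !funeposE.
by rewrite (key _ (measurable_funeneg mg) (fun y => funeneg_ge0 g y)); apply: eq_integral => x _; rewrite !funenegE.
Qed.

Section Unif.
Context {R : realType}.
Local Notation mu := (@lebesgue_measure R).

Lemma leb01E (A : set R) : measurable A -> @leb01 R A = mu (A `&` `]0, 1[).
Proof. by []. Qed.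

Lemma leb01T : @leb01 R setT = 1%E.
Proof.
by rewrite leb01E// setTI lebesgue_measure_itv/= lte_fin ltr01 oppr0 adde0.
Qed.

(** [leb01] under a separate name, to carry a [probability] structure. *)
Definition U01 : set (measurableTypeR R) -> \bar R := @leb01 R.

Let U01_0 : U01 set0 = 0%E. Proof. exact: measure0. Qed.
Let U01_ge0 A : (0 <= U01 A)%E. Proof. exact: measure_ge0. Qed.
Let U01_sa : semi_sigma_additive U01. Proof. exact: measure_semi_sigma_additive. Qed.
HB.instance Definition _ := isMeasure.Build _ _ _ U01 U01_0 U01_ge0 U01_sa.
HB.instance Definition _ := Measure_isProbability.Build _ _ _ U01 leb01T.

#[global] Instance ae_U01_filter : Filter (almost_everywhere U01).
Proof. exact: (ae_filter_ringOfSetsType U01). Qed.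

Lemma ae_leb01 (P : R -> Prop) : {ae @leb01 R, forall p, P p} <-> {ae U01, forall p, P p}.
Proof. by split. Qed.

Lemma ae_U01_itv : {ae U01, forall p : R, 0 < p < 1}.
Proof.
exists (~` `]0, 1[); split; first by apply: measurableC; exact: measurable_itv.
  by rewrite [U01 _]leb01E ?setICl ?measure0//; apply: measurableC; exact: measurable_itv.
by move=> p /=; rewrite in_itv/= => np.
Qed.

Lemma ae_U01P (P : R -> Prop) :
  (forall p, 0 < p < 1 -> P p) -> {ae U01, forall p, P p}.
Proof.
move=> H; have A := ae_U01_itv.
apply: filterS A => p; exact: H.
Qed.

Lemma U01_le (c : R) : 0 <= c <= 1 -> U01 [set p | p <= c] = c%:E.
Proof.
move=> /andP[c0 c1]; rewrite (_ : [set p | p <= c] = `]-oo, c]%classic); last first.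
  by apply/seteqP; split => p /=; rewrite in_itv.
rewrite [U01 _]leb01E; last exact: measurable_itv.
move: c1; rewrite le_eqVlt => /predU1P[->|c1].
  rewrite (_ : _ `&` _ = `]0, 1[%classic); last first.
    apply/seteqP; split => p /=; rewrite !in_itv/=; first by case.
    by move=> /andP[p0 p1]; rewrite (ltW p1) p0 p1.
  by rewrite lebesgue_measure_itv/= lte_fin ltr01 oppr0 adde0.
rewrite (_ : _ `&` _ = `]0, c]%classic); last first.
  apply/seteqP; split => p /=; rewrite !in_itv/=; first by case=> -> /andP[->].
  by move=> /andP[p0 pc]; rewrite p0 pc (le_lt_trans pc).
rewrite lebesgue_measure_itv/= lte_fin; case: ltP => [_|c0']; first by rewrite oppr0 adde0.
by congr (_%:E); apply/eqP; rewrite eq_le c0 c0'.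
Qed.

End Unif.

Section Quantile.
Context {R : realType}.
Implicit Types (m : P2 R).

Definition cdf2 m (x : R) : R := fine (m `]-oo, x]%classic).

Lemma cdf2_cdf m (x : R) : cdf (P := P2_prob m) (mfun_Sub (mem_set (@measurable_id _ _ setT))) x
  = m `]-oo, x]%classic.
Proof. by []. Qed.

Lemma cdf2E m x : m `]-oo, x]%classic = (cdf2 m x)%:E.
Proof. by rewrite /cdf2 fineK// fin_num_measure. Qed.

Lemma cdf2_01 m x : 0 <= cdf2 m x <= 1.
Proof. by rewrite -!lee_fin -cdf2E measure_ge0 probability_le1. Qed.

Lemma cdf2_nd m : {homo cdf2 m : x y / x <= y}.
Proof.
move=> x y xy; rewrite -lee_fin -!cdf2E le_measure ?inE//.
by apply: subset_itv => //=; rewrite bnd_simp.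
Qed.

Lemma cdf2_rc m x p : (forall y, x < y -> p <= cdf2 m y) -> p <= cdf2 m x.
Proof.
move=> H.
have := @cdf_right_continuous _ _ _ (P2_prob m) (mfun_Sub (mem_set (@measurable_id _ _ setT))) x.
rewrite cdf2_cdf cdf2E => /fine_cvgP[_ cv].
have : cdf2 m y @[y --> x^'+] --> cdf2 m x by exact: cv.
move=> {}cv; rewrite leNgt; apply/negP => lt.
have : \forall y \near x^'+, cdf2 m y < p by exact: (cvgr_lt _ cv).
move=> nr; near x^'+ => y.
have : cdf2 m y < p by near: y.
rewrite ltNge H//.
Unshelve. all: by end_near. Qed.

Lemma cdf2_y m p : p < 1 -> exists x, p <= cdf2 m x.
Proof.
move=> p1.
have := @cvg_cdfy1 _ _ _ (P2_prob m) (mfun_Sub (mem_set (@measurable_id _ _ setT))).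
move=> /fine_cvgP[_ cv].
have {}cv : cdf2 m y @[y --> +oo] --> (1:R) by exact: cv.
have : \forall y \near +oo, p < cdf2 m y by exact: (cvgr_gt _ cv).
move=> nr; near (pinfty_nbhs R) => y; exists y; apply: ltW; near: y; exact: nr.
Unshelve. all: by end_near. Qed.

Lemma cdf2_Ny m p : 0 < p -> exists x, cdf2 m x < p.
Proof.
move=> p1.
have := @cvg_cdfNy0 _ _ _ (P2_prob m) (mfun_Sub (mem_set (@measurable_id _ _ setT))).
move=> /fine_cvgP[_ cv].
have {}cv : cdf2 m y @[y --> -oo] --> (0:R) by exact: cv.
have : \forall y \near -oo, cdf2 m y < p by exact: (cvgr_lt _ cv).
move=> nr; near (ninfty_nbhs R) => y; exists y; near: y; exact: nr.
Unshelve. all: by end_near. Qed.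

(** The Galois connection of quantile and distribution function: right-continuity of [cdf2 m] puts
    the infimum into the set. Monotonicity, left-continuity and measurability of quantiles are read
    off from it. *)
Lemma quantile_le m (p x : R) : 0 < p < 1 -> (quantile m p <= x) = (p <= cdf2 m x).
Proof.
move=> /andP[p0 p1]; rewrite /quantile.
have -> : [set x | (p%:E <= m `]-oo, x]%classic)%E] = [set x | p <= cdf2 m x].
  by apply/seteqP; split => y /=; rewrite cdf2E lee_fin.
have [y0 Hy0] := cdf2_Ny m p0.
have lb : has_lbound [set x | p <= cdf2 m x].
  exists y0 => y /= py; rewrite leNgt; apply/negP => yy0.
  by have := lt_le_trans Hy0 py; rewrite ltNge cdf2_nd// ltW.
have [y1 Hy1] := cdf2_y m p1.
have ne : [set x | p <= cdf2 m x] !=set0 by exists y1.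
apply/idP/idP => [ix|px]; last exact: ge_inf.
apply: cdf2_rc => y xy.
have [z /= pz zy] := inf_lt ne (le_lt_trans ix xy).
by rewrite (le_trans pz)// cdf2_nd// ltW.
Qed.

Lemma quantile_nd m (p q : R) : 0 < p -> p <= q -> q < 1 -> quantile m p <= quantile m q.
Proof.
move=> p0 pq q1; rewrite quantile_le ?p0 ?(le_lt_trans pq)//.
by rewrite (le_trans pq)// -quantile_le ?q1 ?andbT// (lt_le_trans p0).
Qed.

Lemma quantile_lc m (p y : R) : 0 < p < 1 -> y < quantile m p ->
  exists2 p', 0 < p' < p & y < quantile m p'.
Proof.
move=> p01; have /andP[p0 p1] := p01.
rewrite ltNge quantile_le// -ltNge => cp.
(* Any level strictly between [cdf2 m y] and [p] has a quantile beyond [y]; the midpoint is one. *)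
exists ((Num.max 0 (cdf2 m y) + p) / 2).
  have /andP[c0 _] := cdf2_01 m y; rewrite (max_idPr c0); apply/andP; split; lra.
have /andP[c0 _] := cdf2_01 m y; rewrite (max_idPr c0).
rewrite ltNge quantile_le -?ltNge; first lra.
by apply/andP; split; lra.
Qed.

Lemma quantile_le0 m (p : R) : p <= 0 -> quantile m p = inf setT.
Proof.
move=> p0; congr inf; apply/seteqP; split => // x _ /=.
by rewrite (@le_trans _ _ 0%E)// lee_fin.
Qed.

Lemma quantile_gt1 m (p : R) : 1 < p -> quantile m p = inf set0.
Proof.
move=> p1; congr inf; apply/seteqP; split => // x /=.
rewrite cdf2E lee_fin; have /andP[_ c1] := cdf2_01 m x.
by rewrite leNgt (le_lt_trans c1).
Qed.

(** Measurability is on the whole line, so the conventional values count too: they are constant for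
    [p <= 0] and for [p > 1], and [p = 1] is a single point. On the unit interval [quantile_le]
    turns preimages of rays into rays. *)
Lemma measurable_quantile m : measurable_fun setT (quantile m).
Proof.
have -> : quantile m = fun p => if 0 < p < 1 then quantile m p
   else if p <= 0 then inf setT else if p == 1 then quantile m 1 else inf set0.
  apply/funext => p; case: ifPn => //.
  rewrite negb_and -!leNgt => H; case: ifPn => [/quantile_le0//|p0].
  case: eqP => [->//|/eqP np]; rewrite quantile_gt1//.
  by move: H; rewrite (negbTE p0)/= lt_neqAle eq_sym np.
apply: measurable_fun_if => //.
- apply: measurable_and; exact: measurable_fun_ltr.
- rewrite setTI (_ : _ @^-1` _ = `]0, 1[%classic); last first.
    by apply/seteqP; split => p /=; rewrite in_itv/=.
  move=> m01; apply: (measurability _ (RGenOInfty.measurableE R)) => //.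
  move=> _ [_ [x ->] <-].
  rewrite (_ : _ `&` _ = `]0, 1[%classic `&` `]cdf2 m x, +oo[%classic); last first.
    apply/seteqP; split => p /=; rewrite !in_itv/= !andbT => -[p01 H]; split => //.
      by rewrite ltNge -quantile_le// -ltNge.
    by rewrite ltNge quantile_le// -ltNge.
  by apply: measurableI; exact: measurable_itv.
- apply: measurable_fun_if => //.
  + rewrite setTI (_ : _ @^-1` _ = ~` `]0, 1[%classic); first by apply: measurableC; exact: measurable_itv.
    by apply/seteqP; split => p /=; rewrite in_itv/=; [move=> /negbT/negP|move=> /negP/negbTE].
  + by apply: measurable_funTS; exact: measurable_fun_ler.
  + apply: measurable_funTS; apply: measurable_fun_if => //.
    apply: measurable_fun_eqr => //.
Qed.

Lemma U01_quantile_le m (x : R) :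
  U01 (quantile m @^-1` `]-oo, x]%classic) = m `]-oo, x]%classic.
Proof.
rewrite cdf2E -U01_le ?cdf2_01//; rewrite -![U01 _]/(@leb01 R _).
have mQ : measurable (quantile m @^-1` `]-oo, x]%classic).
  by rewrite -[_ @^-1` _]setTI; apply: measurable_quantile => //; exact: measurable_itv.
rewrite !leb01E//; last first.
  rewrite (_ : [set p | p <= _] = `]-oo, cdf2 m x]%classic); first exact: measurable_itv.
  by apply/seteqP; split => p /=; rewrite in_itv.
congr (lebesgue_measure _); apply/seteqP; split => p /= [];  rewrite !in_itv/= => H p01.
  by split => //; rewrite -quantile_le.
by split => //; rewrite quantile_le.
Qed.

Lemma P2_ext (m1 m2 : probability R R) :
  (forall x : R, m1 `]-oo, x]%classic = m2 `]-oo, x]%classic) ->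
  forall A, measurable A -> m1 A = m2 A.
Proof.
move=> E1.
pose G := [set A : set R | exists x, A = `]-oo, x]%classic].
move=> A mA; refine (@measure_unique _ _ _ G
  (fun n => `]-oo, n%:R]%classic) _ _ _ _ m1 m2 _ _ A mA).
- have -> : (@measurable _ R) = (@measurable _ (measurableTypeR R)) by [].
  rewrite RGenOInfty.measurableE; apply/seteqP; split.
    apply: smallest_sub; first exact: smallest_sigma_algebra.
    move=> _ [x ->]; rewrite -setCitvl; apply: (@measurableC _ (g_sigma_algebraType G)).
    by apply: sub_sigma_algebra; exists x.
  apply: smallest_sub; first exact: smallest_sigma_algebra.
  move=> _ [x ->]; rewrite -RGenOInfty.measurableE; exact: measurable_itv.
- move=> _ _ [x ->] [y ->]; exists (Num.min x y).
  by apply/seteqP; split => z /=; rewrite !in_itv/= le_min; [case=> -> ->|move/andP].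
- by move=> n; exists n%:R.
- rewrite -subTset => x _; exists (Num.trunc `|x|).+1 => //=.
  by rewrite in_itv/= (le_trans (ler_norm _))// ltW// truncnS_gt.
- by move=> _ [x ->]; exact: E1.
- by move=> n; rewrite (le_lt_trans (probability_le1 _ _))// ltry.
Qed.

Lemma quantile_push m (A : set R) : measurable A -> m A = U01 (quantile m @^-1` A).
Proof.
move=> mA; have := @P2_ext (P2_prob m) (law U01 (@measurable_quantile m)); apply => //.
move=> x; have := U01_quantile_le m x. by move=> <-; rewrite lawE.
Qed.

Lemma integral_quantile m (g : R -> \bar R) : measurable_fun setT g ->
  (\int[m]_x g x = \int[leb01]_p g (quantile m p))%E.
Proof.
by move=> mg; apply: integral_image => //; [exact: measurable_quantile|exact: quantile_push].
Qed.

End Quantile.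

(** * Monotone couplings and the Wasserstein distance *)

Section L2.
Context d (T : measurableType d) {R : realType} (mu : {measure set T -> \bar R}).

Lemma Lnorm2E (f : T -> R) :
  ('N[mu]_2[EFin \o f] = (\int[mu]_x (f x ^+ 2)%:E) `^ 2^-1)%E.
Proof.
rewrite unlock; congr (_ `^ _)%E; apply: eq_integral => x _ /=.
by rewrite powR_mulrn// -normrX ger0_norm// sqr_ge0.
Qed.

Lemma int_sqr_ge0 (f : T -> R) : (0 <= \int[mu]_x (f x ^+ 2)%:E)%E.
Proof. by apply: integral_ge0 => x _; rewrite lee_fin sqr_ge0. Qed.

Lemma Lfun2P (f : T -> R) : f \in Lfun mu 2%:E <->
  measurable_fun setT f /\ (\int[mu]_x (f x ^+ 2)%:E < +oo)%E.
Proof.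
rewrite inE; split=> [|[mf fi]].
  move=> /andP[]; rewrite !inE/= => mf.
  rewrite /finite_norm Lnorm2E => /(poweR_lty 2).
  rewrite -poweRrM ?mulVf// poweRe1 ?int_sqr_ge0//.
apply/andP; rewrite !inE/=; split => //.
by rewrite /finite_norm Lnorm2E poweR_lty.
Qed.

Lemma Lnorm2_sqrt (f : T -> R) :
  fine ('N[mu]_2[EFin \o f])%E = Num.sqrt (fine (\int[mu]_x (f x ^+ 2)%:E)%E).
Proof.
rewrite Lnorm2E; have := int_sqr_ge0 f; case: (\int[mu]_x _)%E => [r| |]//= r0.
  by rewrite powR12_sqrt.
(* If the integral is infinite, both sides are 0 because [fine +oo = 0]. *)
by rewrite sqrtr0 invr_eq0 pnatr_eq0.
Qed.

Lemma Lnorm2_lt (f : T -> R) (e : R) : 0 < e ->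
  (\int[mu]_x (f x ^+ 2)%:E < (e ^+ 2)%:E)%E -> ('N[mu]_2[EFin \o f] < e%:E)%E.
Proof.
move=> e0; rewrite Lnorm2E; have := int_sqr_ge0 f.
case: (\int[mu]_x _)%E => [r| |]//= r0; rewrite !lte_fin => re.
rewrite powR12_sqrt// -(ger0_norm (ltW e0)) -sqrtr_sqr ltr_sqrt//.
by rewrite exprn_gt0.
Qed.

End L2.

(** * A layer-cake formula for squared positive parts *)

Section Layer.
Context {R : realType}.
Local Notation leb := (@lebesgue_measure R).
Context d (T : measurableType d) (P : probability T R) (u v : T -> R).
Hypotheses (mu : measurable_fun setT u) (mv : measurable_fun setT v).

(** A layer-cake formula expresses the integral of the square of [(v - u)^+]
    through the masses of these sets, which monotone couplings minimize. *)
Definition between (s S : R) : set T := [set x | u x <= s /\ S < v x].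

Let mset d' (T' : measurableType d') (c : T' -> bool) :
  measurable_fun setT c -> measurable [set x | c x].
Proof. by move=> mb; rewrite -[X in measurable X]setTI; exact: mb. Qed.

Lemma measurable_between s S : measurable (between s S).
Proof.
rewrite /between (_ : [set x | _] = [set x | (u x <= s) && (S < v x)]).
  apply: mset; apply: measurable_and; first exact: measurable_fun_ler.
  exact: measurable_fun_ltr.
by apply/seteqP; split => x /=; [case=> -> ->|move/andP].
Qed.

Let A : set (T * measurableTypeR R) := [set z | (u z.1 <= z.2) && (z.2 < v z.1)].

Let mu1 : measurable_fun setT (fun z : T * measurableTypeR R => u z.1).
Proof. exact: measurableT_comp. Qed.

Let mv1 : measurable_fun setT (fun z : T * measurableTypeR R => v z.1).
Proof. exact: measurableT_comp. Qed.

Let m1 : measurable_fun setT (fun z : T * measurableTypeR R => z.2).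
Proof. exact: measurable_snd. Qed.

Let mA : measurable A.
Proof.
by apply: mset; apply: measurable_and; [exact: measurable_fun_ler|exact: measurable_fun_ltr].
Qed.

(** Integrated over the second variable, this is the square of the positive part of [v - u]: one
    factor is the length of the section of [A], the other is unfolded in [sliceE]. *)
Let g (z : T * measurableTypeR R) : \bar R := (\1_A z * Num.max 0 (v z.1 - u z.1))%:E.

Let mg : measurable_fun setT g.
Proof.
apply/measurable_EFinP; apply: measurable_funM; first exact: measurable_indic.
by apply: measurable_maxr => //; exact: measurable_funB.
Qed.

Let g0 z : (0 <= g z)%E.
Proof. by rewrite lee_fin mulr_ge0// le_max lexx. Qed.

Definition slice (a : R) : \bar R := (\int[P]_x g (x, a))%E.

Lemma measurable_slice : measurable_fun (setT : set (measurableTypeR R)) slice.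
Proof. exact: measurable_fun_fubini_tonelli_G. Qed.

Lemma slice_ge0 a : (0 <= slice a)%E.
Proof. by apply: integral_ge0 => x _; exact: g0. Qed.

Lemma int_slice :
  (\int[P]_x ((Num.max 0 (v x - u x)) ^+ 2)%R%:E = \int[leb]_a slice a)%E.
Proof.
rewrite /slice -(fubini_tonelli g)//.
apply: eq_integral => x _; rewrite /g.
under eq_integral do rewrite EFinM /=.
rewrite ge0_integralZr//=; last 2 first.
- apply/measurable_EFinP; apply: (measurableT_comp (f := (\1_A : _ -> R))); [exact: measurable_indic|exact: pair1_measurable].
- by rewrite lee_fin le_max lexx.
rewrite (_ : (fun y => (\1_A (x, y))%:E) =
    (fun y => (\1_(`[u x, v x[%classic) y)%:E)); last first.
  apply/funext => y; rewrite !indicE; congr (_%:R%:E); congr nat_of_bool.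
rewrite integral_indic ?setIT//=.
rewrite lebesgue_measure_itv/= lte_fin; case: ltP => uv.
  by rewrite -EFinD -EFinM expr2 max_r ?subr_ge0// ltW.
by rewrite mul0e max_l ?subr_le0// expr2 mul0r.
Qed.

Section fixed.
Variable a : R.
Let B : set (T * measurableTypeR R) :=
  [set z | (u z.1 <= Num.min a z.2) && (Num.max a z.2 < v z.1)].
Let mB : measurable B.
Proof.
apply: mset; apply: measurable_and.
  by apply: measurable_fun_ler => //; exact: measurable_minr.
by apply: measurable_fun_ltr => //; exact: measurable_maxr.
Qed.
Let h (z : T * measurableTypeR R) : \bar R := (\1_B z)%:E.
Let mh : measurable_fun setT h.
Proof. by apply/measurable_EFinP; exact: measurable_indic. Qed.
Let h0 z : (0 <= h z)%E. Proof. by rewrite lee_fin. Qed.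

Let hE b : (\int[P]_x h (x, b) = P (between (Num.min a b) (Num.max a b)))%E.
Proof.
rewrite -[X in _ = P X]setIT -integral_indic//; last exact: measurable_between.
apply: eq_integral => x _; rewrite /h !indicE; congr (_%:R%:E); congr nat_of_bool.
by apply/idP/idP; rewrite !inE /B/=; [move/andP|case=> -> ->].
Qed.

Lemma measurable_between_slice : measurable_fun (setT : set (measurableTypeR R))
  (fun b => P (between (Num.min a b) (Num.max a b))).
Proof.
rewrite -(_ : fubini_G P h = (fun b => P (between (Num.min a b) (Num.max a b)))).
  exact: measurable_fun_fubini_tonelli_G.
by apply/funext => b; exact: hE.
Qed.

(** The remaining factor is again a length, now integrated over [b]. Altogether the squared positive
    part is the area of the square with side [[u x, v x[], and a point [(a, b)] lies in it exactly
    when [u x <= min a b] and [max a b < v x]. *)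
Lemma sliceE : (slice a = \int[leb]_b P (between (Num.min a b) (Num.max a b)))%E.
Proof.
under [RHS]eq_integral do rewrite -hE.
rewrite -(fubini_tonelli h)//; apply: eq_integral => x _; rewrite /h /g.
rewrite (_ : (fun y => (\1_B (x, y))%:E) =
    (fun y => ((\1_A (x, a))%:E * (\1_(`[u x, v x[%classic) y)%:E)%E)); last first.
  apply/funext => y; rewrite !indicE -EFinM -natrM mulnb; congr (_%:R%:E); congr nat_of_bool.
  apply/idP/idP.
    move=> /set_mem; rewrite /B/= le_min gt_max => /andP[/andP[ua uy] /andP[av yv]].
    by apply/andP; split; apply/mem_set; rewrite /A/= ?in_itv/= ?ua ?uy.
  move=> /andP[/set_mem + /set_mem]; rewrite /A/= in_itv/= => /andP[ua av] /andP[uy yv].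
  by apply/mem_set; rewrite /B/= le_min gt_max ua uy av.
rewrite ge0_integralZl//=; last first.
  by apply/measurable_EFinP; apply: measurable_indic; exact: measurable_itv.
rewrite integral_indic ?setIT//=.
rewrite lebesgue_measure_itv/= lte_fin EFinM; congr (_ * _)%E; case: ltP => uv.
  by rewrite -EFinD max_r ?subr_ge0// ltW.
by rewrite max_l ?subr_le0.
Qed.
End fixed.

End Layer.

Lemma le_int_pos_sqr (R : realType) d (T : measurableType d) (P : probability T R)
  (u v : T -> R) d' (T' : measurableType d') (P' : probability T' R) (u' v' : T' -> R) :
  measurable_fun setT u -> measurable_fun setT v ->
  measurable_fun setT u' -> measurable_fun setT v' ->
  (forall s S : R, s <= S -> (P (between u v s S) <= P' (between u' v' s S))%E) ->
  (\int[P]_x ((Num.max 0 (v x - u x)) ^+ 2)%R%:E <=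
   \int[P']_x ((Num.max 0 (v' x - u' x)) ^+ 2)%R%:E)%E.
Proof.
move=> mu mv mu' mv' H; rewrite !int_slice//; apply: ge0_le_integral => //.
- by move=> a _; exact: slice_ge0.
- exact: measurable_slice.
- exact: measurable_slice.
move=> a _; rewrite !sliceE//; apply: ge0_le_integral => //.
- exact: measurable_between_slice.
- exact: measurable_between_slice.
by move=> b _; apply: H; rewrite ge_min le_max !lexx.
Qed.

(** * Optimality of monotone couplings *)

Section MonotoneTransport.
Context {R : realType}.

Definition mono01 (f : R -> R) := forall p q, 0 < p -> p <= q -> q < 1 -> f p <= f q.

Lemma U01_setI01 (A : set R) : measurable A -> U01 A = U01 (A `&` [set p | 0 < p < 1]).
Proof.
move=> mA; have E : [set p : R | 0 < p < 1] = `]0, 1[%classic.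
  by apply/seteqP; split => p /=; rewrite in_itv.
rewrite E [LHS]leb01E// [RHS]leb01E; last by apply: measurableI => //; exact: measurable_itv.
by rewrite -setIA setIid.
Qed.

Lemma measurable_le (f : R -> R) (s : R) : measurable_fun setT f ->
  measurable [set p : R | f p <= s].
Proof.
move=> mf; rewrite (_ : [set p | _] = f @^-1` `]-oo, s]%classic).
  by rewrite -[_ @^-1` _]setTI; apply: mf => //; exact: measurable_itv.
by apply/seteqP; split => p /=; rewrite in_itv.
Qed.

(** For any pair [u], [v] the mass is at least [P (u <= s) - P (v <= S)], and at least 0. For
    monotone [f] and [g] one of the two bounds is attained: inside the unit interval, either
    [g <= S] implies [f <= s], or no point satisfies [f <= s] and [S < g]. *)
Lemma between_mono_le d (T : measurableType d) (P : probability T R) (u v : T -> R)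
  (f g : R -> R) (s S : R) :
  measurable_fun setT u -> measurable_fun setT v ->
  measurable_fun setT f -> measurable_fun setT g -> mono01 f -> mono01 g ->
  P [set x | u x <= s] = U01 [set p | f p <= s] ->
  P [set x | v x <= S] = U01 [set p | g p <= S] ->
  (U01 (between f g s S) <= P (between u v s S))%E.
Proof.
move=> mu mv mf mg nf ng Hu Hv.
have [sub|nsub] := pselect ([set p | 0 < p < 1 /\ g p <= S] `<=` [set p | f p <= s]); last first.
  rewrite (_ : U01 _ = 0%E) ?measure_ge0//.
  rewrite U01_setI01; last exact: measurable_between.
  rewrite (_ : _ `&` _ = set0) ?measure0// -subset0 => p [[fp gp]] /andP[p0 p1].
  apply: nsub => q [/andP[q0 q1] gq]; rewrite /= leNgt; apply/negP => fq.
  have [pq|qp] := leP p q.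
    by have := ng _ _ p0 pq q1; rewrite leNgt (le_lt_trans gq gp).
  by have := nf _ _ q0 (ltW qp) p1; rewrite leNgt (le_lt_trans fp fq).
have mT (w : T -> R) r : measurable_fun setT w -> measurable [set x | w x <= r].
  move=> mw; rewrite (_ : [set p | _] = w @^-1` `]-oo, r]%classic).
    by rewrite -[_ @^-1` _]setTI; apply: mw => //; exact: measurable_itv.
  by apply/seteqP; split => p /=; rewrite in_itv.
have H1 : (P [set x | (u x <= s)%R] <= P (between u v s S) + P [set x | (v x <= S)%R])%E.
  apply: le_trans (measureU2 _ (measurable_between mu mv s S) (mT _ S mv)).
  apply: le_measure; rewrite ?inE; [exact: mT|apply: measurableU; [exact: measurable_between|exact: mT]|].
  by move=> x /= ux; have [vx|vx] := leP (v x) S; [right|left].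
have H2 : (U01 (between f g s S) + U01 [set p | (g p <= S)%R] = U01 [set p | (f p <= s)%R])%E.
  rewrite [U01 (between _ _ _ _)]U01_setI01; last exact: measurable_between.
  rewrite [U01 [set p | g p <= S]]U01_setI01; last exact: measurable_le.
  have m01 : measurable [set p : R | 0 < p < 1].
    rewrite (_ : [set p | _] = `]0, 1[%classic); first exact: measurable_itv.
    by apply/seteqP; split => p /=; rewrite in_itv.
  rewrite -measureU; last 3 first.
  - by apply: measurableI => //; exact: measurable_between.
  - by apply: measurableI => //; exact: measurable_le.
  - rewrite -subset0 => p [[[_ gp] _] [gp' _]].
    by move: gp; rewrite ltNge gp'.
  rewrite [RHS]U01_setI01; last exact: measurable_le.
  congr (U01 _); apply/seteqP; split => p /=.
    by move=> [[[]]|[gp p01]] //; split => //; exact: sub.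
  move=> [fp p01]; have [gp|gp] := leP (g p) S; [by right|by left].
rewrite -(@leeD2rE _ (U01 [set p | g p <= S])) ?fin_num_measure//; last exact: measurable_le.
by rewrite H2 -Hu -Hv.
Qed.

Lemma sqr_max_split (x y : R) :
  (x - y) ^+ 2 = (Num.max 0 (y - x)) ^+ 2 + (Num.max 0 (x - y)) ^+ 2.
Proof.
have [xy|yx] := leP x y.
  rewrite max_r ?subr_ge0// max_l ?subr_le0//; ring.
by rewrite max_l ?subr_le0 1?ltW// max_r ?subr_ge0 1?ltW//; ring.
Qed.

Lemma int_sqr_split d (T : measurableType d) (P : probability T R) (u v : T -> R) :
  measurable_fun setT u -> measurable_fun setT v ->
  (\int[P]_x ((u x - v x) ^+ 2)%:E =
   \int[P]_x ((Num.max 0 (v x - u x)) ^+ 2)%R%:E +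
   \int[P]_x ((Num.max 0 (u x - v x)) ^+ 2)%R%:E)%E.
Proof.
move=> mu mv.
have m (w w' : T -> R) : measurable_fun setT w -> measurable_fun setT w' ->
    measurable_fun setT (fun x => ((Num.max 0 (w x - w' x)) ^+ 2)%:E).
  move=> mw mw'; apply/measurable_EFinP; apply: measurable_funX.
  by apply: measurable_maxr => //; exact: measurable_funB.
rewrite -ge0_integralD//.
- by apply: eq_integral => x _; rewrite -EFinD -sqr_max_split.
- by move=> x _; rewrite lee_fin sqr_ge0.
- exact: m.
- by move=> x _; rewrite lee_fin sqr_ge0.
- exact: m.
Qed.

Context (f g : R -> R).
Hypotheses (mf : measurable_fun setT f) (mg : measurable_fun setT g).
Hypotheses (nf : mono01 f) (ng : mono01 g).
Context (mu nu : P2 R).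
Hypothesis Hmu : forall A : set R, measurable A -> mu A = U01 (f @^-1` A).
Hypothesis Hnu : forall A : set R, measurable A -> nu A = U01 (g @^-1` A).

Lemma mono_cost_le (rho : probability (R * R)%type R) : coupling mu nu rho ->
  (\int[U01]_p ((f p - g p) ^+ 2)%:E <= cost rho)%E.
Proof.
move=> crho; rewrite /cost !int_sqr_split//.
have E1 (s : R) : rho [set z | z.1 <= s] = U01 [set p | f p <= s].
  have [+ _] := crho `]-oo, s]%classic (measurable_itv _).
  rewrite Hmu; last exact: measurable_itv.
  rewrite (_ : _ `*` _ = [set z | z.1 <= s]); last first.
    by apply/seteqP; split => z /=; rewrite in_itv/=; [case|].
  move=> ->; congr (U01 _); by apply/seteqP; split => p /=; rewrite in_itv.
have E2 (s : R) : rho [set z | z.2 <= s] = U01 [set p | g p <= s].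
  have [_] := crho `]-oo, s]%classic (measurable_itv _).
  rewrite Hnu; last exact: measurable_itv.
  rewrite (_ : _ `*` _ = [set z | z.2 <= s]); last first.
    by apply/seteqP; split => z /=; rewrite in_itv/=; [case|].
  move=> ->; congr (U01 _); by apply/seteqP; split => p /=; rewrite in_itv.
(* The second summand is the first one with the marginals exchanged. *)
apply: leeD; apply: le_int_pos_sqr => // s S _; exact: between_mono_le.
Qed.

Lemma mono_coupling (pi : probability (R * R)%type R) :
  (forall B : set (R * R), measurable B -> pi B = U01 ((fun p => (f p, g p)) @^-1` B)) ->
  opt_coupling mu nu pi /\ cost pi = (\int[U01]_p ((f p - g p) ^+ 2)%:E)%E.
Proof.
move=> Hpi.
have mfg : measurable_fun (setT : set (measurableTypeR R)) (fun p => (f p, g p)).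
  exact: measurable_fun_pair.
have C : cost pi = (\int[U01]_p ((f p - g p) ^+ 2)%:E)%E.
  rewrite /cost (@integral_image _ _ _ _ _ U01 pi _ _ mfg Hpi)//.
  by apply/measurable_EFinP; apply: measurable_funX; exact: measurable_funB.
split => //; split.
  move=> A mA; rewrite !Hpi; try exact: measurableX.
  rewrite Hmu// Hnu//; split; congr (U01 _); apply/seteqP; split => p //=; by case.
by move=> rho crho; rewrite C; exact: mono_cost_le.
Qed.

Lemma W2_mono : W2 mu nu = Num.sqrt (fine (\int[U01]_p ((f p - g p) ^+ 2)%:E)%E).
Proof.
rewrite /W2; congr (Num.sqrt (fine _)); apply/eqP; rewrite eq_le; apply/andP; split.
  have mfg : measurable_fun (setT : set (measurableTypeR R)) (fun p => (f p, g p)).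
  exact: measurable_fun_pair.
  have [[C _] <-] := @mono_coupling (law U01 mfg) (fun _ _ => erefl).
  by apply: ereal_inf_lbound; exists (law U01 mfg).
by apply/ereal_infP => _ [rho crho <-]; exact: mono_cost_le.
Qed.

End MonotoneTransport.

Section QuantileTransport.
Context {R : realType}.
Implicit Types mu nu : P2 R.

Lemma mono_quantile mu : mono01 (quantile mu).
Proof. by move=> p q p0 pq q1; exact: quantile_nd. Qed.

Lemma quantile_sqr_lty mu : (\int[U01]_p ((quantile mu p) ^+ 2)%:E < +oo)%E.
Proof.
have := P2_moment2 mu; rewrite (integral_quantile mu)//.
by apply/measurable_EFinP; exact: exprn_measurable.
Qed.

Lemma L2_quantile mu : L2_01 (quantile mu).
Proof.
rewrite /L2_01 /=; apply/Lfun2P; split; first exact: measurable_quantile.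
exact: quantile_sqr_lty.
Qed.

Lemma L2_01_normE (f : R -> R) :
  L2_01_norm f = Num.sqrt (fine (\int[U01]_p ((f p) ^+ 2)%:E)%E).
Proof. exact: Lnorm2_sqrt. Qed.

Lemma W2_quantile mu nu : W2 mu nu = L2_01_norm (quantile nu \- quantile mu).
Proof.
rewrite L2_01_normE (W2_mono (@measurable_quantile _ mu) (@measurable_quantile _ nu)
  (@mono_quantile mu) (@mono_quantile nu) (@quantile_push _ mu) (@quantile_push _ nu)).
by congr (Num.sqrt (fine _)); apply: eq_integral => p _ /=; rewrite -sqrrN opprB.
Qed.

End QuantileTransport.

(** * Density of bounded Lipschitz functions *)

Section Lip.
Context {R : realType}.

Lemma derive_bound_lip (f : R -> R) (M : R) : (forall x, derivable f x 1) ->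
  (forall x, `|derive1 f x| <= M) -> forall x y, `|f x - f y| <= M * `|x - y|.
Proof.
move=> df bf.
suff H x y : x <= y -> `|f y - f x| <= M * `|y - x|.
  move=> x y; have [xy|/ltW yx] := leP x y; last exact: H.
  by rewrite distrC (distrC x); exact: H.
move=> xy; have [c _ ->] : exists2 c, c \in `[x, y] & f y - f x = derive1 f c * (y - x).
  apply: MVT_segment => // [z _|]; first exact: derivable_is_derive.
  apply: continuous_subspaceT => z.
  by apply: differentiable_continuous; exact/derivable1_diffP.
by rewrite normrM ler_wpM2r.
Qed.

Definition lipb (f : R -> R) := exists L M, [/\ 0 <= L, forall x y, `|f x - f y| <= L * `|x - y|
  & forall x, `|f x| <= M].

Lemma lipb_continuous f : lipb f -> continuous f.
Proof.
move=> [L [M [L0 H _]]] x; have L1 : 0 < L + 1 by rewrite ltr_wpDl.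
apply/cvgrPdist_le => e e0; near=> y.
rewrite (le_trans (H _ _))//.
rewrite (@le_trans _ _ ((L + 1) * `|x - y|))//; first by rewrite ler_wpM2r// lerDl.
rewrite -ler_pdivlMl//; near: y.
have /cvgrPdist_le := @cvg_id _ (nbhs x); apply.
by rewrite mulr_gt0// invr_gt0.
Unshelve. all: by end_near. Qed.

Lemma lipb_measurable f : lipb f -> measurable_fun setT f.
Proof. by move=> lf; apply: continuous_measurable_fun; exact: lipb_continuous. Qed.

Lemma lipb_beval e : lipb (beval e).
Proof.
have [M HM] := @derive1_beval_bounded R e; exists M, 1; split.
- exact: le_trans (HM 0).
- apply: derive_bound_lip => // x; exact/smooth_derivable/smooth_beval.
- by move=> x; rewrite ger0_norm ?beval_ge0 ?beval_le1.
Qed.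

Lemma lipbD f g : lipb f -> lipb g -> lipb (fun x => f x + g x).
Proof.
move=> [L [M [L0 H H']]] [K [N [K0 I I']]]; exists (L + K), (M + N); split.
- exact: addr_ge0.
- move=> x y; rewrite opprD addrACA (le_trans (ler_normD _ _))// mulrDl.
  by rewrite lerD.
- by move=> x; rewrite (le_trans (ler_normD _ _))// lerD.
Qed.

Lemma lipbZ (c : R) f : lipb f -> lipb (fun x => c * f x).
Proof.
move=> [L [M [L0 H H']]]; exists (`|c| * L), (`|c| * M); split.
- exact: mulr_ge0.
- by move=> x y; rewrite -mulrBr normrM -mulrA ler_wpM2l.
- by move=> x; rewrite normrM ler_wpM2l.
Qed.

Definition clamp (c x : R) : R := Num.max (- c) (Num.min c x).

Lemma clamp_dist (c x y : R) : 0 <= c -> `|clamp c x - clamp c y| <= `|x - y|.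
Proof.
move=> c0; rewrite /clamp !maxEle !minEle.
case: (leP c x) => cx; case: (leP c y) => cy; do ?case: ifPn; rewrite -?ltNge => *.
all: by rewrite ler_norml; case: (ler0P (x - y)) => ?; apply/andP; split; lra.
Qed.

Lemma clamp_bound (c x : R) : 0 <= c -> `|clamp c x| <= c.
Proof.
move=> c0; rewrite /clamp ler_norml le_max lexx/= ge_max ge_min lexx/= andbT; lra.
Qed.

Lemma clamp_id (c x : R) : `|x| <= c -> clamp c x = x.
Proof.
by rewrite ler_norml => /andP[cx xc]; rewrite /clamp min_r// max_r.
Qed.

Lemma clamp_rest (c x : R) : 0 <= c -> `|x - clamp c x| <= `|x|.
Proof.
move=> c0; rewrite /clamp !maxEle !minEle.
case: (leP c x) => cx; do ?case: ifPn; rewrite -?ltNge => *.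
all: by rewrite ler_norml; case: (ler0P x) => ?; apply/andP; split; lra.
Qed.

Lemma lipb_clamp (c : R) f : 0 <= c -> lipb f -> lipb (fun x => clamp c (f x)).
Proof.
move=> c0 [L [M [L0 H _]]]; exists L, c; split => // x.
  by move=> y; rewrite (le_trans (clamp_dist _ _ c0)).
exact: clamp_bound.
Qed.

Lemma measurable_clamp d (T : measurableType d) (c : R) (f : T -> R) :
  measurable_fun setT f -> measurable_fun setT (fun x => clamp c (f x)).
Proof. by move=> mf; apply: measurable_maxr => //; exact: measurable_minr. Qed.

Section Density.
Import HBSimple.
Variable m : probability (measurableTypeR R) R.

(** Approximation is first carried out in L1, where indicators are covered by [beval_approx] and
    linear combinations are immediate; [lipb_dense] passes to L2 by truncation. *)
Let near1 (f : R -> R) := forall eps : R, 0 < eps ->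
  exists2 g, lipb g & (\int[m]_x (`|f x - g x|)%:E < eps%:E)%E.

Let mfd (f g : R -> R) : measurable_fun setT f -> measurable_fun setT g ->
  measurable_fun (setT : set (measurableTypeR R)) (fun x => (`|f x - g x|)%:E).
Proof.
by move=> mf mg; apply/measurable_EFinP; apply: measurableT_comp => //; exact: measurable_funB.
Qed.

Let near1D f g : measurable_fun setT f -> measurable_fun setT g ->
  near1 f -> near1 g -> near1 (fun x => f x + g x).
Proof.
move=> mf mg nf ng e e0; have e20 : 0 < e / 2 by rewrite divr_gt0.
have [f' lf Hf] := nf _ e20; have [g' lg Hg] := ng _ e20.
have mf' := lipb_measurable lf; have mg' := lipb_measurable lg.
exists (fun x => f' x + g' x); first exact: lipbD.
apply: (@le_lt_trans _ _ (\int[m]_x (`|f x - f' x|)%:E + \int[m]_x (`|g x - g' x|)%:E)%E).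
  rewrite -ge0_integralD//; [|exact: mfd..].
  apply: ge0_le_integral => //.
  - by apply: mfd; exact: measurable_funD.
  - by apply: emeasurable_funD; exact: mfd.
  - by move=> x _; rewrite -EFinD lee_fin opprD addrACA ler_normD.
by rewrite (splitr e) EFinD; exact: lteD.
Qed.

Let near1Z (c : R) f : measurable_fun setT f -> near1 f -> near1 (fun x => c * f x).
Proof.
move=> mf nf e e0; have c0 : 0 < `|c| + 1 by rewrite ltr_wpDl.
have e20 : 0 < e / (`|c| + 1) by rewrite divr_gt0.
have [f' lf Hf] := nf _ e20; have mf' := lipb_measurable lf.
exists (fun x => c * f' x); first exact: lipbZ.
apply: (@le_lt_trans _ _ ((`|c| + 1)%:E * \int[m]_x (`|f x - f' x|)%:E)%E).
  rewrite -ge0_integralZl//; last exact: mfd.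
  apply: ge0_le_integral => //.
  - by apply: mfd; exact: measurable_funM.
  - by apply: emeasurable_funM => //; exact: mfd.
  - by move=> x _; rewrite -EFinM lee_fin -mulrBr normrM ler_wpM2r// lerDl.
by rewrite -lte_pdivlMl// -EFinM mulrC.
Qed.

Let near1_indic A : measurable A -> near1 \1_A.
Proof.
move=> mA e e0.
have i1 : m.-integrable setT (EFin \o cst (1 : R)) by exact: finite_measure_integrable_cst.
have [b Hb] := @beval_approx R _ _ m id (cst 1) (@measurable_id _ (measurableTypeR R) setT) (fun=> ler01) i1 A e mA e0.
exists (beval b); first exact: lipb_beval.
by under eq_integral do rewrite distrC -[`|_|]mul1r.
Qed.

Let near1_sfun (f : {sfun (measurableTypeR R) >-> R}) : near1 (fun x => f x).
Proof.
have [s ->] : exists s : seq R,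
    (fun x : R => f x) = fun x => \sum_(y <- s) y * \1_(f @^-1` [set y]) x.
  exists (finmap.enum_fset (fset_set (range f))); apply/funext => x.
  by rewrite fimfunE fsbig_finite.
have mpre y : measurable (f @^-1` [set y]) by [].
elim: s => [|y s IH].
  move=> e e0; exists (cst 0).
    by exists 0, 0; split => // [x y|x]; rewrite /cst ?subrr normr0 ?mul0r.
  by under eq_integral do rewrite big_nil subrr normr0; rewrite integral0 lte_fin.
have -> : (fun x => \sum_(z <- y :: s) z * \1_(f @^-1` [set z]) x) =
   (fun x => y * \1_(f @^-1` [set y]) x + \sum_(z <- s) z * \1_(f @^-1` [set z]) x).
  by apply/funext => x; rewrite big_cons.
have mI z : measurable_fun setT (fun x : R => \1_(f @^-1` [set z]) x : R).
  by apply: measurable_indic; exact: mpre.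
apply: near1D.
- by apply: measurable_funM => //; exact: mI.
- by apply: measurable_sum => z; apply: measurable_funM => //; exact: mI.
- by apply: near1Z; [exact: mI|exact: (near1_indic (mpre y))].
- exact: IH.
Qed.

Let near1_bounded (f : R -> R) (c : R) : measurable_fun setT f ->
  (forall x, `|f x| <= c) -> near1 f.
Proof.
move=> mf fc e e0; have e20 : 0 < e / 2 by rewrite divr_gt0.
have fi : m.-integrable setT (EFin \o f).
  apply: measurable_bounded_integrable => //.
    by rewrite ltey_eq (fin_num_measure m setT measurableT).
  exists c; split; first exact: num_real.
  by move=> M cM x _; exact: (le_trans (fc x) (ltW cM)).
have [h [hi _ hc]] := approximation_sfun_integrable measurableT fi.
have [_ /fine_cvgP[ff /cvgrPdist_lt /(_ _ e20) nr]] : True /\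
  (\int[m]_x `|f x - h n x|%:E @[n --> \oo] --> 0)%E by split.
near \oo => n.
have fn : (\int[m]_x `|f x - h n x|%:E)%E \is a fin_num by near: n.
have Hn : (\int[m]_x `|f x - h n x|%:E < (e / 2)%:E)%E.
  rewrite -(fineK fn) lte_fin; apply: le_lt_trans (ler_norm _) _.
  by rewrite -normrN -sub0r; near: n.
have [g lg Hg] := near1_sfun (h n) e20.
exists g => //; have mg := lipb_measurable lg.
have mh : measurable_fun setT (fun x : R => h n x : R) by exact: (@measurable_funPT _ _ _ _ (h n)).
apply: (@le_lt_trans _ _ (\int[m]_x (`|f x - h n x|)%:E + \int[m]_x (`|h n x - g x|)%:E)%E).
  rewrite -ge0_integralD//; [|exact: mfd..].
  apply: ge0_le_integral => //.
  - exact: mfd.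
  - by apply: emeasurable_funD; exact: mfd.
  - by move=> x _; rewrite -EFinD lee_fin ler_distD.
by rewrite (splitr e) EFinD; exact: lteD.
Unshelve. all: by end_near. Qed.

(** Truncation at a high level changes [f] little in L2. For the truncated function, clamping the
    approximation at the same level bounds the difference, so that its square is controlled by its
    absolute value. *)
Lemma lipb_dense (f : R -> R) (e : R) : measurable_fun setT f ->
  (\int[m]_x (f x ^+ 2)%:E < +oo)%E -> 0 < e ->
  exists2 g, lipb g & (\int[m]_x ((f x - g x) ^+ 2)%:E < e%:E)%E.
Proof.
move=> mf f2 e0; have e40 : 0 < e / 4 by rewrite divr_gt0.
have msq (g h : R -> R) : measurable_fun setT g -> measurable_fun setT h ->
    measurable_fun (setT : set (measurableTypeR R)) (fun x => ((g x - h x) ^+ 2)%:E).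
  by move=> mg mh; apply/measurable_EFinP; apply: measurable_funX; exact: measurable_funB.
have [n Hn] : exists n : nat, (\int[m]_x ((f x - clamp n%:R (f x)) ^+ 2)%:E < (e / 4)%:E)%E.
  have := @dominated_convergence _ _ _ m setT measurableT
    (fun n x => ((f x - clamp n%:R (f x)) ^+ 2)%:E) (cst 0%E) (fun x => (f x ^+ 2)%:E).
  case.
  - by move=> n; apply: msq => //; exact: measurable_clamp.
  - exact: measurable_cst.
  - apply: aeW => x _; apply: cvg_near_cst; near=> n.
    rewrite clamp_id ?subrr ?expr0n//; near: n; exact: nbhs_infty_ger.
  - apply/integrableP; split; first by apply/measurable_EFinP; exact: measurable_funX.
    by under eq_integral do rewrite gee0_abs ?lee_fin ?sqr_ge0//.
  - apply: aeW => x n _; rewrite gee0_abs ?lee_fin ?sqr_ge0// -ler_sqrt ?sqr_ge0//.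
    by rewrite !sqrtr_sqr clamp_rest.
  move=> _ _; rewrite integral_cst// mul0e => /fine_cvgP[ff /cvgrPdist_lt /(_ _ e40) nr].
  near \oo => n; exists n.
  have fn : (\int[m]_x ((f x - clamp n%:R (f x)) ^+ 2)%:E)%E \is a fin_num by near: n.
  rewrite -(fineK fn) lte_fin; apply: le_lt_trans (ler_norm _) _.
  by rewrite -normrN -sub0r; near: n.
set F := fun x => clamp n%:R (f x).
have mF : measurable_fun setT F by exact: measurable_clamp.
(* The clamped difference [b] is at most [2 * n.+1] and at most [|F - g|], so
   [2 * b ^ 2 <= 4 * n.+1 * |F - g|] and this tolerance costs [e / 2]. The truncation costs twice
   [e / 4]. *)
have d0 : 0 < e / 2 / (4 * n.+1%:R) by rewrite !divr_gt0// mulr_gt0.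
have [g lg Hg] := near1_bounded mF (fun x => clamp_bound (f x) (ler0n _ n)) d0.
have mg := lipb_measurable lg.
exists (fun x => clamp n%:R (g x)); first exact: lipb_clamp.
apply: (@le_lt_trans _ _ (2%:E * \int[m]_x ((f x - F x) ^+ 2)%:E +
   (4 * n.+1%:R)%:E * \int[m]_x (`|F x - g x|)%:E)%E).
  rewrite -ge0_integralZl//; last 2 first.
  - exact: msq.
  - by move=> x _; rewrite lee_fin sqr_ge0.
  rewrite -ge0_integralZl//; last exact: mfd.
  rewrite -ge0_integralD//.
  - apply: ge0_le_integral => //.
    + by move=> x _; rewrite lee_fin sqr_ge0.
    + by apply: msq => //; exact: measurable_clamp.
    + apply: emeasurable_funD; apply: emeasurable_funM => //; [exact: msq|exact: mfd].
    + move=> x _; rewrite -!EFinM -EFinD lee_fin.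
      set a := f x - F x; set b := F x - clamp n%:R (g x).
      have -> : f x - clamp n%:R (g x) = a + b by rewrite /a /b; ring.
      have ab : (a + b) ^+ 2 <= 2 * a ^+ 2 + 2 * b ^+ 2.
        by rewrite -subr_ge0 (_ : _ - _ = (a - b) ^+ 2) ?sqr_ge0//; ring.
      apply: (le_trans ab); rewrite lerD2l.
      have b1 : `|b| <= `|F x - g x|.
        rewrite /b -[X in `|X - _|](@clamp_id n%:R (F x)) ?clamp_bound//.
        exact: clamp_dist.
      have b2 : `|b| <= 2 * n.+1%:R.
        rewrite (le_trans (ler_normB _ _))// mulr_natl mulr2n.
        by rewrite lerD// (le_trans (clamp_bound _ _))// ler_nat.
      rewrite -[b ^+ 2]ger0_norm ?sqr_ge0// normrX expr2.
      have : `|b| * `|b| <= 2 * n.+1%:R * `|F x - g x| by rewrite ler_pM.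
      lra.
  - by move=> x _; rewrite mule_ge0 ?lee_fin ?sqr_ge0.
  - by apply: emeasurable_funM => //; exact: msq.
  - by apply: emeasurable_funM => //; exact: mfd.
have -> : (e%:E = (e / 2)%:E + (e / 2)%:E)%E by rewrite -EFinD -splitr.
apply: lteD.
  rewrite -lte_pdivlMl//; apply: lt_le_trans Hn _.
  by rewrite -EFinM lee_fin; lra.
rewrite -lte_pdivlMl; last by rewrite mulr_gt0.
by apply: lt_le_trans Hg _; rewrite -EFinM lee_fin mulrC.
Unshelve. all: by end_near. Qed.

End Density.
End Lip.

(** * The tangent space *)

Section Tangent.
Context {R : realType}.

Lemma sqr_add_lty d (T : measurableType d) (m : {measure set T -> \bar R}) (f g : T -> R) :
  measurable_fun setT f -> measurable_fun setT g ->
  (\int[m]_x (f x ^+ 2)%:E < +oo)%E -> (\int[m]_x (g x ^+ 2)%:E < +oo)%E ->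
  (\int[m]_x ((f x + g x) ^+ 2)%:E < +oo)%E.
Proof.
move=> mf mg f2 g2.
have mf2 : measurable_fun setT (fun x => (2 * f x ^+ 2)%:E).
  by apply/measurable_EFinP; apply: measurable_funM => //; exact: measurable_funX.
have mg2 : measurable_fun setT (fun x => (2 * g x ^+ 2)%:E).
  by apply/measurable_EFinP; apply: measurable_funM => //; exact: measurable_funX.
apply: (@le_lt_trans _ _ (\int[m]_x ((2 * f x ^+ 2)%:E + (2 * g x ^+ 2)%:E))%E).
  apply: ge0_le_integral => //.
  - by move=> x _; rewrite lee_fin sqr_ge0.
  - by apply/measurable_EFinP; apply: measurable_funX; exact: measurable_funD.
  - exact: emeasurable_funD.
  - move=> x _; rewrite -EFinD lee_fin -subr_ge0.
    by rewrite (_ : _ - _ = (f x - g x) ^+ 2) ?sqr_ge0//; ring.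
rewrite ge0_integralD//; last 2 first.
- by move=> x _; rewrite lee_fin mulr_ge0 ?sqr_ge0.
- by move=> x _; rewrite lee_fin mulr_ge0 ?sqr_ge0.
apply: lte_add_pinfty.
  under eq_integral do rewrite EFinM.
  rewrite ge0_integralZl//=; last 2 first.
  - by apply/measurable_EFinP; exact: measurable_funX.
  - by move=> x _; rewrite lee_fin sqr_ge0.
  by rewrite lte_mul_pinfty ?lee_fin.
under eq_integral do rewrite EFinM.
rewrite ge0_integralZl//=; last 2 first.
- by apply/measurable_EFinP; exact: measurable_funX.
- by move=> x _; rewrite lee_fin sqr_ge0.
by rewrite lte_mul_pinfty ?lee_fin.
Qed.

Lemma sqr_bounded_lty d (T : measurableType d) (m : probability T R) (f : T -> R) (M : R) :
  measurable_fun setT f -> (forall x, `|f x| <= M) -> (\int[m]_x (f x ^+ 2)%:E < +oo)%E.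
Proof.
move=> mf fM; apply: (@le_lt_trans _ _ (\int[m]_x (M ^+ 2)%:E)%E).
  apply: ge0_le_integral => //.
  - by move=> x _; rewrite lee_fin sqr_ge0.
  - by apply/measurable_EFinP; exact: measurable_funX.
  - by move=> x _; rewrite lee_fin -[leLHS]ger0_norm ?sqr_ge0// normrX lerXn2r// ?nnegrE// (le_trans _ (fM x)).
by rewrite integral_cst//= (_ : _ setT = 1%E) ?mule1 ?ltry//; exact: probability_setT.
Qed.

Lemma lipb_tangent_dir (mu : P2 R) (eta : R -> R) : lipb eta -> tangent_dir mu eta.
Proof.
move=> leta; have meta := lipb_measurable leta.
have [L [M [L0 HL HM]]] := leta.
have l0 : 0 < L + 1 by rewrite ltr_wpDl.
(* [L + 1] rather than [L], to have a positive divisor when [eta] is constant and [L = 0]. *)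
pose T x := x + eta x / (L + 1).
have mT : measurable_fun setT T.
  by apply: measurable_funD => //; apply: measurable_funM.
have T2 : (\int[law mu mT]_x (x ^+ 2)%:E < +oo)%E.
  rewrite (@integral_image _ _ _ _ _ mu (law mu mT) T)//; last first.
    by apply/measurable_EFinP; exact: exprn_measurable.
  apply: sqr_add_lty => //; first by apply: measurable_funM.
  - exact: P2_moment2.
  - apply: (@sqr_bounded_lty _ _ _ _ (M / (L + 1))); first exact: measurable_funM.
    by move=> x; rewrite normrM ler_pM// ger0_norm// invr_ge0 ltW.
have mpi : measurable_fun setT (fun x => (x, T x)) by exact: measurable_fun_pair.
exists T, (L + 1), (MkP2 T2), (law mu mpi); split => //; last first.
  by apply/funext => x; rewrite /T; field; rewrite gt_eqF.
split => //.
have mQ := @measurable_quantile _ mu.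
have mTQ : measurable_fun setT (fun p => T (quantile mu p)) by exact: measurableT_comp.
(* The graph coupling of [T] is the image of the uniform law under the quantile function and its
   composition with [T], both nondecreasing. *)
have [] // := @mono_coupling R _ _ mQ mTQ (@mono_quantile _ mu) _ mu (MkP2 T2)
  (@quantile_push _ mu) _ (law mu mpi).
- move=> p q p0 pq q1; have := quantile_nd mu p0 pq q1.
  set x := quantile mu p; set y := quantile mu q; move=> xy.
  rewrite /T -subr_ge0; have := HL x y.
  rewrite distrC (distrC x) (ger0_norm (_ : 0 <= y - x)) ?subr_ge0// => Hxy.
  have : `|eta y - eta x| / (L + 1) <= y - x.
    rewrite ler_pdivrMr//; apply: (le_trans Hxy).
    by rewrite mulrC ler_wpM2l ?subr_ge0// lerDl.
  rewrite -[X in _ / X]ger0_norm ?(ltW l0)// -normf_div ler_norml mulrBl; lra.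
- move=> A mA; have mTA : measurable (T @^-1` A) by have := mT measurableT A mA; rewrite setTI.
  exact: (quantile_push mu mTA).
- move=> B mB; have mB' : measurable ((fun x => (x, T x)) @^-1` B).
    by have := mpi measurableT B mB; rewrite setTI.
  exact: (quantile_push mu mB').
Qed.

Lemma tangent_Lfun (mu : P2 R) (xi : R -> R) : xi \in Lfun mu 2%:E -> tangent mu xi.
Proof.
move=> Lxi; split => // e e0.
have /Lfun2P[mxi xi2] := Lxi.
have mQ : measurable_fun (setT : set (measurableTypeR R)) (quantile mu : measurableTypeR R -> measurableTypeR R).
  exact: measurable_quantile.
have sqE (f : R -> R) : measurable_fun setT f ->
    (\int[mu]_x (f x ^+ 2)%:E = \int[law U01 mQ]_x (f x ^+ 2)%:E)%E.
  move=> mf; rewrite integral_quantile; last by apply/measurable_EFinP; exact: measurable_funX.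
  rewrite (@integral_image _ _ _ _ _ U01 (law U01 mQ) _ _ mQ)//.
  by apply/measurable_EFinP; exact: measurable_funX.
have [|eta leta H] := @lipb_dense R (law U01 mQ) xi (e ^+ 2) mxi _ (exprn_gt0 _ e0).
  by rewrite -sqE.
exists eta; first exact: lipb_tangent_dir.
apply: Lnorm2_lt => //=; rewrite sqE//.
by apply: measurable_funB => //; exact: lipb_measurable.
Qed.

End Tangent.

(** * Interpolation of quantiles *)

Section Geodesic.
Context {R : realType}.

(** A nondecreasing left-continuous function is the quantile function of its law, because it
    satisfies the same Galois connection with the distribution function. The third hypothesis is
    left-continuity in the form that the connection uses. *)
Lemma quantile_law (f : R -> R) (m : P2 R) : measurable_fun setT f -> mono01 f ->
  (forall p y, 0 < p < 1 -> y < f p -> exists2 p', 0 < p' < p & y < f p') ->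
  (forall A : set R, measurable A -> m A = U01 (f @^-1` A)) ->
  forall p, 0 < p < 1 -> quantile m p = f p.
Proof.
move=> mf nf lf Hm p p01; have /andP[p0 p1] := p01.
have cE x : (cdf2 m x)%:E = U01 [set q | f q <= x].
  rewrite -cdf2E Hm; last exact: measurable_itv.
  by congr (U01 _); apply/seteqP; split => q /=; rewrite in_itv.
have mle := fun x => measurable_le x mf.
have mle1 (c : R) : measurable [set q : R | q <= c] by exact: (measurable_le c (@measurable_id _ _ setT)).
have m01 : measurable [set p : R | 0 < p < 1].
  rewrite (_ : [set p | _] = `]0, 1[%classic); first exact: measurable_itv.
  by apply/seteqP; split => q /=; rewrite in_itv.
have key x : (p <= cdf2 m x) = (f p <= x).
  apply/idP/idP => [|fx].
    apply: contraTT; rewrite -!ltNge => /(lf _ _ p01)[p' /andP[p'0 p'p] xf].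
    rewrite -lte_fin cE (@le_lt_trans _ _ p'%:E) ?lte_fin//.
    rewrite -U01_le; last by rewrite (ltW p'0) ltW// (lt_trans p'p).
    rewrite U01_setI01//; apply: le_measure; rewrite ?inE; [exact: (measurableI _ _ (mle x) m01)|exact: mle1|].
    move=> q /= [fq /andP[q0 q1]]; rewrite leNgt; apply/negP => p'q.
    by have := nf _ _ p'0 (ltW p'q) q1; rewrite leNgt (le_lt_trans fq).
  rewrite -lee_fin cE -U01_le; last by rewrite (ltW p0) ltW.
  rewrite U01_setI01//; apply: le_measure; rewrite ?inE; [exact: (measurableI _ _ (mle1 p) m01)|exact: mle|].
  by move=> q /= [qp /andP[q0 q1]]; rewrite (le_trans _ fx)// nf.
apply/eqP; rewrite eq_le; apply/andP; split; first by rewrite quantile_le// key.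
by rewrite -key -quantile_le.
Qed.

Section Interpolation.
Variables mu nu : P2 R.
Let f (t p : R) : R := (1 - t) * quantile mu p + t * quantile nu p.

Let mf t : measurable_fun setT (f t).
Proof.
by apply: measurable_funD; apply: measurable_funM => //; exact: measurable_quantile.
Qed.

Let f2 t : (\int[U01]_p (f t p ^+ 2)%:E < +oo)%E.
Proof.
have H (c : R) (m : P2 R) : (\int[U01]_p ((c * quantile m p) ^+ 2)%:E < +oo)%E.
  under eq_integral do rewrite exprMn EFinM.
  rewrite ge0_integralZl//=; last 3 first.
  - apply/measurable_EFinP; apply: measurable_funX; exact: measurable_quantile.
  - by move=> x _; rewrite lee_fin sqr_ge0.
  - by rewrite lee_fin sqr_ge0.
  by rewrite lte_mul_pinfty ?lee_fin ?sqr_ge0//; exact: quantile_sqr_lty.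
apply: sqr_add_lty; rewrite ?H//; apply: measurable_funM => //; exact: measurable_quantile.
Qed.

Let m2 t : (\int[law U01 (mf t)]_x (x ^+ 2)%:E < +oo)%E.
Proof.
rewrite (@integral_image _ _ _ _ _ U01 (law U01 (mf t)) _ _ (mf t))//.
by apply/measurable_EFinP; exact: exprn_measurable.
Qed.

Definition interpolation (t : R) : P2 R := MkP2 (m2 t).

Let interpE t (A : set R) : interpolation t A = U01 (f t @^-1` A).
Proof. by []. Qed.

Let nf t : 0 <= t <= 1 -> mono01 (f t).
Proof.
move=> /andP[t0 t1] p q p0 pq q1; apply: lerD; apply: ler_wpM2l; rewrite ?subr_ge0//;
exact: quantile_nd.
Qed.

Let cone_f t : 0 <= t <= 1 -> cone01 (f t).
Proof.
move=> t01; split; last exact: nf.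
by rewrite /L2_01 /=; apply/Lfun2P; split; [exact: mf|exact: f2].
Qed.

(** Each quantile loses at most half of the gap [f t p - y] at a suitable point left of [p]. By
    monotonicity the larger of the two points serves both, and so does it for their convex
    combination. *)
Let lf t p y : 0 <= t <= 1 -> 0 < p < 1 -> y < f t p ->
  exists2 p', 0 < p' < p & y < f t p'.
Proof.
move=> /andP[t0 t1] p01 yf; pose e := f t p - y; have e0 : 0 < e by rewrite subr_gt0.
have e20 : 0 < e / 2 by rewrite divr_gt0.
have lt m : quantile m p - e / 2 < quantile m p by rewrite gtrBl.
have [a /andP[a0 ap] Ha] := quantile_lc p01 (lt mu).
have [b /andP[b0 bp] Hb] := quantile_lc p01 (lt nu).
have /andP[p0 p1] := p01.
have c0 : 0 < Num.max a b by rewrite lt_max a0.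
have cp : Num.max a b < p by rewrite gt_max ap.
exists (Num.max a b); first by rewrite c0.
have Ha' : quantile mu p - e / 2 <= quantile mu (Num.max a b).
  rewrite (le_trans (ltW Ha))// quantile_nd//; last exact: lt_trans p1.
  by rewrite le_max lexx.
have Hb' : quantile nu p - e / 2 <= quantile nu (Num.max a b).
  rewrite (le_trans (ltW Hb))// quantile_nd//; last exact: lt_trans p1.
  by rewrite le_max lexx orbT.
have t1' : 0 <= 1 - t by rewrite subr_ge0.
have := ler_wpM2l t1' Ha'; have := ler_wpM2l t0 Hb'.
move: e0 e20 => {Ha Hb Ha' Hb' lt}; rewrite /e /f; lra.
Qed.

Lemma quantile_interpolation t p : 0 <= t <= 1 -> 0 < p < 1 ->
  quantile (interpolation t) p = (1 - t) * quantile mu p + t * quantile nu p.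
Proof.
move=> t01; apply: (quantile_law (mf t) (nf t01)).
- by move=> q y; exact: lf.
- by move=> A _; exact: interpE.
Qed.

Lemma geodesic_interpolation : geodesic01 interpolation.
Proof.
exists (Num.sqrt (fine (\int[U01]_p ((quantile mu p - quantile nu p) ^+ 2)%:E)%E)).
  exact: sqrtr_ge0.
move=> s t s01 t01.
rewrite (W2_mono (mf s) (mf t) (nf s01) (nf t01) (fun A _ => interpE s A) (fun A _ => interpE t A)).
have mQ := @measurable_quantile R.
have d2 : (\int[U01]_p ((quantile mu p - quantile nu p) ^+ 2)%:E < +oo)%E.
  apply: (@sqr_add_lty R _ _ U01 (quantile mu) (fun p => - quantile nu p)).
  - exact: mQ.
  - by apply: measurable_funN; exact: mQ.
  - exact: quantile_sqr_lty.
  - by under eq_integral do rewrite sqrrN; exact: quantile_sqr_lty.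
have d0 : (0 <= \int[U01]_p ((quantile mu p - quantile nu p) ^+ 2)%:E)%E.
  exact: (int_sqr_ge0 U01 (fun p => quantile mu p - quantile nu p)).
(* Linear interpolation gives [f s - f t = (t - s) * (quantile mu - quantile nu)], so the speed is
   the distance of the endpoints. *)
rewrite (_ : (\int[U01]_p ((f s p - f t p) ^+ 2)%:E =
  ((t - s) ^+ 2)%:E * \int[U01]_p ((quantile mu p - quantile nu p) ^+ 2)%:E)%E).
  rewrite fineM//; last by rewrite ge0_fin_numE.
  by rewrite /= sqrtrM ?sqr_ge0// sqrtr_sqr mulrC.
rewrite -ge0_integralZl//.
- by apply: eq_integral => p _; rewrite -EFinM; congr (_%:E); rewrite /f; ring.
- by apply/measurable_EFinP; apply: measurable_funX; apply: measurable_funB; exact: mQ.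
- by move=> p _; rewrite lee_fin sqr_ge0.
- by rewrite lee_fin sqr_ge0.
Qed.

Lemma convex_interpolation (F : (R -> R) -> \bar R) :
  functional_on cone01 F -> convex_on cone01 F ->
  [/\ geodesic01 interpolation, eqP2 (interpolation 0) mu, eqP2 (interpolation 1) nu &
    forall t, 0 <= t <= 1 -> (F (quantile (interpolation t))
      <= (1 - t)%:E * F (quantile mu) + t%:E * F (quantile nu))%E].
Proof.
move=> [_ Fae] cF; split; first exact: geodesic_interpolation.
- move=> A mA; rewrite interpE quantile_push//; congr (U01 (_ @^-1` A)).
  by apply/funext => p; rewrite /f subr0 mul1r mul0r addr0.
- move=> A mA; rewrite interpE quantile_push//; congr (U01 (_ @^-1` A)).
  by apply/funext => p; rewrite /f subrr mul1r mul0r add0r.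
move=> t t01.
have cq m : cone01 (quantile m) by split; [exact: L2_quantile|exact: mono_quantile].
(* The two functions are known to agree on the open unit interval only, which suffices because [F]
   respects equality almost everywhere. *)
have -> : F (quantile (interpolation t)) = F (f t).
  apply: Fae => //; first exact: cone_f.
  by apply/ae_leb01/ae_U01P => p p01; exact: quantile_interpolation.
exact: cF.
Qed.

End Interpolation.
End Geodesic.

(** * A velocity field in quantile coordinates *)

Section Joint.
Context {R : realType}.
Local Notation T := (measurableTypeR R).
Local Notation L := (@lebesgue_measure R).

Definition ramp (x : R) (n : nat) (y : R) : R := Num.min 1 (Num.max 0 (1 - n%:R * (y - x))).

Lemma ramp_continuous x n : continuous (ramp x n).
Proof.
move=> y; rewrite /ramp.
apply: (@continuous_comp _ _ _ (fun y => Num.max 0 (1 - n%:R * (y - x))) (Num.min 1)).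
  apply: (@continuous_comp _ _ _ (fun y => 1 - n%:R * (y - x)) (Num.max 0)).
    apply: cvgB; first exact: cvg_cst.
    apply: cvgM; first exact: cvg_cst.
    by apply: cvgB; [exact: cvg_id|exact: cvg_cst].
  by apply: continuous_max; [exact: cvg_cst|exact: cvg_id].
by apply: continuous_min; [exact: cvg_cst|exact: cvg_id].
Qed.

Lemma ramp01 x n y : 0 <= ramp x n y <= 1.
Proof. by rewrite /ramp le_min ler01 le_max lexx ge_min lexx. Qed.

Lemma ramp_cvg x y : ramp x n y @[n --> \oo] --> (\1_(`]-oo, x]%classic) y : R).
Proof.
apply: cvg_near_cst; rewrite indicE; have [yx|xy] := leP y x.
  near=> n; rewrite mem_set/= ?in_itv//= /ramp max_r ?min_l//.
    by rewrite lerBrDl gerDr -oppr_ge0 -mulrN opprB mulr_ge0// subr_ge0.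
  by rewrite subr_ge0 (@le_trans _ _ 0)// mulr_ge0_le0// subr_le0.
near=> n; rewrite memNset/= ?in_itv/=; last by rewrite leNgt xy.
rewrite /ramp max_l ?min_r//; rewrite subr_le0 -ler_pdivrMr ?subr_gt0//.
near: n; exact: nbhs_infty_ger.
Unshelve. all: by end_near. Qed.

Variables (gamma : R -> P2 R).
Hypothesis nc : narrowly_continuous `]0, +oo[ gamma.

(** Narrow continuity speaks of bounded continuous functions only. The ramps decrease to the
    indicator of the half-line, so the distribution function is a pointwise limit of functions
    continuous in time. *)
Lemma measurable_cdf_time (x : R) :
  measurable_fun (`]0, +oo[%classic : set T) (fun t => cdf2 (gamma t) x).
Proof.
apply: (@measurable_fun_cvg _ _ _ _ (fun n t => \int[gamma t]_y ramp x n y)).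
- move=> n; apply: subspace_continuous_measurable_fun; first exact: measurable_itv.
  apply: nc; first exact: ramp_continuous.
  by exists 1 => y; have /andP[? ?] := ramp01 x n y; rewrite ger0_norm.
- move=> t _; have mI : @measurable _ R `]-oo, x]%classic by exact: measurable_itv.
  have := @dominated_convergence _ _ _ (gamma t) setT measurableT
    (fun n y => (ramp x n y)%:E) (fun y => (\1_(`]-oo, x]%classic) y)%:E) (cst 1%E).
  case.
  + move=> n; apply/measurable_EFinP; apply: continuous_measurable_fun; exact: ramp_continuous.
  + by apply/measurable_EFinP; exact: measurable_indic.
  + apply: aeW => y _; apply: cvg_EFin; last exact: ramp_cvg.
    by near=> n.
  + apply/integrableP; split; first exact: measurable_cst.
    by under eq_integral do rewrite abse1; rewrite integral_cst// mul1e (_ : _ setT = 1%E) ?ltry//; exact: probability_setT.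
  + apply: aeW => y n _; rewrite /= lee_fin.
    by have /andP[? ?] := ramp01 x n y; rewrite ger0_norm.
  have -> : (\int[gamma t]_y (\1_(`]-oo, x]%classic) y)%:E)%E = (cdf2 (gamma t) x)%:E.
    by rewrite integral_indic ?setIT//; exact: cdf2E.
  by move=> _ _ /fine_cvgP[].
Unshelve. all: by end_near. Qed.

Definition dom (z : R * R) : bool := (0 < z.1) && (0 < z.2 < 1).

Lemma measurable_dom : measurable_fun (setT : set (T * T)) (dom : T * T -> bool).
Proof.
apply: measurable_and; first exact: measurable_fun_ltr.
by apply: measurable_and; exact: measurable_fun_ltr.
Qed.

(** Set to 0 outside the strip where the quantile function is meaningful, to be
    jointly measurable on the whole plane. *)
Definition Qh (z : R * R) : R := if dom z then quantile (gamma z.1) z.2 else 0.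

(** By [quantile_le], [x < Q_t p] means [cdf2 (gamma t) x < p]: joint measurability reduces to
    measurability in time for a fixed [x]. *)
Lemma measurable_Qh : measurable_fun (setT : set (T * T)) (Qh : T * T -> R).
Proof.
apply: (measurability _ (RGenOInfty.measurableE R)) => //.
move=> _ [_ [x ->] <-]; rewrite setTI.
pose c (t : R) := if 0 < t then cdf2 (gamma t) x else 0.
have mc : measurable_fun (setT : set T) (c : T -> R).
  apply: measurable_fun_if => //; first exact: measurable_fun_ltr.
  rewrite setTI (_ : _ @^-1` _ = `]0, +oo[%classic); first exact: measurable_cdf_time.
  by apply/seteqP; split => t /=; rewrite in_itv/= andbT.
have mD b : measurable (dom @^-1` [set b] : set (T * T)).
  by rewrite -[_ @^-1` _]setTI; exact: measurable_dom.
have mc2 : measurable [set z : T * T | c z.1 < z.2].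
  rewrite -[X in measurable X]setTI.
  by apply: measurable_fun_ltr => //; exact: measurableT_comp.
rewrite (_ : _ @^-1` _ = (dom @^-1` [set true] `&` [set z | c z.1 < z.2])
   `|` (dom @^-1` [set false] `&` [set _ | x < 0])).
  apply: measurableU; apply: measurableI; rewrite //.
  by case: (x < 0); [rewrite (_ : [set _ | _] = setT)//|rewrite (_ : [set _ | _] = set0)//];
    apply/seteqP; split.
apply/seteqP; split => -[t p] /=; rewrite in_itv/= andbT /Qh.
  case: ifPn => [dz xq|dz x0]; last by right; split => //; apply/negbTE.
  left; split => //; have /andP[/= t0 p01] := dz; rewrite /c t0.
  by rewrite ltNge -quantile_le// -ltNge.
move=> [[dz]|[dz x0]].
  have /andP[/= t0 p01] := dz; rewrite dz /c t0.
  by rewrite ltNge -quantile_le// -ltNge.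
by rewrite dz.
Qed.

Lemma Qh_slice (t : R) (g : R -> \bar R) : 0 < t -> measurable_fun setT g ->
  (\int[gamma t]_x g x = \int[U01]_p g (Qh (t, p)))%E.
Proof.
move=> t0 mg; rewrite integral_quantile//.
have mS : measurable_fun (setT : set T) (fun p => Qh (t, p)).
  apply: (measurableT_comp measurable_Qh); exact: pair1_measurable.
apply: ae_eq_integral => //.
- by apply: measurableT_comp => //; exact: measurable_quantile.
- by apply: measurableT_comp.
- by apply: ae_U01P => p p01 _; rewrite /Qh /dom/= t0 p01.
Qed.

Variable v : R -> R -> R.
Hypothesis mv : measurable_fun ((`]0, +oo[%classic : set R) `*` setT) (fun z : R * R => v z.1 z.2).

Definition Vh (z : R * R) : R := if dom z then v z.1 (Qh z) else 0.

Lemma measurable_Vh : measurable_fun (setT : set (T * T)) (Vh : T * T -> R).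
Proof.
apply: measurable_fun_if => //; first exact: measurable_dom.
rewrite setTI.
apply: (@measurable_comp _ _ _ _ _ _ ((`]0, +oo[%classic : set R) `*` setT) (fun z : R * R => v z.1 z.2)
  _ (fun z : T * T => (z.1, Qh z))).
- by apply: measurableX => //; exact: measurable_itv.
- move=> _ [[t p] /= dz <-]; split => //=; rewrite in_itv/= andbT.
  by move: dz => /andP[].
- exact: mv.
- apply: measurable_funTS; apply: measurable_fun_pair => //; exact: measurable_Qh.
Qed.

Lemma measurable_v_slice (t : R) : 0 < t -> measurable_fun setT (v t).
Proof.
move=> t0.
apply: (@measurable_comp _ _ _ _ _ _ ((`]0, +oo[%classic : set R) `*` setT) (fun z : R * R => v z.1 z.2)
  _ (fun x : R => (t, x))).
- by apply: measurableX => //; exact: measurable_itv.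
- by move=> _ [x _ <-]; split => //=; rewrite in_itv/= andbT.
- exact: mv.
- exact: pair1_measurable.
Qed.

Lemma Vh_slice (t : R) (g : R * R -> \bar R) : 0 < t -> measurable_fun setT g ->
  (\int[gamma t]_x g (x, v t x) = \int[U01]_p g (Qh (t, p), Vh (t, p)))%E.
Proof.
move=> t0 mg.
have mvt := measurable_v_slice t0.
have mg1 : measurable_fun setT (fun x : R => g (x, v t x)).
  by apply: (measurableT_comp mg); exact: measurable_fun_pair.
have mQs : measurable_fun (setT : set T) (fun p => Qh (t, p)).
  apply: (measurableT_comp measurable_Qh); exact: pair1_measurable.
have mVs : measurable_fun (setT : set T) (fun p => Vh (t, p)).
  apply: (measurableT_comp measurable_Vh); exact: pair1_measurable.
rewrite (Qh_slice t0 mg1); apply: ae_eq_integral => //.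
- exact: (measurableT_comp mg1 mQs).
- by apply: (measurableT_comp mg); exact: measurable_fun_pair.
- by apply: ae_U01P => p p01 _; rewrite /Vh /dom/= t0 p01.
Qed.

Hypothesis vint : forall a b : R, `[a, b] `<=` `]0, +oo[%classic ->
  (\int[L]_(t in `[a, b]) 'N[gamma t]_2[EFin \o v t] < +oo)%E.

Lemma measurable_sqrV : measurable_fun (setT : set (T * T)) (fun z => (Vh z ^+ 2)%:E : \bar R).
Proof. by apply/measurable_EFinP; apply: measurable_funX; exact: measurable_Vh. Qed.

Lemma Lnorm_v (t : R) : 0 < t ->
  ('N[gamma t]_2[EFin \o v t] = (\int[U01]_p (Vh (t, p) ^+ 2)%:E) `^ 2^-1)%E.
Proof.
move=> t0; rewrite Lnorm2E (Vh_slice (g := fun z => (z.2 ^+ 2)%:E))//.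
by apply/measurable_EFinP; apply: measurable_funX; exact: measurable_snd.
Qed.

Lemma measurable_absV : measurable_fun (setT : set (T * T)) (fun z => `|Vh z|%:E : \bar R).
Proof. by apply/measurable_EFinP; apply: measurableT_comp => //; exact: measurable_Vh. Qed.

Lemma measurable_intV2 :
  measurable_fun (setT : set T) (fun t => \int[U01]_p (Vh (t, p) ^+ 2)%:E)%E.
Proof.
have V0 (z : T * T) : (0 <= (Vh z ^+ 2)%:E :> \bar R)%E by rewrite lee_fin sqr_ge0.
exact: (@measurable_fun_fubini_tonelli_F _ _ _ _ R U01 (fun z => (Vh z ^+ 2)%:E) measurable_sqrV V0).
Qed.

(** At each time the L1 norm is at most the L2 norm, by the Hoelder inequality against the constant
    1 on a probability space. *)
Lemma Vh_L1 (a b : R) : 0 < a ->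
  (\int[L]_(t in `[a, b]) \int[U01]_p `|Vh (t, p)|%:E < +oo)%E.
Proof.
move=> a0; have sub : `[a, b] `<=` `]0, +oo[%classic.
  by move=> t /=; rewrite !in_itv/= andbT => /andP[/(lt_le_trans a0)].
apply: le_lt_trans (vint sub).
have mI : measurable (`[a, b]%classic : set T) by exact: measurable_itv.
apply: ge0_le_integral => //.
- by move=> t _; apply: integral_ge0 => p _; rewrite lee_fin.
- apply: measurable_funTS.
  exact: (@measurable_fun_fubini_tonelli_F _ _ _ _ R U01 (fun z => `|Vh z|%:E) measurable_absV).
- apply: (eq_measurable_fun (fun t => (\int[U01]_p (Vh (t, p) ^+ 2)%:E) `^ 2^-1)%E).
    move=> t /set_mem /= tab; rewrite Lnorm_v//.
    by have := sub _ tab; rewrite /= in_itv/= andbT.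
  apply: measurable_funTS; apply: (measurableT_comp (measurable_poweR _)).
  exact: measurable_intV2.
move=> t tab; have t0 : 0 < t by have := sub _ tab; rewrite /= in_itv/= andbT.
rewrite Lnorm_v//.
have mVs : measurable_fun (setT : set T) (fun p => Vh (t, p)).
  apply: (measurableT_comp measurable_Vh); exact: pair1_measurable.
have := @hoelder _ _ _ U01 (fun p => Vh (t, p)) (cst 1) 2 2 mVs.
move=> /(_ (measurable_cst _) _ _ _).
rewrite Lnorm1 Lnorm2E.
have -> : ('N[U01]_2[EFin \o cst 1%R] = 1 :> \bar R)%E.
  rewrite Lnorm2E; under eq_integral do rewrite expr1n.
  rewrite integral_cst// mul1e; transitivity (1 `^ 2^-1 : \bar R)%E; last exact: poweR1r.
  by congr (_ `^ _)%E; exact: probability_setT.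
rewrite mule1 => H; apply: le_trans (H _ _ _) => //.
  rewrite le_eqVlt; apply/orP; left; apply/eqP; apply: eq_integral => p _ /=.
  by rewrite mulr1.
by rewrite [RHS]splitr !div1r.
Qed.

Lemma ae_v_Lfun : {ae L, forall t : R, 0 < t -> v t \in Lfun (gamma t) 2%:E}.
Proof.
(* Integrability of the norm is local, so the positive times are exhausted by compact intervals. *)
have H (n : nat) : {ae L, forall t : R, n.+1%:R^-1 <= t <= n.+1%:R ->
    ('N[gamma t]_2[EFin \o v t] < +oo)%E}.
  set I := `[(n.+1%:R^-1 : R), n.+1%:R].
  have sub : [set` I] `<=` `]0, +oo[%classic.
    move=> t /=; rewrite !in_itv/= andbT => /andP[+ _]; apply: lt_le_trans.
    by rewrite invr_gt0.
  have mI : measurable ([set` I] : set T) by exact: measurable_itv.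
  have fi : L.-integrable [set` I] (fun t => 'N[gamma t]_2[EFin \o v t])%E.
    apply/integrableP; split.
      apply: (eq_measurable_fun (fun t => (\int[U01]_p (Vh (t, p) ^+ 2)%:E) `^ 2^-1)%E).
        move=> t /set_mem /= tab; rewrite Lnorm_v//.
        by have := sub _ tab; rewrite /= in_itv/= andbT.
      apply: measurable_funTS; apply: (measurableT_comp (measurable_poweR _)).
      exact: measurable_intV2.
    under eq_integral do rewrite gee0_abs ?Lnorm_ge0//.
    exact: vint.
  have := integrable_ae mI fi; apply: filterS => t Ht tI.
  have /Ht : [set` I] t by rewrite /= in_itv/=.
  by move=> /fin_numPlt/andP[].
have := ae_foralln H; apply: filterS => t Ht t0.
apply/Lfun2P; split; first exact: measurable_v_slice.
have [n] : exists n : nat, n.+1%:R^-1 <= t <= n.+1%:R.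
  exists (Num.trunc (Num.max t t^-1)); apply/andP; split.
    rewrite invf_ple ?posrE// ltW// (le_lt_trans _ (truncnS_gt _))//.
    by rewrite le_max lexx orbT.
  by rewrite ltW// (le_lt_trans _ (truncnS_gt _))// le_max lexx.
move=> /(Ht n); rewrite Lnorm2E => /(poweR_lty 2).
by rewrite -poweRrM ?mulVf// poweRe1 ?int_sqr_ge0.
Qed.

End Joint.

(** * Cut-offs and mollification *)

Section Plateau.
Context {R : realType}.
Local Notation L := (@lebesgue_measure R).

Lemma derive1_sstep_out (y : R) : (y < 0) || (1 < y) -> derive1 sstep y = 0.
Proof.
move=> /orP[y0|y1].
  apply: (@derive1_near0 _ _ _ 0); near=> z; apply: sstep_eq0; apply: ltW; near: z.
  exact: lt_nbhsl.
apply: (@derive1_near0 _ _ _ 1); near=> z; apply: sstep_eq1; apply: ltW; near: z.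
exact: lt_nbhsr.
Unshelve. all: by end_near. Qed.

Definition plateau (k a b x : R) : R := sstep (k * (x - a)) * sstep (k * (b - x)).

Lemma plateauE (k a b : R) : plateau k a b =
  fun x => sstep (k * x + - (k * a)) * sstep (- k * x + k * b).
Proof. by apply/funext => x; rewrite /plateau; congr (sstep _ * sstep _); ring. Qed.

Lemma smooth_plateau k a b : smooth (plateau k a b).
Proof.
by move=> n; rewrite plateauE; apply: CnM; apply: Cn_affine; exact: smooth_sstep.
Qed.

Lemma plateau01 k a b x : 0 <= plateau k a b x <= 1.
Proof. by rewrite mulr_ge0 ?sstep_ge0//= mulr_ile1 ?sstep_ge0 ?sstep_le1. Qed.

Lemma plateau_out k a b x : 0 <= k -> (x <= a) || (b <= x) -> plateau k a b x = 0.
Proof.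
move=> k0 /orP[xa|bx]; rewrite /plateau.
  by rewrite sstep_eq0 ?mul0r// mulr_ge0_le0// subr_le0.
by rewrite (@sstep_eq0 _ (k * (b - x))) ?mulr0// mulr_ge0_le0// subr_le0.
Qed.

Lemma plateau_in k a b x : 1 <= k * (x - a) -> 1 <= k * (b - x) -> plateau k a b x = 1.
Proof. by move=> h1 h2; rewrite /plateau !sstep_eq1// mulr1. Qed.

Lemma derive1_plateau k a b x : derive1 (plateau k a b) x =
  k * (derive1 sstep (k * (x - a)) * sstep (k * (b - x))
       - sstep (k * (x - a)) * derive1 sstep (k * (b - x))).
Proof.
apply: is_derive_derive1; rewrite plateauE.
have d1 : is_derive x (1 : R) (fun x => sstep (k * x + - (k * a)))
    (derive1 sstep (k * x + - (k * a)) * k).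
  apply: (@is_derive1_comp _ sstep (fun y : R => k * y + - (k * a))).
    exact/smooth_is_derive/smooth_sstep.
  exact: is_derive_affine.
have d2 : is_derive x (1 : R) (fun x => sstep (- k * x + k * b))
    (derive1 sstep (- k * x + k * b) * - k).
  apply: (@is_derive1_comp _ sstep (fun y : R => - k * y + k * b)).
    exact/smooth_is_derive/smooth_sstep.
  exact: is_derive_affine.
have dM := is_deriveM d1 d2.
apply: is_derive_eq.
have -> : k * (x - a) = k * x + - (k * a) by ring.
have -> : k * (b - x) = - k * x + k * b by ring.
by rewrite -![_ *: _]/(_ * _); ring.
Qed.

Lemma derive1_plateau_in k a b x : 1 < k * (x - a) -> 1 < k * (b - x) ->
  derive1 (plateau k a b) x = 0.
Proof.
by move=> h1 h2; rewrite derive1_plateau !derive1_sstep_out ?h1 ?h2 ?orbT// mul0r mulr0 subr0 mulr0.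
Qed.

Lemma derive1_plateau_le M k a b x : (forall y, `|derive1 (@sstep R) y| <= M) ->
  `|derive1 (plateau k a b) x| <= `|k| * (M + M).
Proof.
move=> HM; rewrite derive1_plateau normrM ler_wpM2l// (le_trans (ler_normB _ _))//.
have S1 (y : R) : `|sstep y| <= 1 by rewrite ger0_norm ?sstep_ge0 ?sstep_le1.
rewrite (normrM (derive1 sstep (k * (x - a)))) (normrM (sstep (k * (x - a)))); apply: lerD.
  have := ler_pM (normr_ge0 _) (normr_ge0 _) (HM (k * (x - a))) (S1 (k * (b - x))).
  by rewrite mulr1.
have := ler_pM (normr_ge0 _) (normr_ge0 _) (S1 (k * (x - a))) (HM (k * (b - x))).
by rewrite mul1r.
Qed.

(** The two flanks of a plateau, differentiated: kernels of integral 1 that concentrate at [a] from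
    the right and, for [bumpr], at [b] from the left as [k] grows. *)
Definition bumpl (k a x : R) : R := k * derive1 sstep (k * (x - a)).
Definition bumpr (k b x : R) : R := k * derive1 sstep (k * (b - x)).

(** Each transition has length [k^-1]. If the plateau is longer than both together, one factor
    equals 1 wherever the other varies. *)
Lemma derive1_plateau_split k a b x : 0 < k -> 2 < k * (b - a) ->
  derive1 (plateau k a b) x = bumpl k a x - bumpr k b x.
Proof.
move=> k0 kab; rewrite derive1_plateau /bumpl /bumpr -mulrBr.
have E : k * (b - x) = k * (b - a) - k * (x - a) by ring.
congr (_ * (_ - _)).
  have [h|h] := boolP ((k * (x - a) < 0) || (1 < k * (x - a))).
    by rewrite derive1_sstep_out// mul0r.
  rewrite (@sstep_eq1 _ (k * (b - x))) ?mulr1//.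
  by move: h; rewrite negb_or -!leNgt => /andP[_ h]; lra.
have [h|h] := boolP ((k * (b - x) < 0) || (1 < k * (b - x))).
  by rewrite derive1_sstep_out// mulr0.
rewrite (@sstep_eq1 _ (k * (x - a))) ?mul1r//.
by move: h; rewrite negb_or -!leNgt => /andP[_ h]; lra.
Qed.

Lemma derive1_sstep_cont : continuous (derive1 (@sstep R)).
Proof. exact/smooth_continuous/smooth_derive1/smooth_sstep. Qed.

Lemma bumpl_cont k a : continuous (bumpl k a).
Proof.
move=> x; apply: cvgM; first exact: cvg_cst.
apply: (@continuous_comp _ _ _ (fun x => k * (x - a)) (derive1 sstep)).
  by apply: cvgM; [exact: cvg_cst|apply: cvgB; [exact: cvg_id|exact: cvg_cst]].
exact: derive1_sstep_cont.
Qed.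

Lemma bumpr_cont k a : continuous (bumpr k a).
Proof.
move=> x; apply: cvgM; first exact: cvg_cst.
apply: (@continuous_comp _ _ _ (fun x => k * (a - x)) (derive1 sstep)).
  by apply: cvgM; [exact: cvg_cst|apply: cvgB; [exact: cvg_cst|exact: cvg_id]].
exact: derive1_sstep_cont.
Qed.

Lemma bumpl_out k a x : 0 < k -> (x < a - k^-1) || (a + k^-1 < x) -> bumpl k a x = 0.
Proof.
move=> k0 h; rewrite /bumpl derive1_sstep_out ?mulr0//.
have ki : 0 < k^-1 by rewrite invr_gt0.
move: h => /orP[h|h]; apply/orP; [left|right].
  by rewrite pmulr_rlt0// subr_lt0; lra.
by rewrite -ltr_pdivrMl// mulr1; lra.
Qed.

Lemma bumpr_out k a x : 0 < k -> (x < a - k^-1) || (a + k^-1 < x) -> bumpr k a x = 0.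
Proof.
move=> k0 h; rewrite /bumpr derive1_sstep_out ?mulr0//.
have ki : 0 < k^-1 by rewrite invr_gt0.
move: h => /orP[h|h]; apply/orP; [right|left].
  by rewrite -ltr_pdivrMl// mulr1; lra.
by rewrite pmulr_rlt0// subr_lt0; lra.
Qed.

Lemma bumpl_int (k a : R) : 0 < k ->
  (\int[L]_(x in `[(a - k^-1)%R, (a + k^-1)%R]) (bumpl k a x)%:E = 1)%E.
Proof.
move=> k0; have ki : 0 < k^-1 by rewrite invr_gt0.
have d x : is_derive x (1 : R) (fun x => sstep (k * x + - (k * a))) (bumpl k a x).
  have -> : bumpl k a x = derive1 sstep (k * x + - (k * a)) * k.
    by rewrite /bumpl mulrC mulrBr.
  apply: (@is_derive1_comp _ sstep (fun y : R => k * y + - (k * a))).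
    exact/smooth_is_derive/smooth_sstep.
  exact: is_derive_affine.
rewrite (@continuous_FTC2 _ _ (fun x => sstep (k * x + - (k * a)))).
- rewrite (_ : k * (a + k^-1) + - (k * a) = 1); last by field; rewrite gt_eqF.
  rewrite (_ : k * (a - k^-1) + - (k * a) = - 1); last by field; rewrite gt_eqF.
  by rewrite sstep_eq1// sstep_eq0 ?oppr0 ?sube0// lerN10.
- lra.
- exact/continuous_subspaceT/bumpl_cont.
- have cs : continuous (fun x => sstep (k * x + - (k * a))).
    exact/smooth_continuous/(fun n => Cn_affine k (- (k * a)) (smooth_sstep n)).
  split.
  + by move=> x _; have [] := d x.
  + by apply: cvg_at_right_filter; exact: cs.
  + by apply: cvg_at_left_filter; exact: cs.
- by move=> x _; exact: is_derive_derive1.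
Qed.

Lemma bumpr_int (k a : R) : 0 < k ->
  (\int[L]_(x in `[(a - k^-1)%R, (a + k^-1)%R]) (bumpr k a x)%:E = 1)%E.
Proof.
move=> k0; have ki : 0 < k^-1 by rewrite invr_gt0.
have d x : is_derive x (1 : R) (fun x => - sstep (- k * x + k * a)) (bumpr k a x).
  have -> : bumpr k a x = - (derive1 sstep (- k * x + k * a) * - k).
    by rewrite /bumpr mulrN opprK mulrC (_ : - k * x + k * a = k * (a - x))//; ring.
  apply: is_deriveN; apply: (@is_derive1_comp _ sstep (fun y : R => - k * y + k * a)).
    exact/smooth_is_derive/smooth_sstep.
  exact: is_derive_affine.
rewrite (@continuous_FTC2 _ _ (fun x => - sstep (- k * x + k * a))).
- rewrite (_ : - k * (a + k^-1) + k * a = - 1); last by field; rewrite gt_eqF.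
  rewrite (_ : - k * (a - k^-1) + k * a = 1); last by field; rewrite gt_eqF.
  by rewrite (sstep_eq1 (lexx 1)) (@sstep_eq0 _ (-1)) ?lerN10// oppr0 sub0e -EFinN opprK.
- lra.
- exact/continuous_subspaceT/bumpr_cont.
- have cs : continuous (fun x => - sstep (- k * x + k * a)).
    move=> x; apply: cvgN.
    exact: (smooth_continuous (fun n => Cn_affine (- k) (k * a) (smooth_sstep n))).
  split.
  + by move=> x _; have [] := d x.
  + by apply: cvg_at_right_filter; exact: cs.
  + by apply: cvg_at_left_filter; exact: cs.
- by move=> x _; exact: is_derive_derive1.
Qed.

(** As [K] has integral 1, the difference is the integral of [K x * (g x - g c)]; [2 * M] is the
    height [M / d] times the length [2 * d]. Balls centred at [c] cover left and right kernels
    alike. *)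
Lemma mollify (K g : R -> R) (c d M B e : R) : 0 < d -> continuous K ->
  (forall x, (x < c - d) || (c + d < x) -> K x = 0) ->
  (forall x, `|K x| <= M / d) ->
  (\int[L]_(x in `[(c - d)%R, (c + d)%R]) (K x)%:E = 1)%E ->
  measurable_fun setT g -> (forall x, `|g x| <= B) ->
  (forall x, c - d <= x <= c + d -> `|g x - g c| <= e) ->
  L.-integrable setT (fun x => (K x * g x)%:E) /\
  `|\int[L]_x (K x * g x) - g c| <= 2 * M * e.
Proof.
move=> d0 cK K0 KM K1 mg gB ge.
set I := `[c - d, c + d]%classic.
have mI : measurable (I : set (measurableTypeR R)) by exact: measurable_itv.
have LI : L I = (2 * d)%:E.
  rewrite /I lebesgue_measure_itv/= lte_fin ifT; last by lra.
  by rewrite -EFinD; congr (_%:E); ring.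
have LIoo : (L I < +oo)%E by rewrite LI ltry.
have mK : measurable_fun setT K by exact: continuous_measurable_fun.
have bi (h : R -> R) C : measurable_fun setT h -> (forall x, I x -> `|h x| <= C) ->
    L.-integrable I (EFin \o h).
  move=> mh hC; apply: measurable_bounded_integrable => //; first exact: measurable_funTS.
  exists C; split; first exact: num_real.
  by move=> x Cx y Iy /=; apply: le_trans (hC _ Iy) (ltW Cx).
have K0I x : x \notin I -> K x = 0.
  move=> /negP xI; rewrite K0// -[_ || _]negbK negb_or -!leNgt; apply/negP => h; apply: xI.
  by apply/mem_set; rewrite /I/= in_itv.
have mKg : measurable_fun setT (fun x => K x * g x) by exact: measurable_funM.
have iKg : L.-integrable I (EFin \o (fun x => K x * g x)).
  by apply: (bi _ (M / d * B)) => // x _; rewrite normrM ler_pM.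
have iK : L.-integrable I (EFin \o K) by apply: (bi _ (M / d)).
have iKc : L.-integrable I (EFin \o (fun x => K x * g c)).
  by apply: (bi _ (M / d * B)) => [|x _]; [exact: measurable_funM|rewrite normrM ler_pM].
split.
  rewrite (_ : (fun x => (K x * g x)%:E) = (EFin \o (fun x => K x * g x)) \_ I).
    by rewrite -integrable_mkcond.
  by apply/funext => x; rewrite patchE; case: ifPn => // /K0I ->; rewrite mul0r.
have -> : \int[L]_x (K x * g x) = \int[L]_(x in I) (K x * g x).
  rewrite [RHS]Rintegral_mkcond; apply: eq_Rintegral => x _.
  by rewrite patchE; case: ifPn => // /K0I ->; rewrite mul0r.
have -> : g c = \int[L]_(x in I) (K x * g c).
  by rewrite RintegralZr// /Rintegral K1 mul1r.
rewrite -RintegralB//.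
apply: le_trans (le_normr_Rintegral _ _) _ => //.
  by have := integrableB mI iKg iKc.
apply: (@le_trans _ _ (\int[L]_(x in I) (M / d * e))).
  apply: le_Rintegral => //.
  - apply: (bi _ (M / d * B + M / d * B)).
      by apply: measurableT_comp => //; apply: measurable_funB => //; exact: measurable_funM.
    move=> x _; rewrite normr_id (le_trans (ler_normB _ _))// lerD// normrM ler_pM//.
  - by apply: (bi _ `|M / d * e|).
  - move=> x Ix; rewrite -mulrBr normrM ler_pM//; apply: ge.
    by move: Ix; rewrite /I/= in_itv.
rewrite Rintegral_cst// le_eqVlt; apply/orP; left; apply/eqP.
transitivity (M / d * e * (2 * d)); last by field; rewrite gt_eqF.
by congr (_ * _); rewrite -[RHS]/(fine (2 * d)%:E) -LI.
Qed.

End Plateau.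

(** * The continuity equation in quantile coordinates *)

Section Weak.
Context {R : realType}.
Local Notation T := (measurableTypeR R).
Local Notation L := (@lebesgue_measure R).
Local Notation PM := (@lebesgue_measure R \x U01)%E.

Variables (gamma : R -> P2 R) (v : R -> R -> R).
Hypothesis nc : narrowly_continuous `]0, +oo[ gamma.
Hypothesis lv : loc_velocity_field `]0, +oo[ gamma v.
Local Notation Q := (Qh gamma).
Local Notation V := (Vh gamma v).

Lemma velocity_measurable :
  measurable_fun ((`]0, +oo[%classic : set R) `*` setT) (fun z : R * R => v z.1 z.2).
Proof. by case: lv. Qed.
Let mv := velocity_measurable.

Lemma measurable_Q : measurable_fun (setT : set (T * T)) (Q : T * T -> R).
Proof. exact: measurable_Qh. Qed.

Lemma measurable_V : measurable_fun (setT : set (T * T)) (V : T * T -> R).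
Proof. exact: measurable_Vh. Qed.

Lemma measurable_comp_fst (f : R -> R) : measurable_fun setT f ->
  measurable_fun (setT : set (T * T)) (fun z => f z.1 : R).
Proof. by move=> mf; apply: (measurableT_comp mf); exact: measurable_fst. Qed.

Lemma int_prod_fst (h : T -> \bar R) : measurable_fun setT h -> (forall t, 0 <= h t)%E ->
  (\int[PM]_z h z.1 = \int[L]_t h t)%E.
Proof.
move=> mh h0; have mh1 : measurable_fun (setT : set (T * T)) (fun z => h z.1).
  by apply: (measurableT_comp mh); exact: measurable_fst.
rewrite (fubini_tonelli1 (fun z => h z.1))//; apply: eq_integral => t _.
rewrite /fubini_F /= integral_cst//; transitivity (h t * 1)%E; last by rewrite mule1.
by congr (_ * _)%E; exact: probability_setT.
Qed.

(** The common majorant of the integrands: affine in [|V|] and confined to a compact interval of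
    positive times, hence integrable by [Vh_L1]. *)
Lemma dom_integrable (f : T * T -> R) (a b C1 C2 : R) : 0 < a ->
  measurable_fun setT f ->
  (forall z, `|f z| <= \1_(`[a, b]%classic) z.1 * (C1 + C2 * `|V z|)) ->
  PM.-integrable setT (EFin \o f).
Proof.
move=> a0 mf fC.
have mI : measurable (`[a, b]%classic : set T) by exact: measurable_itv.
have m1 : measurable_fun (setT : set (T * T)) (fun z => \1_(`[a, b]%classic) z.1 : R).
  by apply: measurable_comp_fst; exact: measurable_indic.
have i1 : PM.-integrable setT (fun z : T * T => (\1_(`[a, b]%classic) z.1)%:E).
  apply/integrableP; split; first exact/measurable_EFinP.
  under eq_integral do rewrite gee0_abs ?lee_fin//.
  rewrite (int_prod_fst (h := fun t => (\1_(`[a, b]%classic) t)%:E)).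
  - have Lf : (L `[a, b]%classic < +oo)%E.
      by rewrite lebesgue_measure_itv/=; case: ifP => _; rewrite -?EFinD ltry.
    by rewrite integral_indic// setIT.
  - by apply/measurable_EFinP; exact: measurable_indic.
  - by move=> t; rewrite lee_fin.
have m2 : measurable_fun (setT : set (T * T)) (fun z => \1_(`[a, b]%classic) z.1 * `|V z| : R).
  by apply: measurable_funM => //; apply: measurableT_comp => //; exact: measurable_V.
have i2 : PM.-integrable setT (fun z : T * T => (\1_(`[a, b]%classic) z.1 * `|V z|)%:E).
  apply/integrableP; split; first exact/measurable_EFinP.
  under eq_integral do rewrite gee0_abs ?lee_fin ?mulr_ge0//.
  rewrite (fubini_tonelli1 (fun z : T * T => (\1_(`[a, b]%classic) z.1 * `|V z|)%:E)); last 2 first.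
  - exact/measurable_EFinP.
  - by move=> z; rewrite lee_fin mulr_ge0.
  rewrite /fubini_F (_ : (fun t => _) =
    (fun t => \int[U01]_p `|V (t, p)|%:E)%E \_ `[a, b]%classic).
    rewrite -integral_mkcond; apply: Vh_L1 => //; by case: lv.
  apply/funext => t /=; rewrite patchE indicE; case: (_ \in _).
    by apply: eq_integral => p _; rewrite mul1r.
  by apply: integral0_eq => p _; rewrite mul0r.
have iD : PM.-integrable setT (fun z : T * T => (C1%:E * (\1_(`[a, b]%classic) z.1)%:E
    + C2%:E * (\1_(`[a, b]%classic) z.1 * `|V z|)%:E)%E).
  by apply: integrableD => //; exact: integrableZl.
apply: le_integrable iD => //; first exact/measurable_EFinP.
move=> z _ /=; rewrite lee_fin; apply: le_trans (fC z) _.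
by rewrite (le_trans _ (ler_norm _))// mulrDr mulrCA (mulrC C1).
Qed.

Lemma int_prod12 (f : T * T -> R) : PM.-integrable setT (EFin \o f) ->
  (\int[L]_t \int[U01]_p (f (t, p))%:E = \int[PM]_z (f z)%:E)%E.
Proof. by move=> i; exact: (integral12_prod_meas1 i). Qed.

Section test.
Variables (a P : R -> R) (c u w : R).
Hypotheses (sa : smooth a) (sP : smooth P) (u0 : 0 < u) (uw : u <= w).
Hypothesis a0 : forall t, ~ (u <= t <= w) -> a t = 0.
Variables (B B' : R).
Hypotheses (PB : forall x, `|P x| <= B) (PB' : forall x, `|derive1 P x| <= B').

(** The transitions keep length 1 while the interval grows, so the derivatives are bounded uniformly
    in [N]. *)
Let kap (N : nat) := plateau 1 (- N.+1%:R) (N.+1%:R : R).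

Definition weak_integrand (z : T * T) : R :=
  derive1 a z.1 * P (Q z + c * z.1) + a z.1 * ((c + V z) * derive1 P (Q z + c * z.1)).

Let Z (N : nat) (z : T * T) : R :=
  'D_((1, 0) : R^o * R^o) (shear_test a P (kap N) c) (z.1, Q z) +
        V z * 'D_((0, 1) : R^o * R^o) (shear_test a P (kap N) c) (z.1, Q z).

Let ZE N z : Z N z =
  derive1 a z.1 * (P (Q z + c * z.1) * kap N (Q z))
   + a z.1 * (c * derive1 P (Q z + c * z.1) * kap N (Q z))
   + V z * (a z.1 * (derive1 P (Q z + c * z.1) * kap N (Q z)
     + P (Q z + c * z.1) * derive1 (kap N) (Q z))).
Proof.
by rewrite /Z shear_test_D1 ?shear_test_D2//; exact: smooth_plateau.
Qed.

Let da0 t : ~ (u <= t <= w) -> derive1 a t = 0.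
Proof.
move=> tuw; have /orP[tu|wt] : (t < u) || (w < t).
  by rewrite -[_ || _]negbK negb_or -!leNgt; apply/negP.
- apply: (@derive1_near0 _ _ _ 0); near=> y; apply: a0; apply/negP.
  rewrite negb_and -!ltNge; apply/orP; left; near: y; exact: lt_nbhsl.
- apply: (@derive1_near0 _ _ _ 0); near=> y; apply: a0; apply/negP.
  rewrite negb_and -!ltNge; apply/orP; right; near: y; exact: lt_nbhsr.
Unshelve. all: by end_near. Qed.

Let out t : (t < u) || (w < t) -> ~ (u <= t <= w).
Proof. by move=> h; apply/negP; rewrite negb_and -!ltNge. Qed.

Let ms (f : R -> R) : smooth f -> measurable_fun setT f.
Proof. by move=> sf; apply: continuous_measurable_fun; exact: smooth_continuous. Qed.

Let mshear (f : R -> R) : smooth f ->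
  measurable_fun (setT : set (T * T)) (fun z => f (Q z + c * z.1) : R).
Proof.
move=> sf; apply: (measurableT_comp (ms sf)); apply: measurable_funD; first exact: measurable_Q.
by apply: measurable_funM => //; exact: (@measurable_comp_fst id).
Qed.

Let mQs (f : R -> R) : smooth f -> measurable_fun (setT : set (T * T)) (fun z => f (Q z) : R).
Proof. by move=> sf; apply: (measurableT_comp (ms sf)); exact: measurable_Q. Qed.

Lemma measurable_weak_integrand : measurable_fun setT weak_integrand.
Proof.
have sa' := smooth_derive1 sa; have sP' := smooth_derive1 sP.
apply: measurable_funD; apply: measurable_funM.
- by apply: measurable_comp_fst; exact: ms.
- exact: mshear.
- by apply: measurable_comp_fst; exact: ms.
- by apply: measurable_funM; [apply: measurable_funD => //; exact: measurable_V|exact: mshear].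
Qed.

Let mZ N : measurable_fun setT (Z N).
Proof.
have sa' := smooth_derive1 sa; have sP' := smooth_derive1 sP.
have sk := @smooth_plateau R 1 (- N.+1%:R) N.+1%:R.
have sk' := smooth_derive1 sk.
rewrite (funext (ZE N)).
apply: measurable_funD; first apply: measurable_funD.
- apply: measurable_funM; first by apply: measurable_comp_fst; exact: ms.
  by apply: measurable_funM; [exact: mshear|exact: mQs].
- apply: measurable_funM; first by apply: measurable_comp_fst; exact: ms.
  apply: measurable_funM; last exact: mQs.
  by apply: measurable_funM => //; exact: mshear.
- apply: measurable_funM; first exact: measurable_V.
  apply: measurable_funM; first by apply: measurable_comp_fst; exact: ms.
  apply: measurable_funD; apply: measurable_funM.
  + exact: mshear.
  + exact: mQs.
  + exact: mshear.
  + exact: mQs.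
Qed.

(** The continuity equation holds for the test function cut off in space by [kap N]; the cut-off is
    removed by dominated convergence, which leaves a bounded [P] with bounded derivative. *)
Lemma weak_eq : PM.-integrable setT (EFin \o weak_integrand) /\
  (\int[PM]_z (weak_integrand z)%:E = 0)%E.
Proof.
have [A0 HA0] := bounded_supp uw (smooth_continuous sa) (fun t h => a0 (out h)).
have [A1 HA1] := bounded_supp uw (smooth_continuous (smooth_derive1 sa)) (fun t h => da0 (out h)).
have [M HM] := @derive1_sstep_bounded R.
have M0 : 0 <= M by exact: le_trans (HM 0).
have A00 : 0 <= A0 by exact: le_trans (HA0 0).
have A10 : 0 <= A1 by exact: le_trans (HA1 0).
have B0 : 0 <= B by exact: le_trans (PB 0).
have B'0 : 0 <= B' by exact: le_trans (PB' 0).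
have k1 N x : `|kap N x| <= 1.
  by have /andP[? ?] := plateau01 1 (- N.+1%:R) (N.+1%:R : R) x; rewrite ger0_norm.
have k2 N x : `|derive1 (kap N) x| <= M + M.
  by have := derive1_plateau_le 1 (- N.+1%:R) N.+1%:R x HM; rewrite normr1 mul1r.
pose C1 := A1 * B + A0 * (`|c| * B').
pose C2 := A0 * (B' + B * (M + M)).
have bound (z : T * T) (x1 x2 x3 x4 : R) : `|x1| <= B -> `|x2| <= B' -> `|x3| <= 1 -> `|x4| <= M + M ->
   `|derive1 a z.1 * (x1 * x3) + a z.1 * (c * x2 * x3) + V z * (a z.1 * (x2 * x3 + x1 * x4))|
   <= \1_(`[u, w]%classic) z.1 * (C1 + C2 * `|V z|).
  move=> h1 h2 h3 h4; rewrite indicE; have [zI|zI] := boolP (z.1 \in _).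
    rewrite mul1r (le_trans (ler_normD _ _))// lerD//.
      rewrite (le_trans (ler_normD _ _))// lerD// !normrM.
        by rewrite ler_pM// -[leRHS]mulr1 ler_pM.
      by rewrite ler_pM// -[leRHS]mulr1 ler_pM// ler_wpM2l.
    rewrite mulrC normrM ler_wpM2r// normrM ler_pM// (le_trans (ler_normD _ _))//.
    by rewrite lerD// normrM; [rewrite -[leRHS]mulr1|]; rewrite ler_pM.
  have nI : ~ (u <= z.1 <= w).
    by move=> h; move/negP: zI; apply; apply/mem_set; rewrite /= in_itv.
  by rewrite da0// a0// !mul0r mulr0 !addr0 normr0.
have iZ N : PM.-integrable setT (EFin \o Z N).
  apply: (@dom_integrable _ u w C1 C2) => // z; rewrite ZE; exact: bound.
have Z0 N : (\int[PM]_z (Z N z)%:E = 0)%E.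
  rewrite -int_prod12//.
  have [_ _ ce] := lv.
  have sk := @smooth_plateau R 1 (- N.+1%:R) N.+1%:R.
  have tf := @shear_test_function R a P (kap N) c u w N.+1%:R sa sP sk u0 a0.
  have {}tf : test_function `]0, +oo[ (shear_test a P (kap N) c).
    apply: tf => x; move=> h; apply: plateau_out => //.
    by rewrite -[_ || _]negbK negb_or -!ltNge; apply/negP => /andP[/ltW h1 /ltW h2]; apply: h; rewrite h1.
  rewrite -[RHS](ce _ tf) [RHS]integral_mkcond; apply: eq_integral => t _.
  rewrite patchE; case: ifPn => tI.
    have t0 : 0 < t by have := set_mem tI; rewrite /= in_itv/= andbT.
    pose g (xy : R * R) : \bar R := ('D_((1, 0) : R^o * R^o) (shear_test a P (kap N) c) (t, xy.1) +
        xy.2 * 'D_((0, 1) : R^o * R^o) (shear_test a P (kap N) c) (t, xy.1))%:E.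
    have mg : measurable_fun setT g.
      have m1 (f : R -> R) (y : R) : smooth f ->
          measurable_fun setT (fun xy : R * R => f (xy.1 + y) : R).
        move=> sf; apply: (measurableT_comp (ms sf)); apply: measurable_funD => //.
      have m2 (f : R -> R) : smooth f -> measurable_fun setT (fun xy : R * R => f xy.1 : R).
        by move=> sf; apply: (measurableT_comp (ms sf)); exact: measurable_fst.
      have sP' := smooth_derive1 sP; have sk' := smooth_derive1 sk.
      rewrite /g; apply/measurable_EFinP.
      under eq_fun do rewrite shear_test_D1 ?shear_test_D2//=.
      apply: measurable_funD; first apply: measurable_funD; apply: measurable_funM => //.
      + by apply: measurable_funM; [exact: m1|exact: m2].
      + by apply: measurable_funM; [apply: measurable_funM => //; exact: m1|exact: m2].
      + apply: measurable_funM => //; apply: measurable_funD; apply: measurable_funM.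
        * exact: m1.
        * exact: m2.
        * exact: m1.
        * exact: m2.
    by rewrite (Vh_slice nc mv t0 mg).
  have nI : ~ (u <= t <= w).
    move=> /andP[ut _]; move/negP: tI; apply; apply/mem_set.
    by rewrite /= in_itv/= andbT (lt_le_trans u0).
  by apply: integral0_eq => p _; rewrite ZE /= da0// a0// !mul0r mulr0 !addr0.
have := @dominated_convergence _ _ _ PM setT measurableT (fun N z => (Z N z)%:E)
  (EFin \o weak_integrand) (fun z => (\1_(`[u, w]%classic) z.1 * (C1 + C2 * `|V z|))%:E).
case.
- by move=> N; apply/measurable_EFinP.
- by apply/measurable_EFinP; exact: measurable_weak_integrand.
(* As soon as [N] exceeds [|Q z|], the cut-off has value 1 and derivative 0 at [Q z], so the
   sequence has reached its limit. *)
- apply: aeW => z _; apply: cvg_near_cst; near=> N.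
  have lN : `|Q z| < N%:R by near: N; exact: nbhs_infty_gtr.
  have [l1 l2] : - N%:R < Q z /\ Q z < N%:R by move: lN; rewrite ltr_norml => /andP.
  have e1 : kap N (Q z) = 1.
    by rewrite /kap plateau_in// mul1r -natr1; lra.
  have e2 : derive1 (kap N) (Q z) = 0.
    by rewrite /kap derive1_plateau_in// mul1r -natr1; lra.
  by congr (_%:E); rewrite ZE e1 e2 /weak_integrand; ring.
- apply: (@dom_integrable _ u w C1 C2) => //.
    apply: measurable_funM; first by apply: measurable_comp_fst; apply: measurable_indic; exact: measurable_itv.
    apply: measurable_funD => //; apply: measurable_funM => //.
    by apply: measurableT_comp => //; exact: measurable_V.
  move=> z; rewrite ger0_norm// mulr_ge0// addr_ge0//.
    by rewrite addr_ge0// !mulr_ge0.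
  by rewrite !mulr_ge0// addr_ge0// mulr_ge0// addr_ge0.
- apply: aeW => z N _; rewrite lee_fin ZE; exact: bound.
move=> i _ cv; split => //.
have : [sequence (\int[PM]_x (Z n x)%:E)%E]_n x @[x --> \oo] --> (0 : \bar R)%E.
  by apply: cvg_near_cst; near=> N; rewrite /= Z0.
move=> /(cvg_unique _ cv) -> //.
Unshelve. all: by end_near. Qed.

End test.
End Weak.

(** * Increments in time of integrals of sheared functions *)

Section Evolution.
Context {R : realType}.
Local Notation T := (measurableTypeR R).
Local Notation L := (@lebesgue_measure R).
Local Notation PM := (@lebesgue_measure R \x U01)%E.

Lemma adde_eq0_opp (x y : R) (X : \bar R) : ((x - y)%:E + X = 0)%E -> (y - x)%:E = X.
Proof. by case: X => [r| |]// [h]; congr (_%:E); lra. Qed.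

Lemma U01_bounded_integrable (f : R -> R) (B : R) : measurable_fun setT f ->
  (forall x, `|f x| <= B) -> (U01 : {measure set T -> \bar R}).-integrable setT (EFin \o f).
Proof.
move=> mf fB; apply: measurable_bounded_integrable => //.
  by rewrite ltey_eq (fin_num_measure U01 setT measurableT).
exists B; split; first exact: num_real.
by move=> M BM x _ /=; exact: (le_trans (fB x) (ltW BM)).
Qed.

Lemma U01_cst (c : R) : \int[U01]_p c = c.
Proof.
rewrite Rintegral_cst// -[RHS]mulr1; congr (_ * _).
by rewrite -[RHS]/(fine 1%E); congr fine; exact: probability_setT.
Qed.

Lemma U01_norm_le (f : R -> R) (B : R) : measurable_fun setT f ->
  (forall x, `|f x| <= B) -> `|\int[U01]_p f p| <= B.
Proof.
move=> mf fB; have i := U01_bounded_integrable mf fB.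
apply: (le_trans (le_normr_Rintegral _ _)) => //.
rewrite -[leRHS]U01_cst; apply: le_Rintegral => //.
- exact: integrable_norm.
- apply: (@U01_bounded_integrable _ `|B|) => //; exact: measurable_cst.
Qed.

Variables (gamma : R -> P2 R) (v : R -> R -> R).
Hypothesis nc : narrowly_continuous `]0, +oo[ gamma.
Hypothesis lv : loc_velocity_field `]0, +oo[ gamma v.
Local Notation Q := (Qh gamma).
Local Notation V := (Vh gamma v).

Variables (P : R -> R) (c : R).
Hypothesis (sP : smooth P).
Variables (B B' : R).
Hypotheses (PB : forall x, `|P x| <= B) (PB' : forall x, `|derive1 P x| <= B').

Definition gfun (r : R) : R := \int[U01]_p P (Q (r, p) + c * r).

Let ms (f : R -> R) : smooth f -> measurable_fun setT f.
Proof. by move=> sf; apply: continuous_measurable_fun; exact: smooth_continuous. Qed.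

Let mG : measurable_fun (setT : set (T * T)) (fun z => P (Q z + c * z.1) : R).
Proof.
apply: (measurableT_comp (ms sP)); apply: measurable_funD; first exact: measurable_Q.
by apply: measurable_funM => //; exact: (@measurable_comp_fst _ id).
Qed.

Let mQs (r : R) : measurable_fun (setT : set T) (fun p => Q (r, p)).
Proof. apply: (measurableT_comp (measurable_Q nc)); exact: pair1_measurable. Qed.

Let mPs (r d : R) : measurable_fun (setT : set T) (fun p => P (Q (r, p) + d)).
Proof. by apply: (measurableT_comp (ms sP)); apply: measurable_funD. Qed.

Let iPs (r d : R) : (U01 : {measure set T -> \bar R}).-integrable setT
  (EFin \o (fun p => P (Q (r, p) + d))).
Proof. exact: (U01_bounded_integrable (mPs r d) (fun p => PB _)). Qed.

Lemma gfun_le r : `|gfun r| <= B.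
Proof. exact: (U01_norm_le (mPs r (c * r)) (fun p => PB _)). Qed.

Lemma measurable_gfun : measurable_fun (setT : set T) gfun.
Proof.
(* Adding [B] makes the integrand nonnegative, as the Tonelli theorem requires. *)
have m : measurable_fun (setT : set T) (fun r => \int[U01]_p ((P (Q (r, p) + c * r) + B)%:E))%E.
  have H0 (z : T * T) : (0 <= (P (Q z + c * z.1) + B)%:E :> \bar R)%E.
    by rewrite lee_fin -lerBlDr sub0r; have := PB (Q z + c * z.1); rewrite ler_norml => /andP[].
  apply: (@measurable_fun_fubini_tonelli_F _ _ _ _ R U01 (fun z : T * T => (P (Q z + c * z.1) + B)%:E)) => //.
  by apply/measurable_EFinP; exact: measurable_funD.
have -> : gfun = (fun r => fine (\int[U01]_p ((P (Q (r, p) + c * r) + B)%:E))%E - B).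
  apply/funext => r; rewrite -[X in _ = X - B]/(\int[U01]_p (P (Q (r, p) + c * r) + B)).
  rewrite RintegralD//; first by rewrite U01_cst addrK.
  by apply: (@U01_bounded_integrable _ `|B|) => //; exact: measurable_cst.
apply: measurable_funB => //.
by apply: (measurableT_comp (fine_measurable _)).
Qed.

(** With the shift frozen at [c * r0] this is narrow continuity; changing the shift costs at most a
    Lipschitz constant of [P] times [|c| * |r0 - r|]. *)
Lemma gfun_continuous (r0 : R) : 0 < r0 -> {for r0, continuous gfun}.
Proof.
move=> r00.
have H (r d : R) : 0 < r -> \int[U01]_p P (Q (r, p) + d) = \int[gamma r]_x P (x + d).
  move=> r0'; rewrite /Rintegral (Qh_slice nc r0' (g := fun x => (P (x + d))%:E))//.
  apply/measurable_EFinP; apply: (measurableT_comp (ms sP)).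
  exact: measurable_funD.
have cF : {for r0, continuous (fun r => \int[gamma r]_x P (x + c * r0))}.
  have oI : open (`]0, +oo[%classic : set R) by exact: interval_open.
  have cP : continuous (fun x => P (x + c * r0)).
    move=> x; apply: (@continuous_comp _ _ _ (fun x => x + c * r0) P); last exact: smooth_continuous.
    by apply: cvgD; [exact: cvg_id|exact: cvg_cst].
  have := nc cP (ex_intro _ B (fun x => PB _)).
  rewrite (continuous_open_subspace _ oI) => cont; apply: cont.
  by rewrite inE/= in_itv/= r00.
have [C C0 lipP] : exists2 C, 0 < C & forall x y, `|P x - P y| <= C * `|x - y|.
  exists (B' + 1); first by rewrite ltr_wpDl// (le_trans _ (PB' 0)).
  have HL := derive_bound_lip (fun x : R => smooth_derivable sP (x := x)) PB'.
  move=> x y; rewrite (le_trans (HL x y))//.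
  by rewrite ler_wpM2r// lerDl.
have C1 : 0 < C * (`|c| + 1) by rewrite mulr_gt0// ltr_wpDl.
apply/cvgrPdist_le => e e0.
have e20 : 0 < e / 2 by rewrite divr_gt0.
have /cvgrPdist_le /(_ _ e20) nr := cF.
near=> r; have r0' : 0 < r by near: r; exact: lt_nbhsr.
have -> : gfun r0 - gfun r = (\int[gamma r0]_x P (x + c * r0) - \int[gamma r]_x P (x + c * r0))
   + \int[U01]_p (P (Q (r, p) + c * r0) - P (Q (r, p) + c * r)).
  rewrite RintegralB// -!H// /gfun; ring.
rewrite (le_trans (ler_normD _ _))// (splitr e) lerD//; first by near: r.
apply: (@le_trans _ _ (C * (`|c| * `|r0 - r|))).
  apply: U01_norm_le; first exact: (measurable_funB (mPs _ _) (mPs _ _)).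
  move=> p; apply: le_trans (lipP _ _) _; rewrite ler_pM2l//.
  by rewrite (_ : _ - _ = c * (r0 - r)) ?normrM//; ring.
rewrite (@le_trans _ _ (C * (`|c| + 1) * `|r0 - r|))//.
  by rewrite -mulrA ler_pM2l// ler_wpM2r// lerDl.
rewrite -ler_pdivlMl//; near: r.
have /cvgrPdist_le := @cvg_id _ (nbhs r0); apply.
by rewrite mulr_gt0// invr_gt0.
Unshelve. all: by end_near. Qed.

Let H (z : T * T) : R := (c + V z) * derive1 P (Q z + c * z.1).

Let mH : measurable_fun setT H.
Proof.
apply: measurable_funM; first by apply: measurable_funD => //; exact: measurable_V.
apply: (measurableT_comp (ms (smooth_derive1 sP))); apply: measurable_funD; first exact: measurable_Q.
by apply: measurable_funM => //; exact: (@measurable_comp_fst _ id).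
Qed.

Let HB z : `|H z| <= `|c| * B' + B' * `|V z|.
Proof.
by rewrite normrM (mulrC B') -mulrDl; apply: ler_pM => //; exact: ler_normD.
Qed.

(** In [weak_eq] the time factor runs through plateaus that steepen to the indicator of []s, t[].
    Their derivatives are unit kernels at [s] minus unit kernels at [t], and continuity of [gfun]
    yields the endpoint values for every [s < t], not merely almost every one. *)
Lemma evolution (s t : R) : 0 < s -> s < t ->
  (\int[PM]_z (\1_(`]s, t[%classic) z.1 * ((c + V z) * derive1 P (Q z + c * z.1)))%:E
   = (gfun t - gfun s)%:E)%E.
Proof.
move=> s0 st; have t0 := lt_trans s0 st.
pose a n := plateau (n.+1%:R) s t : R -> R.
have sa n : smooth (a n) by exact: smooth_plateau.
have a0 n r : ~ (s <= r <= t) -> a n r = 0.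
  move=> h; apply: plateau_out => //.
  by rewrite -[_ || _]negbK negb_or -!ltNge; apply/negP => /andP[/ltW h1 /ltW h2]; apply: h; rewrite h1.
have a01 n r : `|a n r| <= \1_(`[s, t]%classic) r.
  have [h|h] := pselect (s <= r <= t); last by rewrite a0// normr0.
  rewrite indicE mem_set ?in_itv//=.
  by have /andP[? ?] := plateau01 n.+1%:R s t r; rewrite ger0_norm.
have W n := weak_eq nc lv c (sa n) sP s0 (ltW st) (a0 n) PB PB'.
have iaH n : PM.-integrable setT (EFin \o (fun z : T * T => a n z.1 * H z)).
  apply: (@dom_integrable _ _ _ nc lv _ s t (`|c| * B') B') => //.
    by apply: measurable_funM => //; apply: measurable_comp_fst; exact: ms.
  by move=> z; rewrite normrM ler_pM.
have iaG n : PM.-integrable setT (EFin \o (fun z : T * T => derive1 (a n) z.1 * P (Q z + c * z.1))).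
  have [iw _] := W n.
  have := integrableB measurableT iw (iaH n).
  apply: eq_integrable => // z _ /=; rewrite -EFinB; congr (_%:E).
  by rewrite /weak_integrand /H; ring.
have E0 n : (\int[PM]_z (derive1 (a n) z.1 * P (Q z + c * z.1))%:E +
   \int[PM]_z (a n z.1 * H z)%:E = 0)%E.
  have [iw <-] := W n; rewrite -(integralD measurableT (iaG n) (iaH n)).
  by apply: eq_integral => z _; rewrite /= -EFinD.
have E1 n : (\int[PM]_z (derive1 (a n) z.1 * P (Q z + c * z.1))%:E =
   \int[L]_r (derive1 (a n) r * gfun r)%:E)%E.
  rewrite -int_prod12//; apply: eq_integral => r _.
  have fin : (\int[U01]_p (P (Q (r, p) + c * r))%:E)%E \is a fin_num.
    exact: (integrable_fin_num measurableT (iPs r (c * r))).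
  by rewrite EFinM /gfun fineK// -(integralZl measurableT (iPs r (c * r))).
have [M HM] := @derive1_sstep_bounded R.
have M0 : 0 <= M by exact: le_trans (HM 0).
have bumpl_le (x : R) n y : `|bumpl n.+1%:R x y| <= M / n.+1%:R^-1.
  by rewrite invrK mulrC normrM ger0_norm ?ler0n// ler_wpM2l ?ler0n.
have bumpr_le (x : R) n y : `|bumpr n.+1%:R x y| <= M / n.+1%:R^-1.
  by rewrite invrK mulrC normrM ger0_norm ?ler0n// ler_wpM2l ?ler0n.
have mol (K : nat -> R -> R) (x : R) : 0 < x -> (forall n, continuous (K n)) ->
    (forall n y, (y < x - n.+1%:R^-1) || (x + n.+1%:R^-1 < y) -> K n y = 0) ->
    (forall n y, `|K n y| <= M / n.+1%:R^-1) ->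
    (forall n, (\int[L]_(y in `[(x - n.+1%:R^-1)%R, (x + n.+1%:R^-1)%R]) (K n y)%:E = 1)%E) ->
    (forall n, L.-integrable setT (fun y => (K n y * gfun y)%:E)) /\
    \int[L]_y (K n y * gfun y) @[n --> \oo] --> gfun x.
  move=> x0 cK K0 KM K1.
  have d0 n : 0 < n.+1%:R^-1 :> R by rewrite invr_gt0.
  split=> [n|].
    have [|] // := @mollify R (K n) gfun x _ M B (B + B) (d0 n) (cK n) (K0 n) (KM n) (K1 n) measurable_gfun gfun_le.
    by move=> y _; rewrite (le_trans (ler_normB _ _))// lerD// gfun_le.
  apply/cvgrPdist_le => e e0.
  have M1 : 0 < 2 * M + 1 by rewrite ltr_wpDl// mulr_ge0.
  have e'0 : 0 < e / (2 * M + 1) by rewrite divr_gt0.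
  have /cvgrPdist_le /(_ _ e'0) [d /= d0' Hd] := gfun_continuous x0.
  near=> n.
  have dn : n.+1%:R^-1 < d.
    rewrite invf_plt ?posrE//; near: n.
    by apply: filterS (nbhs_infty_ger d^-1) => m /le_lt_trans; apply; rewrite ltr_nat.
  have [|_] := @mollify R (K n) gfun x _ M B (e / (2 * M + 1)) (d0 n) (cK n) (K0 n) (KM n) (K1 n) measurable_gfun gfun_le.
    move=> y /andP[y1 y2]; rewrite distrC; apply: Hd => /=.
    by rewrite (le_lt_trans _ dn)// ler_distlC y1 y2.
  rewrite distrC => /le_trans; apply.
  by rewrite mulrA ler_pdivrMr// mulrC ler_pM2l// lerDl.
have [il cl] := mol (fun n => bumpl n.+1%:R s) s s0 (fun n => @bumpl_cont _ _ _)
  (fun n y => @bumpl_out _ n.+1%:R s y (ltr0Sn _ _))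
  (bumpl_le s) (fun n => bumpl_int s (ltr0Sn _ _)).
have [ir cr] := mol (fun n => bumpr n.+1%:R t) t t0 (fun n => @bumpr_cont _ _ _)
  (fun n y => @bumpr_out _ n.+1%:R t y (ltr0Sn _ _))
  (bumpr_le t) (fun n => bumpr_int t (ltr0Sn _ _)).
(* Only for large [n] are the two flanks disjoint. *)
have E2 : \forall n \near \oo, (\int[PM]_z (derive1 (a n) z.1 * P (Q z + c * z.1))%:E)%E =
   (\int[L]_y (bumpl n.+1%:R s y * gfun y) - \int[L]_y (bumpr n.+1%:R t y * gfun y))%:E.
  near=> n; rewrite E1.
  have nst : 2 < n.+1%:R * (t - s).
    rewrite -ltr_pdivrMr ?subr_gt0// (@le_lt_trans _ _ n%:R)// ?ltr_nat//.
    by near: n; exact: nbhs_infty_ger.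
  rewrite -(RintegralB measurableT (il n) (ir n)) /Rintegral fineK; last first.
    apply: integrable_fin_num => //; have := integrableB measurableT (il n) (ir n).
    by apply: eq_integrable.
  apply: eq_integral => r _; congr (_%:E).
  by rewrite derive1_plateau_split ?ltr0Sn// mulrBl.
have cI : (\int[PM]_z (a n z.1 * H z)%:E)%E @[n --> \oo] -->
    (\int[PM]_z (\1_(`]s, t[%classic) z.1 * H z)%:E)%E.
  have := @dominated_convergence _ _ _ PM setT measurableT
    (fun n z => (a n z.1 * H z)%:E) (fun z => (\1_(`]s, t[%classic) z.1 * H z)%:E)
    (fun z => (\1_(`[s, t]%classic) z.1 * (`|c| * B' + B' * `|V z|))%:E).
  case.
  - by move=> n; case/integrableP: (iaH n).
  - apply/measurable_EFinP; apply: measurable_funM => //.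
    by apply: measurable_comp_fst; apply: measurable_indic; exact: measurable_itv.
  - apply: aeW => z _; apply: cvg_near_cst; near=> n; congr (_ * _)%:E.
    rewrite indicE; have [zI|zI] := boolP (z.1 \in _); last first.
      rewrite [a n _]plateau_out//.
      rewrite -[_ || _]negbK negb_or -!ltNge; apply/negP => h; move/negP: zI; apply.
      by apply/mem_set; rewrite /= in_itv.
    have /andP[sz zt] : s < z.1 < t by have := set_mem zI; rewrite /= in_itv.
    rewrite [a n _]plateau_in//.
      rewrite -ler_pdivrMr ?subr_gt0// (@le_trans _ _ n%:R) ?ler_nat//.
      by near: n; exact: nbhs_infty_ger.
    rewrite -ler_pdivrMr ?subr_gt0// (@le_trans _ _ n%:R) ?ler_nat//.
    by near: n; exact: nbhs_infty_ger.
  - apply: (@dom_integrable _ _ _ nc lv _ s t (`|c| * B') B') => //.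
      apply: measurable_funM; first by apply: measurable_comp_fst; apply: measurable_indic; exact: measurable_itv.
      apply: measurable_funD => //; apply: measurable_funM => //.
      by apply: measurableT_comp => //; exact: measurable_V.
    have B'0 : 0 <= B' by exact: le_trans (PB' 0).
    by move=> z; rewrite ger0_norm// mulr_ge0// addr_ge0// mulr_ge0.
  - apply: aeW => z n _; rewrite lee_fin normrM ler_pM//.
  by move=> _ _.
have cG : (\int[PM]_z (a n z.1 * H z)%:E)%E @[n --> \oo] --> (gfun t - gfun s)%:E.
  have cS : (\int[L]_y (bumpr n.+1%:R t y * gfun y) - \int[L]_y (bumpl n.+1%:R s y * gfun y))%:E
      @[n --> \oo] --> (gfun t - gfun s)%:E.
    by apply: cvg_EFin; [exact: nearW|exact: cvgB].
  apply: cvg_trans cS; apply: near_eq_cvg.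
  near=> n; have := E0 n.
  have -> : (\int[PM]_z (derive1 (a n) z.1 * P (Q z + c * z.1))%:E)%E =
    (\int[L]_y (bumpl n.+1%:R s y * gfun y) - \int[L]_y (bumpr n.+1%:R t y * gfun y))%:E.
    by near: n.
  exact: adde_eq0_opp.
exact: (cvg_unique _ cI cG).
Unshelve. all: by end_near. Qed.

End Evolution.

(** * One-sided estimates *)

Section Primitive.
Context {R : realType}.
Local Notation T := (measurableTypeR R).
Local Notation L := (@lebesgue_measure R).

Definition prim (f : R -> R) (x : R) : R := \int[L]_(y in `]-oo, x]) f y.

Definition subunit (K : R) (f : R -> R) :=
  measurable_fun setT f /\ forall x, `|f x| <= \1_(`[- K, K]%classic) x.

Variable K : R.
Hypothesis K0 : 0 < K.

Let mI : measurable (`[- K, K]%classic : set T).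
Proof. exact: measurable_itv. Qed.

Lemma L_itvK : L `[- K, K]%classic = (2 * K)%:E.
Proof.
rewrite lebesgue_measure_itv/= lte_fin ifT; last by rewrite (lt_trans _ K0)// oppr_lt0.
by rewrite -EFinD; congr (_%:E); ring.
Qed.

Lemma int_indicK : (\int[L]_x (\1_(`[- K, K]%classic) x)%:E = (2 * K)%:E)%E.
Proof. by rewrite -L_itvK integral_indic ?setIT. Qed.

Lemma indicK_integrable : L.-integrable setT (fun x => (\1_(`[- K, K]%classic) x)%:E).
Proof.
apply/integrableP; split; first by apply/measurable_EFinP; exact: measurable_indic.
under eq_integral do rewrite gee0_abs ?lee_fin//.
by rewrite int_indicK ltry.
Qed.

Lemma subunit_integrable f : subunit K f -> L.-integrable setT (EFin \o f).
Proof.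
move=> [mf fK]; apply: le_integrable indicK_integrable => //; first exact/measurable_EFinP.
by move=> x _ /=; rewrite lee_fin (le_trans (fK x))// ler_norm.
Qed.

Lemma subunit_integrableS f (i : interval R) : subunit K f ->
  L.-integrable [set` i] (EFin \o f).
Proof.
move=> sf; apply: integrableS (subunit_integrable sf) => //; exact: measurable_itv.
Qed.

Lemma int_subunit_le f (i : interval R) : subunit K f ->
  `|\int[L]_(x in [set` i]) f x| <= \int[L]_x `|f x|.
Proof.
move=> sf; have [mf _] := sf.
have fi := subunit_integrable sf.
have mi : measurable ([set` i] : set T) by exact: measurable_itv.
apply: (le_trans (le_normr_Rintegral mi (subunit_integrableS i sf))).
have fn : L.-integrable setT (EFin \o (fun x => `|f x|)) by exact: integrable_norm.
have fni : L.-integrable [set` i] (EFin \o (fun x => `|f x|)).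
  by apply: integrableS fn.
apply: fine_le.
- exact: integrable_fin_num.
- exact: integrable_fin_num.
- apply: ge0_subset_integral => //.
    by apply/measurable_EFinP; apply: measurableT_comp.
Qed.

Lemma int_norm_subunit f : subunit K f -> \int[L]_x `|f x| <= 2 * K.
Proof.
move=> sf; have [mf fK] := sf.
have -> : 2 * K = \int[L]_x \1_(`[- K, K]%classic) x.
  by rewrite /Rintegral int_indicK.
apply: le_Rintegral => //.
- exact: integrable_norm (subunit_integrable sf).
- exact: indicK_integrable.
Qed.

(** The interval is closed on the left and open on the right because [a <= x] and [x < b] are what
    the Galois connection translates into conditions on distribution functions. *)
Lemma prim_sub f (a b : R) : subunit K f -> a <= b ->
  prim f b - prim f a = \int[L]_(x in `[a, b[) f x.
Proof.
move=> sf ab; rewrite /prim Rintegral_itvB//.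
- rewrite Rintegral_itv_obnd_cbnd; last exact: subunit_integrableS.
  by rewrite Rintegral_itv_bndo_bndc; last exact: subunit_integrableS.
- exact: subunit_integrableS.
Qed.

Lemma prim_le f x : subunit K f -> `|prim f x| <= 2 * K.
Proof. by move=> sf; apply: le_trans (int_subunit_le _ sf) (int_norm_subunit sf). Qed.

Lemma is_derive_prim f (x : R) : subunit K f -> continuous f ->
  is_derive x (1 : R) (prim f) (f x).
Proof.
move=> sf cf; have xu : x < x + 1 by rewrite ltrDl.
have [|d e] := @continuous_FTC1 R f -oo%O x (x + 1) xu (subunit_integrableS _ sf) _ (cf x).
  by rewrite ltNyr.
by split; [exact: d|rewrite -e derive1E].
Qed.

Lemma smooth_prim f : subunit K f -> smooth f -> smooth (prim f).
Proof.
move=> sf smf [|n].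
  move=> x; apply: differentiable_continuous; apply/derivable1_diffP.
  by have [] := is_derive_prim x sf (smooth_continuous smf).
apply: CnS_is_derive (smf n) => x.
exact: (is_derive_prim x sf (smooth_continuous smf)).
Qed.

Lemma derive1_prim f : subunit K f -> smooth f -> derive1 (prim f) = f.
Proof.
move=> sf smf; apply/funext => x; apply: is_derive_derive1.
exact: (is_derive_prim x sf (smooth_continuous smf)).
Qed.

Lemma prim_diff_le f g x : subunit K f -> subunit K g ->
  `|prim f x - prim g x| <= \int[L]_y `|f y - g y|.
Proof.
move=> sf sg; have [mf fK] := sf; have [mg gK] := sg.
have fi := subunit_integrable sf; have gi := subunit_integrable sg.
have mi : measurable (`]-oo, x]%classic : set T) by exact: measurable_itv.
have fgi : L.-integrable setT (EFin \o (fun y => f y - g y)).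
  have := integrableB measurableT fi gi; apply: eq_integrable => //.
rewrite /prim -(RintegralB mi (subunit_integrableS _ sf) (subunit_integrableS _ sg)).
have fgi' : L.-integrable `]-oo, x] (EFin \o (fun y => f y - g y)).
  by apply: integrableS fgi.
apply: (le_trans (le_normr_Rintegral mi fgi')).
have fn : L.-integrable setT (EFin \o (fun x => `|f x - g x|)) by exact: integrable_norm fgi.
apply: fine_le.
- by apply: integrable_fin_num => //; apply: integrableS fn.
- exact: integrable_fin_num.
- apply: ge0_subset_integral => //.
    by apply/measurable_EFinP; apply: measurableT_comp => //; exact: measurable_funB.
Qed.

(** The heart of one-dimensional Kantorovich duality: for monotone [A] and [B],
    the positive part of [prim w (A p) - prim w (B p)] is the increment of one
    function of a single variable, the primitive of [w] restricted to the set
    where the distribution functions satisfy [FA < FB]. *)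
Lemma prim_duality (w : R -> R) (FA FB : R -> R) (p a b : R) :
  subunit K w -> (forall x, 0 <= w x) ->
  measurable [set x : T | FA x < FB x] ->
  (forall x, (a <= x) = (p <= FA x)) -> (forall x, (b <= x) = (p <= FB x)) ->
  Num.max 0 (prim w a - prim w b) =
  prim (fun x => w x * \1_[set x | FA x < FB x] x) a
   - prim (fun x => w x * \1_[set x | FA x < FB x] x) b.
Proof.
move=> sw w0 mG HA HB; set G := [set x | FA x < FB x].
have [mw wK] := sw.
have sG : subunit K (fun x => w x * \1_G x).
  split; first by apply: measurable_funM => //; exact: measurable_indic.
  move=> x; rewrite normrM (le_trans _ (wK x))// ler_piMr//.
  by rewrite indicE; case: (_ \in _); rewrite ?normr1 ?normr0.
have ge0i (i : interval R) : 0 <= \int[L]_(x in [set` i]) w x.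
  by apply: Rintegral_ge0 => x _.
have [ba|/ltW ab] := leP b a.
  rewrite !prim_sub// max_r//; apply: eq_Rintegral => x /set_mem /=.
  rewrite in_itv/= HB => /andP[pb xa].
  have xG : G x by rewrite /G/= (lt_le_trans _ pb)// ltNge -HA -ltNge.
  by rewrite indicE mem_set ?mulr1.
have -> : prim w a - prim w b = - \int[L]_(x in `[a, b[) w x by rewrite -prim_sub// opprB.
have -> : Num.max 0 (- \int[L]_(x in `[a, b[) w x) = 0 by apply/max_idPl; rewrite oppr_le0.
apply/esym/eqP; rewrite -oppr_eq0 opprB prim_sub//; apply/eqP.
rewrite (_ : \int[L]_(x in `[a, b[) _ = \int[L]_(x in `[a, b[) 0).
  by rewrite /Rintegral integral0.
apply: eq_Rintegral => x /set_mem /=.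
rewrite in_itv/= HA => /andP[pa xb].
have xG : ~ G x by rewrite /G/= => lt; move: xb; rewrite ltNge HB (le_trans pa)// ltW.
by rewrite indicE memNset ?mulr0.
Qed.

End Primitive.

(** * Positive parts of increments bounded by the flux *)

Section OneSided.
Context {R : realType}.
Local Notation T := (measurableTypeR R).
Local Notation L := (@lebesgue_measure R).
Local Notation PM := (@lebesgue_measure R \x U01)%E.

Lemma U01_le01 (f g : R -> R) : (U01 : {measure set T -> \bar R}).-integrable setT (EFin \o f) ->
  (U01 : {measure set T -> \bar R}).-integrable setT (EFin \o g) ->
  (forall p, 0 < p < 1 -> f p <= g p) -> \int[U01]_p f p <= \int[U01]_p g p.
Proof.
move=> fi gi fg; rewrite -subr_ge0 -(RintegralB measurableT gi fi).
have /integrableP[mf _] := fi; have /integrableP[mg _] := gi.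
have mh : measurable_fun (setT : set T) (fun p => g p - f p).
  by apply: measurable_funB; exact/measurable_EFinP.
have -> : \int[U01]_p (g p - f p) = \int[U01]_p (Num.max 0 (g p - f p)).
  rewrite /Rintegral; congr fine; apply: ae_eq_integral => //.
  - exact/measurable_EFinP.
  - by apply/measurable_EFinP; exact: measurable_maxr.
  - by apply: ae_U01P => p p01 _; rewrite max_r// subr_ge0 fg.
by apply: Rintegral_ge0 => p _; rewrite le_max lexx.
Qed.

Variables (gamma : R -> P2 R) (v : R -> R -> R).
Hypothesis nc : narrowly_continuous `]0, +oo[ gamma.
Hypothesis lv : loc_velocity_field `]0, +oo[ gamma v.
Local Notation Q := (Qh gamma).
Local Notation V := (Vh gamma v).

Variables (e : bexp) (K c : R).
Hypothesis K0 : 0 < K.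

(** The cut-off makes the weight integrable, so that its primitive is bounded and [evolution]
    applies to it. *)
Definition weight (x : R) : R := beval e x * plateau 1 (- K) K x.

Lemma weight_ge0 x : 0 <= weight x.
Proof. by rewrite mulr_ge0 ?beval_ge0//; have /andP[] := plateau01 1 (- K) K x. Qed.

Lemma smooth_weight : smooth weight.
Proof. by move=> n; apply: CnM; [exact: smooth_beval|exact: smooth_plateau]. Qed.

Lemma measurable_weight : measurable_fun setT weight.
Proof. by apply: continuous_measurable_fun; exact: (smooth_continuous smooth_weight). Qed.

Lemma weight_le x : weight x <= \1_(`[- K, K]%classic) x.
Proof.
have /andP[b0 b1] := beval01 e x; have /andP[p0 p1] := plateau01 1 (- K) K x.
rewrite indicE; have [h|h] := boolP (x \in _); first by rewrite mulr_ile1.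
rewrite /weight plateau_out ?mulr0//.
rewrite -[_ || _]negbK negb_or -!ltNge; apply/negP => /andP[h1 h2]; move/negP: h; apply.
by apply/mem_set; rewrite /= in_itv/= !ltW.
Qed.

Lemma subunit_weightM (f : R -> R) : measurable_fun setT f -> (forall x, 0 <= f x <= 1) ->
  subunit K (fun x => weight x * f x).
Proof.
move=> mf f01; split; first by apply: measurable_funM => //; exact: measurable_weight.
move=> x; have /andP[f0 f1] := f01 x.
have wf : 0 <= weight x * f x by exact: mulr_ge0 (weight_ge0 x) f0.
rewrite (ger0_norm wf).
apply: (le_trans _ (weight_le x)); exact: ler_piMr (weight_ge0 x) f1.
Qed.

Lemma subunit_weight : subunit K weight.
Proof.
have -> : weight = (fun x => weight x * 1) by apply/funext => x; rewrite mulr1.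
by apply: (@subunit_weightM (cst 1)) => // x; rewrite ler01 lexx.
Qed.

Lemma smooth_weight_beval e' : smooth (fun x => weight x * beval e' x).
Proof. by move=> n; apply: CnM; [exact: smooth_weight|exact: smooth_beval]. Qed.

Lemma subunit_weight_beval e' : subunit K (fun x => weight x * beval e' x).
Proof. by apply: subunit_weightM; [exact: measurable_beval|move=> x; exact: beval01]. Qed.

Let Wp e' := prim (fun x => weight x * beval e' x).

Let W := prim weight.

Lemma measurable_Q_slice (r : R) : measurable_fun (setT : set T) (fun p => Q (r, p)).
Proof. apply: (measurableT_comp (measurable_Q nc)); exact: pair1_measurable. Qed.

Lemma measurable_prim (f : R -> R) : subunit K f -> continuous f -> measurable_fun setT (prim f).
Proof.
move=> sf cf; apply: continuous_measurable_fun => x.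
apply: differentiable_continuous; apply/derivable1_diffP.
by have [] := is_derive_prim K0 x sf cf.
Qed.

Let iprim (f : R -> R) (r d : R) : subunit K f -> continuous f ->
  (U01 : {measure set T -> \bar R}).-integrable setT (EFin \o (fun p => prim f (Q (r, p) + d))).
Proof.
move=> sf cf; apply: (@U01_bounded_integrable _ _ (2 * K)).
  by apply: (measurableT_comp (measurable_prim sf cf)); exact: (measurable_funD (measurable_Q_slice _) (measurable_cst _)).
by move=> x; exact: prim_le.
Qed.

Let cW : continuous weight.
Proof. exact: smooth_continuous smooth_weight. Qed.

Let cWe e' : continuous (fun x => weight x * beval e' x).
Proof. exact: smooth_continuous (smooth_weight_beval e'). Qed.

Let indicI (E : set R) (x : R) : 0 <= (\1_E x : R) <= 1.
Proof. by rewrite indicE; case: (_ \in _); rewrite ?ler01 lexx. Qed.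

(** [prim_duality] produces the primitive of the weight times the indicator of [G], to which
    [evolution] does not apply. Replacing the indicator by a smooth [beval e'] costs [eps] at each
    of the two times. The times are not ordered, which serves both signs in [one_sided]. *)
Lemma one_sided_approx (t1 t2 eps : R) : 0 < t1 -> 0 < t2 -> 0 < eps ->
  exists e', \int[U01]_p Num.max 0 (W (Q (t1, p) + c * t1) - W (Q (t2, p) + c * t2))
   <= gfun gamma (Wp e') c t1 - gfun gamma (Wp e') c t2 + 2 * eps.
Proof.
move=> t10 t20 eps0.
(* The distribution functions of the shifted quantiles [Q_t + c t]. *)
pose FA x := cdf2 (gamma t1) (x - c * t1).
pose FB x := cdf2 (gamma t2) (x - c * t2).
have mF t : measurable_fun (setT : set T) (fun x : R => cdf2 (gamma t) (x - c * t)).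
  apply: nondecreasing_measurable => // x y xy; apply: cdf2_nd.
  exact: lerB.
pose G := [set x : T | FA x < FB x].
have mG : measurable G.
  rewrite -[X in measurable X]setTI; apply: measurable_fun_ltr => //; exact: mF.
have [e' He'] := @beval_approx _ _ _ L id weight (@measurable_id _ T setT) weight_ge0
  (subunit_integrable K0 subunit_weight) G eps mG eps0.
exists e'.
have sG : subunit K (fun x => weight x * \1_G x).
  by apply: subunit_weightM => //; exact: measurable_indic.
have delta : \int[L]_y `|weight y * beval e' y - weight y * \1_G y| <= eps.
  rewrite /Rintegral -lee_fin fineK; last first.
    have i0 : L.-integrable setT (EFin \o (fun y => weight y * beval e' y - weight y * \1_G y)).
      have := integrableB measurableT (subunit_integrable K0 (subunit_weight_beval e'))
        (subunit_integrable K0 sG); exact: eq_integrable.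
    have i1 : L.-integrable setT
      (EFin \o (fun y => `|weight y * beval e' y - weight y * \1_G y|)) by exact: integrable_norm i0.
    exact: integrable_fin_num i1.
  apply: le_trans (ltW He'); rewrite le_eqVlt; apply/orP; left; apply/eqP.
  by apply: eq_integral => y _ /=; rewrite -mulrBr normrM (ger0_norm (weight_ge0 y)).
have iW := iprim t1 (c * t1) subunit_weight cW.
have iW2 := iprim t2 (c * t2) subunit_weight cW.
have i1 := iprim t1 (c * t1) (subunit_weight_beval e') (@cWe e').
have i2 := iprim t2 (c * t2) (subunit_weight_beval e') (@cWe e').
have i12 := integrableB measurableT i1 i2.
rewrite /gfun -(RintegralB measurableT i1 i2) -[2 * eps]U01_cst.
have ic : (U01 : {measure set T -> \bar R}).-integrable setT (EFin \o (fun=> 2 * eps)).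
  by apply: (@U01_bounded_integrable _ _ `|2 * eps|) => //; exact: measurable_cst.
rewrite -(RintegralD measurableT i12 ic).
apply: U01_le01.
- apply: (@U01_bounded_integrable _ _ (2 * K + 2 * K)).
    apply: measurable_maxr => //; apply: measurable_funB.
    + by apply: (measurableT_comp (measurable_prim subunit_weight cW)); exact: (measurable_funD (measurable_Q_slice _) (measurable_cst _)).
    + by apply: (measurableT_comp (measurable_prim subunit_weight cW)); exact: (measurable_funD (measurable_Q_slice _) (measurable_cst _)).
  move=> p; have bd : `|W (Q (t1, p) + c * t1) - W (Q (t2, p) + c * t2)| <= 2 * K + 2 * K.
    by rewrite (le_trans (ler_normB _ _))// lerD// prim_le//; exact: subunit_weight.
  rewrite ger0_norm ?le_max ?lexx// ge_max (le_trans _ bd) ?normr_ge0//=.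
  exact: le_trans (ler_norm _) bd.
- exact: (integrableD measurableT i12 ic).
move=> p p01.
have Q1 : Q (t1, p) = quantile (gamma t1) p by rewrite /Qh /dom/= t10 p01.
have Q2 : Q (t2, p) = quantile (gamma t2) p by rewrite /Qh /dom/= t20 p01.
have H1 x : (Q (t1, p) + c * t1 <= x) = (p <= FA x).
  by rewrite Q1 -lerBrDr quantile_le.
have H2 x : (Q (t2, p) + c * t2 <= x) = (p <= FB x).
  by rewrite Q2 -lerBrDr quantile_le.
rewrite (prim_duality K0 subunit_weight weight_ge0 mG H1 H2).
have D1 := le_trans (prim_diff_le K0 (Q (t1, p) + c * t1) (subunit_weight_beval e') sG) delta.
have D2 := le_trans (prim_diff_le K0 (Q (t2, p) + c * t2) (subunit_weight_beval e') sG) delta.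
move: D1 D2; rewrite !ler_norml => /andP[D1 _] /andP[_ D2].
rewrite /= /Wp -/G; lra.
Qed.

(** [b] selects the positive or the negative part of the shifted velocity. *)
Definition flux (b : bool) (z : T * T) : R :=
  Num.max 0 ((-1) ^+ b * (c + V z)) * weight (Q z + c * z.1).

Lemma flux_ge0 (b : bool) z : 0 <= flux b z.
Proof. by rewrite mulr_ge0 ?weight_ge0// le_max lexx. Qed.

Lemma measurable_shift : measurable_fun (setT : set (T * T)) (fun z => Q z + c * z.1).
Proof.
by apply: measurable_funD; [exact: measurable_Q nc|apply: measurable_funM; [|exact: measurable_fst]].
Qed.

Lemma measurable_flux (b : bool) : measurable_fun setT (flux b).
Proof.
apply: measurable_funM; last exact: (measurableT_comp measurable_weight measurable_shift).
apply: measurable_maxr => //; apply: measurable_funM => //.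
by apply: measurable_funD => //; exact: measurable_V lv.
Qed.

Lemma weight_le1 x : weight x <= 1.
Proof. by rewrite (le_trans (weight_le x))// indicE; case: (_ \in _). Qed.

Lemma flux_le (b : bool) z : flux b z <= `|c| + `|V z|.
Proof.
rewrite (@le_trans _ _ (Num.max 0 ((-1) ^+ b * (c + V z))))//.
  by rewrite ler_piMr ?weight_le1// le_max lexx.
rewrite ge_max addr_ge0//= (le_trans (ler_norm _))// normrM normrX normrN1 expr1n mul1r.
exact: ler_normD.
Qed.

Lemma flux_integrable (b : bool) (s t : R) : 0 < s ->
  PM.-integrable setT (EFin \o (fun z : T * T => \1_(`]s, t[%classic) z.1 * flux b z)).
Proof.
move=> s0; apply: (@dom_integrable _ _ _ nc lv _ s t `|c| 1 s0).
  apply: measurable_funM; last exact: measurable_flux.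
  by apply: (@measurable_comp_fst _ (\1_(`]s, t[%classic))); exact: measurable_indic.
move=> z; rewrite mul1r normrM; apply: ler_pM => //.
  rewrite ger0_norm// !indicE ler_nat; have [h|//] := boolP (z.1 \in `]s, t[%classic).
  move/set_mem: h; rewrite /= in_itv/= => /andP[h1 h2].
  by rewrite mem_set// /= in_itv/= !ltW.
by rewrite ger0_norm ?flux_ge0// flux_le.
Qed.

Let W_evolution e' (s t : R) : 0 < s -> s < t ->
  gfun gamma (Wp e') c t - gfun gamma (Wp e') c s =
  \int[PM]_z (\1_(`]s, t[%classic) z.1 * ((c + V z) * (weight (Q z + c * z.1) * beval e' (Q z + c * z.1)))).
Proof.
move=> s0 st.
have sf := subunit_weight_beval e'; have smf := @smooth_weight_beval e'.
have PB x : `|Wp e' x| <= 2 * K by exact: (prim_le K0).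
have d1 : derive1 (Wp e') = (fun x => weight x * beval e' x) by exact: (derive1_prim K0 sf smf).
have PB' x : `|derive1 (Wp e') x| <= 1.
  by rewrite d1 (le_trans (sf.2 x))// indicE; case: (_ \in _).
have := evolution nc lv c (smooth_prim K0 sf smf) PB PB' s0 st.
by rewrite d1 /Rintegral => ->.
Qed.

(** After [W_evolution] the factor [beval e'] lies between 0 and 1, so passing to the positive part
    of the signed velocity bounds the integrand by the flux, uniformly in [e']; then [eps] tends to
    0. *)
Lemma one_sided (b : bool) (s t : R) : 0 < s -> s < t ->
  \int[U01]_p Num.max 0 ((-1) ^+ b * (W (Q (t, p) + c * t) - W (Q (s, p) + c * s)))
  <= \int[PM]_z (\1_(`]s, t[%classic) z.1 * flux b z).
Proof.
move=> s0 st; have t0 := lt_trans s0 st.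
(* The sign only decides which of [s] and [t] comes first. *)
have [t1 [t2 [t10 t20 E1 E2]]] : exists t1 t2, [/\ 0 < t1, 0 < t2,
    (forall g : R -> R, (-1) ^+ b * (g t - g s) = g t1 - g t2) &
    (forall g : R -> R, g t1 - g t2 = (-1) ^+ b * (g t - g s))].
  by case: (b); [exists s, t|exists t, s]; split => // g; rewrite ?expr1 ?expr0 ?mul1r ?mulN1r ?opprB.
apply/ler_addgt0Pr => eps eps0; have e20 : 0 < eps / 2 by rewrite divr_gt0.
have [e' He'] := one_sided_approx t10 t20 e20.
have -> : \int[U01]_p Num.max 0 ((-1) ^+ b * (W (Q (t, p) + c * t) - W (Q (s, p) + c * s)))
   = \int[U01]_p Num.max 0 (W (Q (t1, p) + c * t1) - W (Q (t2, p) + c * t2)).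
  by apply: eq_Rintegral => p _; congr (Num.max 0 _); exact: (E1 (fun r => W (Q (r, p) + c * r))).
apply: (le_trans He'); rewrite mulrCA divff// mulr1 lerD2r.
rewrite (E2 (gfun gamma (Wp e') c)) W_evolution//.
have mH : measurable_fun (setT : set (T * T)) (fun z : T * T => \1_(`]s, t[%classic) z.1 *
    ((c + V z) * (weight (Q z + c * z.1) * beval e' (Q z + c * z.1)))).
  apply: measurable_funM.
    by apply: (@measurable_comp_fst _ (\1_(`]s, t[%classic))); exact: measurable_indic.
  apply: measurable_funM; first by apply: measurable_funD => //; exact: measurable_V lv.
  apply: measurable_funM; first exact: (measurableT_comp measurable_weight measurable_shift).
  exact: (measurableT_comp (measurable_beval e') measurable_shift).
have wb z : 0 <= weight (Q z + c * z.1) * beval e' (Q z + c * z.1) <= weight (Q z + c * z.1).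
  by rewrite mulr_ge0 ?weight_ge0 ?beval_ge0//= ler_piMr ?weight_ge0 ?beval_le1.
have iH : PM.-integrable setT (EFin \o (fun z : T * T => \1_(`]s, t[%classic) z.1 *
    ((c + V z) * (weight (Q z + c * z.1) * beval e' (Q z + c * z.1))))).
  apply: (@dom_integrable _ _ _ nc lv _ s t `|c| 1 s0) => // z.
  rewrite mul1r normrM; apply: ler_pM => //.
    rewrite ger0_norm// !indicE ler_nat; have [h|//] := boolP (z.1 \in `]s, t[%classic).
    move/set_mem: h; rewrite /= in_itv/= => /andP[h1 h2].
    by rewrite mem_set// /= in_itv/= !ltW.
  have /andP[w0 w1] := wb z.
  rewrite normrM (ger0_norm w0) (le_trans _ (ler_normD _ _))// ler_piMr//.
  exact: le_trans w1 (weight_le1 _).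
rewrite -RintegralZl//.
have fi := flux_integrable b t s0.
apply: le_Rintegral => //.
  by have := integrableZl measurableT ((-1) ^+ b) iH; apply: eq_integrable => // z _ /=; rewrite EFinM.
move=> z _; rewrite mulrCA ler_wpM2l// [leLHS]mulrA /flux.
have /andP[w0 w1] := wb z.
apply: (@le_trans _ _ (Num.max 0 ((-1) ^+ b * (c + V z)) *
    (weight (Q z + c * z.1) * beval e' (Q z + c * z.1)))).
  by apply: ler_wpM2r => //; rewrite le_max lexx orbT.
by apply: ler_wpM2l => //; rewrite le_max lexx.
Qed.

End OneSided.

(** * Differentiation in time *)

Lemma derive1_seq (R : realType) (f : R -> R) (t d : R) : is_derive t (1 : R) f d ->
  n.+1%:R * (f (t + n.+1%:R^-1) - f t) @[n --> \oo] --> d.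
Proof.
move=> D; have [df <-] := D.
have /cvgr_dnbhsP H := df.
have [Hu Hc] : (forall n : nat, (n.+1%:R^-1 : R) != 0) /\ (n.+1%:R^-1 : R) @[n --> \oo] --> 0.
  by split; [move=> n; rewrite invr_eq0 pnatr_eq0|exact: cvg_harmonic].
have := H _ (conj Hu Hc); apply: cvg_trans; apply: near_eq_cvg; apply: nearW => n /=.
by rewrite invrK [X in f (X + t)](mulr1 (n.+1%:R^-1 : R)) [t + _]addrC.
Qed.

Section ProductDifferentiation.
Context {R : realType}.
Local Notation T := (measurableTypeR R).
Local Notation L := (@lebesgue_measure R).
Local Notation PM := (@lebesgue_measure R \x U01)%E.

Variable phi : T * T -> R.
Hypothesis phii : PM.-integrable setT (EFin \o phi).

Definition marginal (t : R) : R := \int[U01]_p phi (t, p).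

Lemma marginal_integrable : L.-integrable setT (EFin \o marginal).
Proof.
have [mF bF] := integrableP _ _ _ (integrable_fubini_F phii).
have mm : measurable_fun (setT : set T) marginal by apply: (measurableT_comp (fine_measurable measurableT) mF).
apply: le_integrable (integrable_fubini_F phii) => //; first exact/measurable_EFinP.
move=> t _; rewrite /= /marginal /Rintegral /fubini_F.
by case: (\int[U01]_p _)%E => [r| |] /=; rewrite ?normr0 ?lexx ?leey.
Qed.

Lemma ae_marginal_fin : {ae L, forall t, (\int[U01]_p (phi (t, p))%:E = (marginal t)%:E)%E}.
Proof.
apply: filterS (ae_integrable1 phii) => t it; rewrite /marginal /Rintegral fineK//.
exact: integrable_fin_num it.
Qed.

(** By the Fubini theorem the strip integral is an increment of a primitive of [marginal], to which
    Lebesgue differentiation applies. *)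
Lemma int_strip (a b : R) : a < b ->
  \int[PM]_z (\1_(`]a, b[%classic) z.1 * phi z) =
  \int[L]_(t in `]-oo, b]) marginal t - \int[L]_(t in `]-oo, a]) marginal t.
Proof.
move=> ab; set I := `]a, b[%classic.
have mI : measurable (I : set T) by exact: measurable_itv.
have [/measurable_EFinP mphi _] := integrableP _ _ _ phii.
have i1 : PM.-integrable setT (EFin \o (fun z : T * T => \1_I z.1 * phi z)).
  apply: le_integrable phii => //.
    apply/measurable_EFinP/measurable_funM => //; apply: (@measurable_comp_fst _ (\1_I)); exact: measurable_indic.
  move=> z _; rewrite /= lee_fin normrM ler_piMl//.
  by rewrite indicE; case: (_ \in _); rewrite ?normr1 ?normr0.
have iIm (i : interval R) : L.-integrable [set` i] (EFin \o marginal).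
  apply: integrableS marginal_integrable => //; exact: measurable_itv.
rewrite Rintegral_itvB ?bnd_simp ?ltW// -Rintegral_itv_bndo_bndc//.
rewrite /Rintegral -(int_prod12 i1) [in RHS]integral_mkcond; congr fine.
have [mF _] := integrableP _ _ _ (integrable_fubini_F i1).
apply: ae_eq_integral => //.
  by rewrite -(measurable_restrictT _ mI); have [] := integrableP _ _ _ (iIm `]a, b[).
apply: filterS ae_marginal_fin => t Ht _; rewrite patchE -/I.
case: (boolP (t \in I)) => tI.
  by rewrite -Ht; apply: eq_integral => p _; rewrite /= indicE tI mul1r.
by apply: integral0_eq => p _; rewrite /= indicE (negbTE tI) mul0r.
Qed.

Lemma ae_derive_marginal : {ae L, forall t,
  (n.+1%:R * \int[PM]_z (\1_(`]t, t + n.+1%:R^-1[%classic) z.1 * phi z)) @[n --> \oo] --> marginal t}.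
Proof.
have iI : forall y, L.-integrable `]-oo, y] (EFin \o marginal).
  move=> y; apply: integrableS marginal_integrable => //; exact: measurable_itv.
have lI : locally_integrable [set: R] marginal.
  by apply: open_integrable_locally; [exact: openT|exact: marginal_integrable].
have := FTC1Ny iI lI; apply: filterS; first exact: (ae_filter_ringOfSetsType L).
move=> t [df ft].
set F := (fun x => _) in df ft.
have D : is_derive t (1 : R) F (marginal t) by apply: DeriveDef => //; rewrite -derive1E.
have := derive1_seq D; apply: cvg_trans; apply: near_eq_cvg; apply: nearW => n /=.
by rewrite int_strip// ltrDl invr_gt0.
Qed.

End ProductDifferentiation.

Lemma fatou_le d (S : measurableType d) (R : realType) (mu : {measure set S -> \bar R})
    (fs : nat -> S -> R) (f : S -> R) (a : nat -> R) (l : R) :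
  (forall n, measurable_fun setT (fs n)) -> (forall n x, 0 <= fs n x) ->
  measurable_fun setT f -> {ae mu, forall x, fs n x @[n --> \oo] --> f x} ->
  (forall n, (\int[mu]_x (fs n x)%:E <= (a n)%:E)%E) -> a @ \oo --> l ->
  (\int[mu]_x (f x)%:E <= l%:E)%E.
Proof.
move=> mfs fs0 mf cf ia al.
have mE n : measurable_fun setT (EFin \o fs n) by exact/measurable_EFinP.
have := fatou mu measurableT mE (fun n x _ => fs0 n x).
rewrite (_ : (\int[mu]_x limn_einf _ = \int[mu]_x (f x)%:E)%E); last first.
  apply: ae_eq_integral => //.
  - rewrite /limn_einf; apply: measurableT_comp => //.
    by apply: measurable_fun_limn_esup => n; exact: measurableT_comp.
  - exact/measurable_EFinP.
  apply: filterS cf => x cx _.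
  by apply: (cvg_limn_einf_sup _).1; apply/cvg_EFin => //; exact: nearW.
move=> /le_trans; apply; rewrite limn_einf_lim.
have aE : (EFin \o a) @ \oo --> l%:E by apply/cvg_EFin => //; exact: nearW.
rewrite -(cvg_lim _ aE)//; apply: lee_lim.
- exact: is_cvg_einfs.
- by apply/cvg_ex; exists l%:E.
- apply: nearW => n; apply: le_trans (ia n).
  by apply: ereal_inf_lbound; exists n => /=.
Qed.

(** * Comparison of the flux with the time derivative *)

Section Localization.
Context {R : realType}.
Local Notation T := (measurableTypeR R).
Local Notation L := (@lebesgue_measure R).
Local Notation PM := (@lebesgue_measure R \x U01)%E.
Variables (gamma : R -> P2 R) (v : R -> R -> R).
Hypothesis nc : narrowly_continuous `]0, +oo[ gamma.
Hypothesis lv : loc_velocity_field `]0, +oo[ gamma v.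
Local Notation Q := (Qh gamma).
Local Notation V := (Vh gamma v).

Lemma flux_differentiation e (K c : R) (b : bool) : {ae L, forall t, 0 < t ->
  n.+1%:R * \int[PM]_z (\1_(`]t, t + n.+1%:R^-1[%classic) z.1 * flux gamma v e K c b z) @[n --> \oo]
   --> \int[U01]_p flux gamma v e K c b (t, p)}.
Proof.
(* [ae_derive_marginal] asks for global integrability, while the flux is controlled on bounded
   strips away from time 0. Around a given [t] one such strip contains []t, t + n.+1^-1[] for large
   [n]. *)
pose I (m : nat) : set R := `]m.+1%:R^-1, m.+1%:R[%classic.
have fi m : PM.-integrable setT (EFin \o (fun z : T * T => \1_(I m) z.1 * flux gamma v e K c b z)).
  by apply: (flux_integrable nc lv); rewrite invr_gt0.
apply: filterS (ae_forall_countable (fun m => ae_derive_marginal (fi m))) => t Ht t0.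
have [m [m1 m2]] : exists m : nat, m.+1%:R^-1 < t /\ t < m.+1%:R.
  near \oo => m; exists m; split; near: m.
    exact: (near_infty_natSinv_lt (PosNum t0)).
  by apply: filterS (nbhs_infty_gtr t) => k; move/lt_trans; apply; rewrite ltr_nat.
have tI : t \in I m by rewrite mem_set//= /I/= in_itv/= m1 m2.
have -> : \int[U01]_p flux gamma v e K c b (t, p) =
    marginal (fun z : T * T => \1_(I m) z.1 * flux gamma v e K c b z) t.
  by apply: eq_Rintegral => p _; rewrite /= indicE tI mul1r.
apply: cvg_trans (Ht m); apply: near_eq_cvg; near=> n; congr (_ * _).
apply: eq_Rintegral => z _; rewrite mulrA; congr (_ * _); rewrite !indicE -natrM.
congr (_%:R); case: (boolP (z.1 \in `]t, _[%classic)) => h; rewrite ?mul0n//.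
rewrite mem_set//; move/set_mem: h; rewrite /I/= !in_itv/= => /andP[h1 h2].
rewrite (lt_trans m1 h1) (lt_trans h2)// -ltrBrDl; near: n.
have d0 : 0 < m.+1%:R - t by rewrite subr_gt0.
exact: (near_infty_natSinv_lt (PosNum d0)).
Unshelve. all: by end_near. Qed.

Section Pointwise.
Variables (t : R) (h : R -> R).
Hypotheses (t0 : 0 < t) (qd : quantile_derivative gamma t h).
Variables (e : bexp) (K c : R) (b : bool).
Hypothesis K0 : 0 < K.
Hypothesis Dt : n.+1%:R * \int[PM]_z (\1_(`]t, t + n.+1%:R^-1[%classic) z.1 * flux gamma v e K c b z)
   @[n --> \oo] --> \int[U01]_p flux gamma v e K c b (t, p).

(** [one_sided] on []t, t + n.+1^-1[], multiplied by [n.+1]. On the right this converges by [Dt]; on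
    the left the chain rule gives the pointwise limit, and Fatou's lemma keeps the inequality. *)
Lemma flux_ge_derivative :
  (\int[U01]_p (weight e K (Q (t, p) + c * t) * Num.max 0 ((-1) ^+ b * (c + h p)))%:E <=
   (\int[U01]_p flux gamma v e K c b (t, p))%:E)%E.
Proof.
have [hL hd] := qd.
have [mh _] := (Lfun2P _ _).1 hL.
pose W := prim (weight e K).
have sw := subunit_weight e K; have cw := smooth_continuous (@smooth_weight R e K).
have mW : measurable_fun setT W by exact: (measurable_prim K0 sw cw).
pose tn n : R := t + n.+1%:R^-1.
have tn0 n : t < tn n by rewrite ltrDl invr_gt0.
have mWQ s d : measurable_fun (setT : set T) (fun p => W (Q (s, p) + d)).
  by apply: (measurableT_comp mW); exact: (measurable_funD (measurable_Q_slice nc _) (measurable_cst _)).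
pose D n p : R := Num.max 0 ((-1) ^+ b * (W (Q (tn n, p) + c * tn n) - W (Q (t, p) + c * t))).
have mD n : measurable_fun setT (D n).
  by apply: measurable_maxr => //; apply: measurable_funM => //; exact: (measurable_funB (mWQ _ _) (mWQ _ _)).
have D0 n p : 0 <= D n p by rewrite le_max lexx.
apply: (@fatou_le _ _ _ U01 (fun n p => n.+1%:R * D n p) _ _ _ _ _ _ _ _ Dt).
- by move=> n; exact: (measurable_funM (measurable_cst _) (mD n)).
- by move=> n p; rewrite mulr_ge0.
- apply: measurable_funM.
    apply: (measurableT_comp (@measurable_weight _ e K)).
    exact: (measurable_funD (measurable_Q_slice nc _) (measurable_cst _)).
  by apply: measurable_maxr => //; apply: measurable_funM => //; exact: (measurable_funD (measurable_cst _) mh).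
- have hd' : {ae U01, forall p, is_derive t (1 : R) (fun s => quantile (gamma s) p) (h p)}.
    by apply/ae_leb01.
  apply: filterS2 (ae_U01_itv) hd' => p p01 dp.
  have QE s : 0 < s -> Q (s, p) = quantile (gamma s) p by move=> s0; rewrite /Qh /dom/= s0 p01.
  pose g s := quantile (gamma s) p + c * s.
  have dg : is_derive t (1 : R) g (h p + c).
    have dl : is_derive t (1 : R) (fun s : R => c * s) c.
      by have := is_derive_affine c 0 t; rewrite (_ : (fun y => _) = *%R c)//; apply/funext => y; rewrite addr0.
    exact: is_deriveD dp dl.
  have dW : is_derive t (1 : R) (W \o g) (weight e K (g t) * (h p + c)).
    exact: is_derive1_comp (is_derive_prim K0 _ sw cw) dg.
  have cW := derive1_seq dW.
  have -> : weight e K (Q (t, p) + c * t) * Num.max 0 ((-1) ^+ b * (c + h p)) =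
      Num.max 0 ((-1) ^+ b * (weight e K (g t) * (h p + c))).
    rewrite QE// -/(g t) [c + _]addrC mulrCA.
    by rewrite (maxr_pMr _ _ (weight_ge0 e K (g t))) mulr0.
  have -> : (fun n : nat => n.+1%:R * D n p) =
     (fun n => Num.max 0 ((-1) ^+ b * (n.+1%:R * ((W \o g) (t + n.+1%:R^-1) - (W \o g) t)))).
    apply/funext => n; rewrite /D !QE// ?(lt_trans t0)//.
    by rewrite [in RHS]mulrCA maxr_pMr// mulr0.
  have cm : continuous (fun x : R => Num.max 0 ((-1) ^+ b * x)).
    by move=> x; apply: continuous_max; [exact: cvg_cst|exact: mulrl_continuous].
  exact: (cvg_comp _ _ cW (cm _)).
- move=> n.
  have iD : (U01 : {measure set T -> \bar R}).-integrable setT (EFin \o D n).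
    apply: (@U01_bounded_integrable _ _ (2 * K + 2 * K)) => // p.
    have bd : `|(-1) ^+ b * (W (Q (tn n, p) + c * tn n) - W (Q (t, p) + c * t))| <= 2 * K + 2 * K.
      rewrite normrM normrX normrN1 expr1n mul1r (le_trans (ler_normB _ _))// lerD//.
        exact: prim_le.
      exact: prim_le.
    rewrite ger0_norm// ge_max (le_trans _ bd)//=; exact: le_trans (ler_norm _) bd.
  under eq_integral do rewrite EFinM.
  rewrite (integralZl measurableT iD).
  have -> : (\int[U01]_p (EFin \o D n) p = (\int[U01]_p D n p)%:E)%E.
    by rewrite /Rintegral fineK//; exact: integrable_fin_num iD.
  by rewrite -EFinM lee_fin ler_wpM2l// (one_sided nc lv).
Qed.

End Pointwise.
End Localization.

(** * Identification of the velocity *)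

Section SignTransfer.
Context {R : realType}.
Local Notation T := (measurableTypeR R).

Let U : {measure set T -> \bar R} := U01.

Variables (g X Y : R -> R) (E : set R).
Hypotheses (mg : measurable_fun (setT : set T) g) (mE : measurable E).
Hypotheses (X0 : forall p, 0 <= X p) (Y0 : forall p, 0 <= Y p).
Hypotheses (Xi : U.-integrable setT (EFin \o X)) (Yi : U.-integrable setT (EFin \o Y)).
Hypothesis EY : forall p, E (g p) -> Y p = 0.
Hypothesis XY : forall e m, (\int[U]_p (weight e m.+1%:R (g p) * X p)%:E <=
  \int[U]_p (weight e m.+1%:R (g p) * Y p)%:E)%E.

Let mX : measurable_fun (setT : set T) X.
Proof. by have /integrableP[/measurable_EFinP] := Xi. Qed.

Let mY : measurable_fun (setT : set T) Y.
Proof. by have /integrableP[/measurable_EFinP] := Yi. Qed.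

Let pl m p := plateau 1 (- m.+1%:R) (m.+1%:R : R) (g p).

Let pl01 m p : 0 <= pl m p <= 1. Proof. exact: plateau01. Qed.

Let mpl m : measurable_fun (setT : set T) (pl m).
Proof.
apply: (measurableT_comp _ mg); apply: continuous_measurable_fun.
by apply: smooth_continuous; exact: smooth_plateau.
Qed.

Let mEg : measurable_fun (setT : set T) (fun p => \1_E (g p) : R).
Proof. by apply: measurableT_comp mg; exact: measurable_indic. Qed.

Let h0 m p : 0 <= pl m p * \1_E (g p) * X p.
Proof.
have /andP[h _] := pl01 m p; apply: mulr_ge0 (X0 p); apply: mulr_ge0 => //.
Qed.

(** [weight] approximates [1_E] cut off to a bounded interval, in L1 of the
    image under [g] of the measure with density [X + Y]. *)
Let strip m : (\int[U]_p (pl m p * \1_E (g p) * X p)%:E = 0)%E.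
Proof.
apply/eqP; rewrite eq_le; apply/andP; split; last first.
  by apply: integral_ge0 => p _; rewrite lee_fin h0.
apply/lee_addgt0Pr => eps eps0; rewrite add0e.
have e20 : 0 < eps / 2 by rewrite divr_gt0.
have w0 p : 0 <= X p + Y p by exact: addr_ge0.
have wi : U.-integrable setT (EFin \o (fun p => X p + Y p)).
  by apply: eq_integrable (integrableD measurableT Xi Yi).
have [e He] := @beval_approx R _ T U g _ mg w0 wi E _ mE e20.
pose d p := `|beval e (g p) - \1_E (g p)|.
have md : measurable_fun (setT : set T) d.
  apply: measurableT_comp => //; apply: measurable_funB => //.
  by apply: measurableT_comp mg; exact: measurable_beval.
have mw : measurable_fun (setT : set T) (fun p => weight e m.+1%:R (g p)).
  by apply: measurableT_comp mg; exact: measurable_weight.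
have d0 p : (0 <= ((X p + Y p) * d p)%:E)%E by rewrite lee_fin; exact: mulr_ge0 (w0 p) (normr_ge0 _).
have mdE : measurable_fun (setT : set T) (fun p => ((X p + Y p) * d p)%:E).
  by apply/measurable_EFinP; exact: (measurable_funM (measurable_funD mX mY) md).
have wX0 p : (0 <= (weight e m.+1%:R (g p) * X p)%:E)%E by rewrite lee_fin; exact: mulr_ge0 (weight_ge0 _ _ _) (X0 p).
have mwX : measurable_fun (setT : set T) (fun p => (weight e m.+1%:R (g p) * X p)%:E).
  by apply/measurable_EFinP; exact: (measurable_funM mw mX).
(* The weight at [g p] is [pl m p * beval e (g p)], so exchanging the indicator for [beval e] costs
   at most [d p * X p]. *)
apply: (@le_trans _ _ (\int[U]_p (weight e m.+1%:R (g p) * X p)%:E + \int[U]_p ((X p + Y p) * d p)%:E)%E).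
  rewrite -ge0_integralD//; apply: ge0_le_integral => //.
  - by move=> p _; rewrite lee_fin h0.
  - by apply/measurable_EFinP; exact: (measurable_funM (measurable_funM (mpl m) mEg) mX).
  - exact: emeasurable_funD.
  move=> p _; have /andP[p0 p1] := pl01 m p; rewrite -EFinD lee_fin.
  rewrite -lerBlDl /weight [_ * plateau _ _ _ _]mulrC -/(pl m p) -mulrBl -mulrBr.
  apply: (@le_trans _ _ (d p * X p)).
    apply: ler_wpM2r => //; apply: le_trans (ler_norm _) _.
    by rewrite normrM distrC ler_piMl// ger0_norm.
  by rewrite [leLHS]mulrC ler_wpM2r ?normr_ge0// lerDl.
rewrite (splitr eps) EFinD; apply: leeD; last exact: ltW He.
(* Where [g p] lies in [E], [Y] vanishes; elsewhere [beval e (g p)] is itself the approximation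
   error. So the integral with [Y] is small as well. *)
apply: (le_trans (XY e m)); apply: le_trans (ltW He); apply: ge0_le_integral => //.
- by move=> p _; rewrite lee_fin; exact: mulr_ge0 (weight_ge0 _ _ _) (Y0 p).
- by apply/measurable_EFinP; exact: (measurable_funM mw mY).
move=> p _; rewrite lee_fin.
have [pE|pE] := pselect (E (g p)); first by rewrite [Z in _ * Z <= _]EY// mulr0; exact: mulr_ge0 (w0 p) (normr_ge0 _).
have /andP[p0 p1] := pl01 m p; have b0 := beval_ge0 e (g p).
rewrite /weight -/(pl m p) indicE memNset// subr0 ger0_norm// mulrC.
apply: ler_pM => //; first exact: mulr_ge0.
  by rewrite lerDr.
by rewrite ler_piMr.
Qed.

(** Weights tending to the indicator of [E] make the side of [Y] vanish in [XY], hence also the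
    integral of [X] over the preimage of [E], first within the bounded ranges selected by [pl m]. *)
Lemma sign_transfer : {ae U, forall p, E (g p) -> X p = 0}.
Proof.
have H m : {ae U, forall p, pl m p * \1_E (g p) * X p = 0}.
  have mh : measurable_fun (setT : set T) (fun p => pl m p * \1_E (g p) * X p).
    exact: (measurable_funM (measurable_funM (mpl m) mEg) mX).
  have : (\int[U]_p `|(pl m p * \1_E (g p) * X p)%:E| = 0)%E.
    rewrite -(strip m); apply: eq_integral => p _.
    by rewrite gee0_abs// lee_fin h0.
  have mhE : measurable_fun (setT : set T) (EFin \o (fun p => pl m p * \1_E (g p) * X p)) by exact/measurable_EFinP.
  move/(ae_eq_integral_abs _ measurableT mhE).
  by apply: filterS => p /(_ I) /= [].
apply: filterS (ae_forall_countable H) => p Hp Ep.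
near \oo => m; have := Hp m; rewrite /pl plateau_in; last first.
- rewrite mul1r; have gm : `|g p| + 1 < m%:R by near: m; exact: nbhs_infty_gtr.
  have := ler_norm (g p); rewrite -natr1; lra.
- rewrite mul1r; have gm : `|g p| + 1 < m%:R by near: m; exact: nbhs_infty_gtr.
  have := ler_norm (- g p); rewrite normrN -natr1; lra.
by rewrite indicE mem_set// !mul1r.
Unshelve. all: by end_near. Qed.

End SignTransfer.

(** * The time derivative of the quantiles is the velocity *)

Section DerivativeVelocity.
Context {R : realType}.
Local Notation T := (measurableTypeR R).
Local Notation L := (@lebesgue_measure R).
Local Notation PM := (@lebesgue_measure R \x U01)%E.

Let U : {measure set T -> \bar R} := U01.

Lemma U01_sqr_integrable (f : R -> R) : measurable_fun (setT : set T) f ->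
  (\int[U]_p (f p ^+ 2)%:E < +oo)%E -> U.-integrable setT (EFin \o f).
Proof.
move=> mf f2; have fU : U setT \is a fin_num by exact: (fin_num_measure U01 setT measurableT).
apply/Lfun1_integrable; apply: (Lfun_subset12 fU); exact/Lfun2P.
Qed.

Lemma sign_integrable (f : R -> R) (c : R) (b : bool) : U.-integrable setT (EFin \o f) ->
  U.-integrable setT (EFin \o (fun p => Num.max 0 ((-1) ^+ b * (c + f p)))).
Proof.
move=> fi; have /integrableP[/measurable_EFinP mf _] := fi.
have ic : U.-integrable setT (EFin \o (fun p => `|c| + `|f p|)).
  have i1 : U.-integrable setT (EFin \o (fun=> `|c|)).
    by apply: (@U01_bounded_integrable _ _ `|c|) => [|x]; [exact: measurable_cst|rewrite normr_id].
  by apply: eq_integrable (integrableD measurableT i1 (integrable_norm fi)).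
apply: le_integrable ic => //.
  apply/measurable_EFinP; apply: measurable_maxr => //.
  exact: (measurable_funM (measurable_cst _) (measurable_funD (measurable_cst _) mf)).
move=> p _; rewrite /= lee_fin [leRHS]ger0_norm ?addr_ge0// ger0_norm ?le_max ?lexx//.
rewrite ge_max addr_ge0//= (le_trans (ler_norm _))// normrM normrX normrN1 expr1n mul1r.
exact: ler_normD.
Qed.

Variables (gamma : R -> P2 R) (v : R -> R -> R).
Hypothesis nc : narrowly_continuous `]0, +oo[ gamma.
Hypothesis lv : loc_velocity_field `]0, +oo[ gamma v.
Local Notation Q := (Qh gamma).
Local Notation V := (Vh gamma v).

Section Pointwise.
Variables (t : R) (h : R -> R).
Hypotheses (t0 : 0 < t) (qd : quantile_derivative gamma t h).
Hypothesis vL : v t \in Lfun (gamma t) 2%:E.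
Hypothesis Dt : forall (e : bexp) (m : nat) (c : rat) (b : bool),
  n.+1%:R * \int[PM]_z (\1_(`]t, t + n.+1%:R^-1[%classic) z.1 * flux gamma v e m.+1%:R (ratr c) b z)
   @[n --> \oo] --> \int[U01]_p flux gamma v e m.+1%:R (ratr c) b (t, p).

Let mv : measurable_fun (setT : set T) (v t).
Proof. exact: (measurable_v_slice (velocity_measurable lv) t0). Qed.

(** Unlike [V (t, p)], which is 0 outside the unit interval, this is a function of [Q (t, p)] for
    every [p], as [sign_transfer] demands. *)
Let vQ p := v t (Q (t, p)).

Let mvQ : measurable_fun (setT : set T) vQ.
Proof. exact: measurableT_comp mv (measurable_Q_slice nc t). Qed.

Let VE p : 0 < p < 1 -> V (t, p) = vQ p.
Proof. by move=> p01; rewrite /Vh /dom/= t0 p01. Qed.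

Let vQi : U.-integrable setT (EFin \o vQ).
Proof.
apply: U01_sqr_integrable => //; have [_ v2] := (Lfun2P _ _).1 vL.
have mv2 : measurable_fun setT (fun x => (v t x ^+ 2)%:E) by apply/measurable_EFinP; exact: measurable_funX.
by rewrite (Qh_slice nc t0 mv2) in v2.
Qed.

Let hi : U.-integrable setT (EFin \o h).
Proof. by have [hL _] := qd; have [mh h2] := (Lfun2P _ _).1 hL; exact: U01_sqr_integrable. Qed.

Let half (c : rat) (b : bool) : {ae U01, forall p,
  (-1) ^+ b * (ratr c + V (t, p)) <= 0 -> (-1) ^+ b * (ratr c + h p) <= 0}.
Proof.
pose g p : R := Q (t, p) + ratr c * t.
have mg : measurable_fun (setT : set T) g by exact: (measurable_funD (measurable_Q_slice nc t) (measurable_cst _)).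
pose X p : R := Num.max 0 ((-1) ^+ b * (ratr c + h p)).
pose Y p : R := Num.max 0 ((-1) ^+ b * (ratr c + vQ p)).
(* The weights act on the shifted quantile [g]; subtracting [ratr c * t] recovers the argument of
   the velocity. *)
pose E := [set x : T | (-1) ^+ b * (ratr c + v t (x - ratr c * t)) <= 0 :> R].
have mE : measurable E.
  apply: measurable_le; apply: (measurable_funM (measurable_cst _)).
  apply: (measurable_funD (measurable_cst _)); apply: (measurableT_comp mv).
  exact: (measurable_funD (@measurable_id _ T setT) (measurable_cst _)).
have X0 p : 0 <= X p by rewrite le_max lexx.
have Y0 p : 0 <= Y p by rewrite le_max lexx.
have EY p : E (g p) -> Y p = 0.
  by rewrite /E/= /g addrK => Yp; apply/max_idPl.
have Xi : U.-integrable setT (EFin \o X) by exact: sign_integrable.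
have Yi : U.-integrable setT (EFin \o Y) by exact: sign_integrable.
have XY e m : (\int[U]_p (weight e m.+1%:R (g p) * X p)%:E <=
    \int[U]_p (weight e m.+1%:R (g p) * Y p)%:E)%E.
  apply: (le_trans (flux_ge_derivative nc lv t0 qd (ltr0Sn _ m) (Dt (e:=e) (m:=m) (c:=c) (b:=b)))).
  (* A real-valued integral is [fine] of an extended one; for a nonnegative integrand the inequality
     is in the required direction even at [+oo]. *)
  have fle (x : \bar R) : (0 <= x)%E -> ((fine x)%:E <= x)%E by case: x => [r| |]//=; rewrite leey.
  apply: le_trans (fle _ _) _.
    by apply: integral_ge0 => p _; rewrite lee_fin; exact: flux_ge0.
  rewrite le_eqVlt; apply/orP; left; apply/eqP; apply: ae_eq_integral => //.
  - apply/measurable_EFinP; apply: (measurableT_comp (measurable_flux nc lv e m.+1%:R (ratr c) b)).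
    exact: pair1_measurable.
  - apply/measurable_EFinP; apply: measurable_funM.
      exact: (measurableT_comp (@measurable_weight _ e m.+1%:R) mg).
    by have [/measurable_EFinP] := integrableP _ _ _ Yi.
  by apply: ae_U01P => p p01 _; rewrite /flux VE// mulrC.
apply: filterS2 (ae_U01_itv) (sign_transfer mg mE X0 Y0 Xi Yi EY XY) => p p01 EX Vp.
have : X p = 0 by apply: EX; rewrite /E/= /g addrK -/(vQ p) -VE.
by move=> /max_idPl.
Qed.

(** If the two values differed, a rational [q] would lie strictly between them, against [half] at
    the level [c = - q] with the appropriate sign. *)
Lemma derivative_velocity : {ae U01, forall p, h p = V (t, p)}.
Proof.
have H := ae_forall_countable (fun cb : rat * bool => half cb.1 cb.2).
apply: filterS H => p Hp; apply/eqP; rewrite eq_le; apply/andP; split.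
  rewrite leNgt; apply/negP => /rat_in_itvoo[q]; rewrite in_itv/= => /andP[q1 q2].
  have := Hp (- q, false); rewrite /= expr0 !mul1r rmorphN/= addrC subr_le0 => /(_ (ltW q1)).
  by rewrite addrC subr_le0 leNgt q2.
rewrite leNgt; apply/negP => /rat_in_itvoo[q]; rewrite in_itv/= => /andP[q1 q2].
have := Hp (- q, true); rewrite /= expr1 !mulN1r rmorphN/= !oppr_le0 addrC subr_ge0.
by move=> /(_ (ltW q2)); rewrite addrC subr_ge0 leNgt q1.
Qed.

End Pointwise.
End DerivativeVelocity.

(** * Gradient flows *)

Section GradientFlow.
Context {R : realType}.
Local Notation T := (measurableTypeR R).
Local Notation L := (@lebesgue_measure R).

(** [W2] is the L2 distance of the quantiles, so the same [d] works for both subdifferentials. The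
    infimum over optimal couplings is at most its value at the monotone one, which is the L2 inner
    product because [k] is [xi] composed with the quantile function. *)
Lemma L2_subdiff_frechet (F : (R -> R) -> \bar R) (mu : P2 R) (xi k : R -> R) :
  functional_on L2_01 F -> xi \in Lfun mu 2%:E ->
  L2_subdiff F (quantile mu) k -> {ae U01, forall p, k p = xi (quantile mu p)} ->
  frechet_subdiff (fun nu => F (quantile nu)) mu xi.
Proof.
move=> [FNy _] xiL [kL Foo H] kxi; split => // e e0.
have [d d0 Hd] := H e e0; exists d => // nu; rewrite W2_quantile => Wd.
have := Hd _ (L2_quantile nu) Wd.
set g := quantile nu; set f := quantile mu; set W := L2_01_norm _.
(* Finiteness allows [F f] to be moved across the inequality in the extended reals. *)
have Ffin : F f \is a fin_num by rewrite fin_numE FNy ?lt_eqF//; exact: L2_quantile.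
have mf : measurable_fun (setT : set T) f by exact: measurable_quantile.
have mg : measurable_fun (setT : set T) g by exact: measurable_quantile.
have mfg : measurable_fun (setT : set T) (fun p => (f p, g p)) by exact: measurable_fun_pair.
have Hpi B : measurable B -> law U01 mfg B = U01 ((fun p => (f p, g p)) @^-1` B) by [].
have [opt _] := mono_coupling mf mg (mono_quantile mu) (mono_quantile nu)
  (fun A mA => quantile_push mu mA) (fun A mA => quantile_push nu mA) Hpi.
have [mxi _] := (Lfun2P _ _).1 xiL; have [mk k2] := (Lfun2P _ _).1 kL.
have iE : (\int[law U01 mfg]_z (xi z.1 * (z.2 - z.1))%:E = (L2_01_inner k (g \- f)%R)%:E)%E.
  have mxi2 : measurable_fun setT (fun z : R * R => (xi z.1 * (z.2 - z.1))%:E).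
    apply/measurable_EFinP; apply: measurable_funM; first exact: measurableT_comp.
    exact: measurable_funB.
  rewrite (integral_image mfg Hpi mxi2) /L2_01_inner /Rintegral fineK; last first.
    have gfL : (g \- f)%R \in Lfun (@leb01 R) 2%:E.
      have [_ g2] := (Lfun2P _ _).1 (L2_quantile nu); have [_ f2] := (Lfun2P _ _).1 (L2_quantile mu).
      apply/Lfun2P; split; first exact: measurable_funB.
      apply: sqr_add_lty => //; first exact: measurableT_comp.
      by under eq_integral do rewrite sqrrN.
    have ik : (@leb01 R).-integrable setT (EFin \o (fun p => k p * (g \- f)%R p)).
      by apply/Lfun1_integrable; exact: Lfun2_mul_Lfun1 kL gfL.
    exact: integrable_fin_num ik.
  apply: ae_eq_integral => //.
  - exact: (measurableT_comp mxi2 mfg).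
  - by apply/measurable_EFinP; apply: measurable_funM => //; exact: measurable_funB.
  by apply: filterS kxi => p -> _.
have le_inf : (ereal_inf [set \int[pi]_z (xi z.1 * (z.2 - z.1))%:E | pi in opt_coupling mu nu]
    <= (L2_01_inner k (g \- f)%R)%:E)%E.
  by rewrite -iE; apply: ereal_inf_lbound; exists (law U01 mfg).
move=> Hg; rewrite leeBrDl//; apply: le_trans Hg.
by rewrite EFinB; apply: leeD2l; exact: leeB.
Qed.

Lemma gradient_flow_of_quantiles (gamma : R -> P2 R) (F : (R -> R) -> \bar R) :
  functional_on L2_01 F ->
  loc_abs_continuous `]0, +oo[ gamma ->
  {ae lebesgue_measure, forall t : R, 0 < t ->
     exists2 h, quantile_derivative gamma t h &
       L2_subdiff F (quantile (gamma t)) (fun p => - h p)} ->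
  wasserstein_gradient_flow (fun mu => F (quantile mu)) gamma.
Proof.
move=> FD [nc [v lv]] Hd; split => //; exists v => //.
have [_ vint _] := lv.
(* One null set of times for all weights, cut-offs, levels and signs together. *)
have D := ae_forall_countable (fun x : (bexp * nat) * (rat * bool) =>
  flux_differentiation nc lv x.1.1 x.1.2.+1%:R (ratr x.2.1) x.2.2).
have vL := ae_v_Lfun nc (velocity_measurable lv) vint.
have aeF : Filter (almost_everywhere L) by exact: (ae_filter_ringOfSetsType L).
apply: (@filterS3 _ _ aeF _ _ _ _ _ vL D Hd) => t vLt Dt Hdt t0.
have vt := vLt t0; have [h qd sub] := Hdt t0.
split; first exact: tangent_Lfun.
have mvt := measurable_v_slice (velocity_measurable lv) t0.
apply: L2_subdiff_frechet (FD) _ sub _.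
  have [m2 v2] := (Lfun2P _ _).1 vt; apply/Lfun2P; split.
    exact: measurableT_comp.
  by under eq_integral do rewrite sqrrN.
have hV := derivative_velocity nc lv t0 qd vt (fun e m c b => Dt ((e, m), (c, b)) t0).
apply: filterS2 (ae_U01_itv) hV => p p01 ->.
by rewrite /Vh /Qh /dom/= t0 p01.
Qed.
End GradientFlow.

Theorem theorem2 (R : realType) :
  (forall (gamma : R -> P2 R) (F : (R -> R) -> \bar R),
     functional_on L2_01 F ->
     loc_abs_continuous `]0, +oo[ gamma ->
     {ae lebesgue_measure, forall t : R, 0 < t ->
        exists2 h, quantile_derivative gamma t h &
          L2_subdiff F (quantile (gamma t)) (fun p => - h p)} ->
     wasserstein_gradient_flow (fun mu => F (quantile mu)) gamma) /\
  (forall F : (R -> R) -> \bar R,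
     functional_on cone01 F ->
     convex_on cone01 F ->
     convex_along_geodesics (fun mu => F (quantile mu))).
Proof.
split; first exact: gradient_flow_of_quantiles.
move=> F fF cF mu nu _ _; exists (interpolation mu nu); exact: convex_interpolation.
Qed.
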